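(* Let $d\in\mathbb{N}$, $\alpha\in(d-1,\infty)$ and $\Sigma\in\mathcal{S}_{++}^d$ be given, and let $\mathfrak{W}$ be an $\mathcal{S}_{++}^d$-valued random matrix. Then $$\mathfrak{W}\sim\mathcal{W}_d(\alpha,\Sigma)\quad\Longleftrightarrow\quad\mathsf{E}\big[\mathcal{A}^{\mathcal{W}}f(\mathfrak{W})\big]=0\ \text{ for all } f\in C^2_{\mathcal{A}^{\mathcal{W}}}(\mathcal{S}_{++}^d),$$ where $$\mathcal{A}^{\mathcal{W}}f(S)=2\,\mathrm{tr}\{(\alpha\Sigma-S)\nabla f(S)\}+4\,\mathrm{tr}\{S\nabla\Sigma\nabla f(S)\},\qquad S\in\mathcal{S}_{++}^d,$$ and, for $\mathfrak{W}_\infty\sim\mathcal{W}_d(\alpha,\Sigma)$, $C^2_{\mathcal{A}^{\mathcal{W}}}(\mathcal{S}_{++}^d)$ is the class of all $f\in C^2(\mathcal{S}_{++}^d)$ (real-valued, twice continuously differentiable) such that $$\mathsf{E}[|\mathrm{tr}\{\Sigma\nabla f(\mathfrak{W}_\infty)\}|]<\infty,\quad \mathsf{E}[|\mathrm{tr}\{\mathfrak{W}_\infty\nabla f(\mathfrak{W}_\infty)\}|]<\infty,\quad \mathsf{E}[|\mathrm{tr}\{\mathfrak{W}_\infty\nabla\Sigma\nabla f(\mathfrak{W}_\infty)\}|]<\infty,$$ $$\mathsf{E}[|f(\mathfrak{W}_\infty)|]<\infty,\quad\text{and}\quad \mathsf{E}\big[\|\mathfrak{W}_\infty^{1/2}\nabla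 f(\mathfrak{W}_\infty)\Sigma^{1/2}\|_F^2\big]<\infty .$$
   Context: $\mathcal{S}_{++}^d$ is the set of real positive definite $d\times d$ matrices; $\|\cdot\|_F$ is the Frobenius norm; $S^{1/2}$ is the nonnegative definite square root. $\nabla=(\tfrac12(1+\delta_{ij})\,\partial/\partial S_{ij})_{1\le i,j\le d}$ is the symmetric gradient (partial derivatives with respect to the free entries $S_{ij}=S_{ji}$), and $\mathrm{tr}\{S\nabla\Sigma\nabla f(S)\}=\sum_{i,j,k,\ell}S_{ij}\Sigma_{k\ell}\nabla_{jk}\nabla_{\ell i}f(S)$ (derivatives act only on $f$). For $\alpha>d-1$ and $\Sigma\in\mathcal{S}_{++}^d$, $\mathcal{W}_d(\alpha,\Sigma)$ is the (central) Wishart law on $\mathcal{S}_{++}^d$ with density $|X|^{\alpha/2-(d+1)/2}\exp\{-\mathrm{tr}(\Sigma^{-1}X)/2\}/\{|2\Sigma|^{\alpha/2}\Gamma_d(\alpha/2)\}$, where $|\cdot|$ is the determinant and $\Gamma_d(\nu)=\int_{\mathcal{S}_{++}^d}e^{-\mathrm{tr}X}|X|^{\nu-(d+1)/2}\,\mathrm{d}X$. *)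

(* Defs.v *)
From HB Require Import structures.
From mathcomp Require Import all_boot all_order all_algebra lra.
From mathcomp Require Import all_classical all_reals all_analysis.
From mathcomp Require Import measurable_realfun.

Set Implicit Arguments.
Unset Strict Implicit.
Unset Printing Implicit Defensive.
Import Order.TTheory GRing.Theory Num.Theory.
Import numFieldNormedType.Exports.
Local Open Scope classical_set_scope.
Local Open Scope ring_scope.

Lemma pushforward_semi_sigma_additive d1 d2 (T1 : measurableType d1)
    (T2 : measurableType d2) (R : realType) (mu : {measure set T1 -> \bar R})
    (f : T1 -> T2) :
  measurable_fun setT f -> semi_sigma_additive (pushforward mu f).
Proof.
move=> mf; have mp A : measurable A -> measurable (f @^-1` A).
  by rewrite -[X in _ -> measurable X]setTI; exact: mf.
move=> F mF tF mUF; rewrite /pushforward preimage_bigcup.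
apply: measure_semi_sigma_additive => [k||].
- by apply: mp; exact: mF.
- apply/trivIsetP => /= i j _ _ ij; rewrite -preimage_setI.
  by move/trivIsetP : tF => /(_ _ _ _ _ ij) ->//; rewrite preimage_set0.
- by rewrite -preimage_bigcup; exact: mp.
Qed.

(* Lebesgue measure on n.-tuple R (with its product sigma-algebra), as an
   iterated product of the Lebesgue measure on R. *)
Section lebesgue_tuple.
Context {R : realType}.
Local Open Scope ereal_scope.

Definition cons_pair n (p : R * n.-tuple R) : n.+1.-tuple R :=
  [tuple of p.1 :: p.2].

Lemma measurable_cons_pair n :
  measurable_fun [set: R * n.-tuple R] (@cons_pair n).
Proof. exact: measurable_cons. Qed.

Definition cons_measure n (mu : set (n.-tuple R) -> \bar R) :
    set (n.+1.-tuple R) -> \bar R :=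
  pushforward (@lebesgue_measure R \x mu) (@cons_pair n).

Section cons_measure_instance.
Variables (n : nat) (mu : {sigma_finite_measure set (n.-tuple R) -> \bar R}).

Let cons_measure0 : cons_measure mu set0 = 0.
Proof. by rewrite /cons_measure /pushforward preimage_set0 measure0. Qed.

Let cons_measure_ge0 A : 0 <= cons_measure mu A.
Proof. by rewrite /cons_measure /pushforward measure_ge0. Qed.

Let cons_measure_sigma_additive : semi_sigma_additive (cons_measure mu).
Proof.
by apply: pushforward_semi_sigma_additive; exact: measurable_cons_pair.
Qed.

HB.instance Definition _ := isMeasure.Build _ _ _ (cons_measure mu)
  cons_measure0 cons_measure_ge0 cons_measure_sigma_additive.

Let cons_measure_sigma_finite : sigma_finite setT (cons_measure mu).
Proof.
have /sigma_finiteP[F [FT ndF Foo]] := sigma_finiteT (@lebesgue_measure R).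
have /sigma_finiteP[G [GT ndG Goo]] := sigma_finiteT mu.
pose g (t : n.+1.-tuple R) : R * n.-tuple R := (thead t, [tuple of behead t]).
have fK : cancel (@cons_pair n) g.
  by case=> x t; rewrite /g /cons_pair theadE; congr (_, _); exact: val_inj.
have mg : measurable_fun setT g.
  apply: measurable_fun_pair; first exact: measurable_tnth.
  exact: measurable_behead.
exists (fun k => g @^-1` (F k `*` G k)) => [|k].
  apply/esym; rewrite -subTset => t _.
  have : setT (g t).1 by []. rewrite FT => -[k _ Fk].
  have : setT (g t).2 by []. rewrite GT => -[l _ Gl].
  exists (maxn k l) => //; split.
  - by move: (_.1) Fk; exact/subsetPset/ndF/leq_maxl.
  - by move: (_.2) Gl; exact/subsetPset/ndG/leq_maxr.
have [mF Fk] := Foo k; have [mG Gk] := Goo k; split.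
  by rewrite -[X in measurable X]setTI; apply: mg => //; exact: measurableX.
rewrite /cons_measure /pushforward -comp_preimage.
rewrite (_ : g \o _ = id); last by apply/funext => x /=; rewrite fK.
by rewrite preimage_id product_measure1E// lte_mul_pinfty// ge0_fin_numE.
Qed.

HB.instance Definition _ := Measure_isSigmaFinite.Build _ _ _ (cons_measure mu)
  cons_measure_sigma_finite.

End cons_measure_instance.

Fixpoint lebesgue_tuple n : {sigma_finite_measure set (n.-tuple R) -> \bar R} :=
  match n with
  | 0 => \d_([tuple] : 0.-tuple R)
  | m.+1 => cons_measure (lebesgue_tuple m)
  end.

End lebesgue_tuple.

(* Real matrices carry the product sigma-algebra, generated by the entries. *)
Definition measure_mx_display : measure_display -> measure_display.
Proof. exact. Qed.

Section measurable_mx.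
Context {R : realType} {m n : nat}.

Definition mx_cylinder : set (set 'M[R]_(m, n)) :=
  [set [set M : 'M[R]_(m, n) | B (M ij.1 ij.2)]
     | ij in [set: 'I_m * 'I_n] & B in @measurable _ R].

Let mx_set0 : <<s mx_cylinder >> set0.
Proof. exact: sigma_algebra0. Qed.

Let mx_setC A : <<s mx_cylinder >> A -> <<s mx_cylinder >> (~` A).
Proof. exact: sigma_algebraC. Qed.

Let mx_bigcup (F : _^nat) : (forall i, <<s mx_cylinder >> (F i)) ->
  <<s mx_cylinder >> (\bigcup_i (F i)).
Proof. exact: sigma_algebra_bigcup. Qed.

HB.instance Definition _ := @isMeasurable.Build
  (measure_mx_display ((R.-ocitv.-measurable).-sigma)%mdisp) 'M[R]_(m, n)
  <<s mx_cylinder >> mx_set0 mx_setC mx_bigcup.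


Lemma measurable_mx_coord i j :
  measurable_fun [set: 'M[R]_(m, n)] (fun M : 'M[R]_(m, n) => M i j : R).
Proof.
move=> _ B mB; rewrite setTI; apply: sub_sigma_algebra.
by exists (i, j) => //; exists B.
Qed.

Lemma measurable_fun_mx d (T : measurableType d) (f : T -> 'M[R]_(m, n)) :
  (forall i j, measurable_fun setT (fun x => f x i j)) -> measurable_fun setT f.
Proof.
move=> mf; apply: (@measurability _ _ _ _ _ _ mx_cylinder) => //.
move=> _ [_ [[i j] _ [B mB <-]] <-].
exact: mf.
Qed.

End measurable_mx.

Section symmetric_matrices.
Context {R : realType} {d : nat}.
Implicit Types S : 'M[R]_d.

Definition psdmx S : Prop :=
  S^T = S /\ forall u : 'rV[R]_d, 0 <= (u *m S *m u^T) 0 0.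

Definition posdefmx S : Prop :=
  S^T = S /\ forall u : 'rV[R]_d, u != 0 -> 0 < (u *m S *m u^T) 0 0.

Definition sqrtmx S : 'M[R]_d := get [set B | psdmx B /\ B *m B = S].

(* Coordinates of a symmetric matrix by its free entries, i.e. those with
   i <= j: the entry (i, j), i <= j, has rank i + (1 + ... + j) when the upper
   triangle is read column by column. *)
Definition sym_of_tuple (t : 'C(d.+1, 2).-tuple R) : 'M[R]_d :=
  \matrix_(i, j) t`_('C((maxn i j).+1, 2) + minn i j)%N.

Lemma measurable_sym_of_tuple : measurable_fun setT sym_of_tuple.
Proof.
apply: measurable_fun_mx => i j; under eq_fun do rewrite mxE.
set k := ('C((maxn i j).+1, 2) + minn i j)%N.
have [kd|dk] := ltnP k 'C(d.+1, 2).
  under eq_fun do rewrite -[k]/(val (Ordinal kd)) -tnth_nth.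
  exact: measurable_tnth.
under eq_fun do rewrite nth_default ?size_tuple//.
exact: measurable_cst.
Qed.

(* The measure dX = \prod_(i <= j) dX_ij on symmetric matrices. *)
Definition sym_lebesgue : set 'M[R]_d -> \bar R :=
  pushforward (@lebesgue_tuple R 'C(d.+1, 2)) sym_of_tuple.

Let sym_lebesgue0 : sym_lebesgue set0 = 0%E.
Proof. by rewrite /sym_lebesgue /pushforward preimage_set0 measure0. Qed.

Let sym_lebesgue_ge0 A : (0 <= sym_lebesgue A)%E.
Proof. by rewrite /sym_lebesgue /pushforward measure_ge0. Qed.

Let sym_lebesgue_sigma_additive : semi_sigma_additive sym_lebesgue.
Proof.
apply: pushforward_semi_sigma_additive; exact: measurable_sym_of_tuple.
Qed.

HB.instance Definition _ := isMeasure.Build _ _ _ sym_lebesgue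
  sym_lebesgue0 sym_lebesgue_ge0 sym_lebesgue_sigma_additive.

Let qform (u : 'rV[R]_d) S := (u *m S *m u^T) 0 0.

Let qformE u S : qform u S = \sum_j (\sum_i u 0 i * S i j) * u 0 j.
Proof.
rewrite /qform mxE; apply: eq_bigr => j _.
by rewrite !mxE.
Qed.

Let measurable_qform u : measurable_fun setT (qform u).
Proof.
rewrite (_ : qform u = fun S => \sum_j (\sum_i u 0 i * S i j) * u 0 j);
  last by apply/funext => S; rewrite qformE.
apply: measurable_sum => j; apply: measurable_funM => //.
apply: measurable_sum => i; apply: measurable_funM => //.
exact: measurable_mx_coord.
Qed.

Lemma measurable_det : measurable_fun setT (fun S => \det S).
Proof.
apply: measurable_sum => s; apply: measurable_funM => //.
apply: measurable_prod => i _.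
exact: measurable_mx_coord.
Qed.

Let psdmx_rat S : S^T = S ->
  (forall v : 'rV[rat]_d, 0 <= qform (map_mx ratr v) S) -> psdmx S.
Proof.
move=> symS qS; split=> // u; rewrite -/(qform u S) leNgt; apply/negP => qu.
have qc : continuous (qform^~ S).
  rewrite (_ : qform^~ S = fun u => \sum_j (\sum_i u 0 i * S i j) * u 0 j);
    last by apply/funext => v; rewrite qformE.
  have add_cont : continuous (fun x : R * R => x.1 + x.2).
    by move=> x; exact: add_continuous.
  move=> v; apply: (@cvg_big _ _ _ _ _ add_cont _ (nbhs v)) => j _.
  apply: cvgM; last exact: coord_continuous.
  apply: (@cvg_big _ _ _ _ _ add_cont _ (nbhs v)) => i _; apply: cvgMr_tmp.
  exact: coord_continuous.
have /nbhs_ballP[e /= e0 he] : nbhs u [set v | qform v S < 0].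
  have := qc u => /cvgr_lt; exact.
have /choice[r hr] : forall j, exists q : rat, ball (u 0 j) e (ratr q : R).
  move=> j; have bne : ball (u 0 j) e !=set0 by exists (u 0 j); exact: ballxx.
  have [x [ux [q _ qE]]] := dense_rat bne (ball_open _ _).
  by exists q; rewrite qE.
have : qform (map_mx ratr (\row_j r j)) S < 0.
  apply: he; split => // i j; rewrite !mxE ord1.
  exact: hr.
by rewrite ltNge qS.
Qed.

Lemma posdefmxE S : posdefmx S <-> psdmx S /\ \det S != 0.
Proof.
split=> [[symS pS]|[[symS pS] dS]].
  split; first split=> // u.
    have [->|/pS/ltW//] := eqVneq u 0.
    by rewrite !mul0mx mxE.
  apply/eqP => /eqP/det0P[u u0 uS].
  by have := pS _ u0; rewrite uS mul0mx mxE ltxx.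
split=> // u u0; rewrite lt_def pS andbT; apply/negP => /eqP qu0.
suff uS : u *m S = 0 by move/eqP: dS; apply; apply/eqP/det0P; exists u.
have [v vE] : {v | v = u *m S} by exists (u *m S).
rewrite -vE.
pose b := (v *m v^T) 0 0; pose c := (v *m S *m v^T) 0 0.
have vSu : (v *m S *m u^T) 0 0 = b.
  by rewrite -mulmxA -{1}symS -trmx_mul -vE.
have c0 : 0 <= c by exact: pS.
have b0 : 0 <= b.
  by rewrite /b mxE; apply: sumr_ge0 => j _; rewrite mxE -expr2 sqr_ge0.
have DE (M N : 'M[R]_1) : (M + N) 0 0 = M 0 0 + N 0 0 by rewrite mxE.
have ZE a (M : 'M[R]_1) : (a *: M) 0 0 = a * M 0 0 by rewrite mxE.
have qt t : 0 <= t * b + (t * b + t * (t * c)).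
  have := pS (u + t *: v); rewrite linearD/= linearZ/= !mulmxDl !mulmxDr.
  by rewrite -!scalemxAl -!scalemxAr !(DE, ZE) vSu qu0 add0r -vE.
have {}b0 : b = 0.
  apply/eqP; rewrite eq_le b0 andbT leNgt; apply/negP => bgt0.
  have c1 : 0 < 1 + c by rewrite ltr_pwDl.
  pose t := b / (1 + c); have t0 : 0 < t by rewrite divr_gt0.
  have tE : b = t * (1 + c) by rewrite divfK ?gt_eqF.
  by have := qt (- t); rewrite tE; nra.
apply/rowP => j; rewrite mxE; apply/eqP; rewrite -sqrf_eq0.
move: b0; rewrite /b mxE => /eqP; rewrite psumr_eq0 => [/allP/(_ j)|k _].
  by rewrite mem_index_enum mxE -expr2 => /(_ isT).
by rewrite mxE -expr2 sqr_ge0.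
Qed.

Lemma measurable_posdefmx : measurable [set S | posdefmx S].
Proof.
rewrite (_ : [set S | _] = [set S | S^T = S] `&`
    (\bigcap_(v : 'rV[rat]_d) [set S | 0 <= qform (map_mx ratr v) S]) `&`
    [set S | \det S != 0]); last first.
  apply/seteqP; split=> S /=.
    by move=> /posdefmxE[[symS qS] dS]; split=> //; split=> // v _; exact: qS.
  move=> [[symS qS] dS]; apply/posdefmxE; split=> //; apply: psdmx_rat => // v.
  exact: qS.
apply: measurableI; first apply: measurableI.
- rewrite (_ : (fun S => _) = \bigcap_(ij in [set: 'I_d * 'I_d])
      [set S | S ij.2 ij.1 = S ij.1 ij.2]); last first.
    apply/seteqP; split=> S /= symS.
      by move=> [i j] _ /=; rewrite -[in RHS]symS mxE.
    by apply/matrixP => i j; rewrite mxE; exact: (symS (i, j)).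
  apply: fin_bigcap_measurable => // -[i j] _ /=.
  rewrite (_ : (fun S => _) = setT `&`
      (fun S : 'M[R]_d => S j i - S i j) @^-1` [set 0]); last first.
    rewrite setTI; apply/seteqP; split=> S /=.
      by move=> ->; rewrite subrr.
    by move/eqP; rewrite subr_eq0 => /eqP.
  apply: measurable_funB => //; exact: measurable_mx_coord.
- rewrite -[X in measurable X]setCK setC_bigcap; apply: measurableC.
  apply: countable_bigcupT_measurable => // v; apply: measurableC.
  rewrite -[X in measurable X]setTI.
  apply: measurable_fun_le => //; exact: measurable_qform.
- rewrite (_ : (fun S => _) = ~` (@determinant R d @^-1` [set 0])); last first.
    by apply/seteqP; split=> S /= /eqP.
  apply: measurableC; rewrite -[X in measurable X]setTI.
  exact: measurable_det.
Qed.

End symmetric_matrices.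

Section wishart.
Context {R : realType} {d : nat}.
Implicit Types (alpha nu : R) (Sigma X : 'M[R]_d).

Definition multigamma nu : R :=
  \int[@sym_lebesgue R d]_(X in posdefmx)
    (expR (- \tr X) * (\det X) `^ (nu - (d%:R + 1) / 2)).

Definition wishart_pdf alpha Sigma X : R :=
  (\det X) `^ (alpha / 2 - (d%:R + 1) / 2)
    * expR (- (\tr (invmx Sigma *m X) / 2))
    / ((\det (2 *: Sigma)) `^ (alpha / 2) * multigamma (alpha / 2)).

Definition wishart alpha Sigma : set 'M[R]_d -> \bar R := fun V =>
  (\int[sym_lebesgue]_(X in V `&` posdefmx) (wishart_pdf alpha Sigma X)%:E)%E.

Lemma wishart_pdf_ge0 alpha Sigma X : 0 <= wishart_pdf alpha Sigma X.
Proof.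
rewrite /wishart_pdf divr_ge0 ?mulr_ge0 ?powR_ge0 ?expR_ge0//.
by apply: fine_ge0; apply: integral_ge0 => Y _;
  rewrite lee_fin mulr_ge0 ?expR_ge0 ?powR_ge0.
Qed.

Lemma measurable_wishart_pdf alpha Sigma :
  measurable_fun setT (wishart_pdf alpha Sigma).
Proof.
apply: measurable_funM => //; apply: measurable_funM.
  apply: (measurableT_comp (measurable_powR _)); exact: measurable_det.
apply: measurableT_comp => //; apply: measurableT_comp => //.
apply: measurable_funM => //.
apply: measurable_sum => i; under eq_fun do rewrite mxE.
apply: measurable_sum => j; apply: measurable_funM => //.
exact: measurable_mx_coord.
Qed.

Section wishart_measure.
Variables (alpha : R) (Sigma : 'M[R]_d).

Let wishart0 : wishart alpha Sigma set0 = 0%E.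
Proof. by rewrite /wishart set0I integral_set0. Qed.

Let wishart_ge0 A : (0 <= wishart alpha Sigma A)%E.
Proof. by apply: integral_ge0 => X _; rewrite lee_fin wishart_pdf_ge0. Qed.

Let wishart_sigma_additive : semi_sigma_additive (wishart alpha Sigma).
Proof.
move=> F mF tF mUF; rewrite /wishart setI_bigcupl ge0_integral_bigcup//=.
- by apply: is_cvg_ereal_nneg_natsum_cond => n _ _; exact: wishart_ge0.
- by move=> k; apply: measurableI => //; exact: measurable_posdefmx.
- apply/measurable_EFinP; apply: measurable_funTS.
  exact: measurable_wishart_pdf.
- by move=> X _; rewrite lee_fin wishart_pdf_ge0.
- exact: trivIset_setIr.
Qed.

HB.instance Definition _ := isMeasure.Build _ _ _ (wishart alpha Sigma)
  wishart0 wishart_ge0 wishart_sigma_additive.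

End wishart_measure.
End wishart.

Section stein_operator.
Context {R : realType} {d : nat}.
Implicit Types (alpha : R) (f : 'M[R]_d -> R) (S Sigma M : 'M[R]_d)
  (i j : 'I_d).

Definition frobenius_norm M : R := Num.sqrt (\sum_i \sum_j M i j ^+ 2).

(* Direction in which only the free entry S_ij = S_ji moves, at unit speed. *)
Definition free_dir i j : 'M[R]_d :=
  if i == j then delta_mx i i else delta_mx i j + delta_mx j i.

Definition partial i j f S : R := 'D_(free_dir i j) f S.

Definition nabla i j f S : R := (1 + (i == j)%:R) / 2 * partial i j f S.

Definition grad f S : 'M[R]_d := \matrix_(i, j) nabla i j f S.

(* tr {S nabla Sigma nabla f(S)}, where the derivatives act on f only *)
Definition tr_second_order Sigma f S : R :=
  \sum_i \sum_j \sum_k \sum_l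
    S i j * Sigma k l * nabla j k (nabla l i f) S.

Definition stein_op alpha Sigma f S : R :=
  2 * \tr ((alpha *: Sigma - S) *m grad f S) + 4 * tr_second_order Sigma f S.

(* Functions on the open cone are represented by functions on all matrices;
   only their values on the cone matter below, since free_dir i j is
   symmetric. *)
Definition C1_posdef f : Prop := forall i j,
  (forall S, posdefmx S -> derivable f S (free_dir i j)) /\
  {within posdefmx, continuous (partial i j f)}.

Definition C2_posdef f : Prop :=
  C1_posdef f /\ forall i j, C1_posdef (partial i j f).

(* E|g(X)| < oo for X with law mu carried by the positive definite cone *)
Definition finite_mean (mu : set 'M[R]_d -> \bar R) (g : 'M[R]_d -> R) : Prop :=
  (\int[mu]_(X in posdefmx) `|g X|%:E < +oo)%E.

Definition C2_stein alpha Sigma f : Prop :=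
  let E_fin := finite_mean (wishart alpha Sigma) in
  [/\ C2_posdef f,
      E_fin (fun S => \tr (Sigma *m grad f S)),
      E_fin (fun S => \tr (S *m grad f S)),
      E_fin (tr_second_order Sigma f) &
      E_fin f /\
      E_fin (fun S =>
        frobenius_norm (sqrtmx S *m grad f S *m sqrtmx Sigma) ^+ 2)].

End stein_operator.

(* Main.v *)
Require Import Defs.
From HB Require Import structures.
From mathcomp Require Import all_boot all_order all_algebra ring lra zify.
From mathcomp Require Import all_classical all_reals all_analysis.
From mathcomp Require Import measurable_realfun.

(* Stein identity: with w(X) = |X|^b exp(- tr (B X)), B = Sigma^-1 / 2 and
   b = (alpha - d - 1) / 2, the divergence of the field w Sigma (grad f) X in
   the symmetric coordinates is w (A f) / 4. Integrating it over the cone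
   against cutoffs chi(log |X| / n) chi(tr (B X) / n) kills the boundary terms,
   and the terms where a cutoff is differentiated are O(1 / n) times
   |w tr (Sigma grad f)| + |w tr (X grad f)|, so E (A f) = 0 in the limit.

   Conversely, only the test functions f(X) = exp(- tr (Th X)) are needed. Along
   the path Th_s = (s Psi + 2 (s - 1) Sigma)^-1, s > 1, the identity
   E (A f) = 0 becomes the linear equation s phi' = alpha tr (Sigma Th_s) phi
   for the Laplace transform phi(s) = E exp(- tr (Th_s W)), with phi -> 1 at
   infinity. The Wishart law satisfies the same equation, so the two Laplace
   transforms agree on the cone; and they determine the law, because
   polynomials in exp(- tr (Th X)) approximate the indicator functions of the
   half-spaces {c < tr (Th X)}.

   That the Wishart density has mass one is not known beforehand. Its
   normalization is obtained by applying the Stein identity to linear functions,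
   which shows that |B|^(alpha / 2) times the integral of w does not depend on
   B. If the multivariate gamma integral were infinite (0 in the definition),
   the Wishart measure would vanish and every C^2 function would be a test
   function; f(X) = exp(tr (Sigma^-1 X)), for which A f > 0, excludes this. *)

Set Implicit Arguments.
Unset Strict Implicit.
Unset Printing Implicit Defensive.
Import Order.TTheory GRing.Theory Num.Theory.
Import numFieldNormedType.Exports.
Local Open Scope classical_set_scope.
Local Open Scope ring_scope.

(** * Positive definite matrices *)

(** The cutoffs depend on log |X| and tr (B X) because the gradients of these are X^-1 and B: paired
    with the field Sigma (grad f) X they give tr (Sigma grad f) and tr (X grad f) / 2, two of the
    quantities assumed integrable. Nothing is known of f near the boundary of the cone or at
    infinity, so integration by parts is done only for fields supported in a compact part of the
    cone. Extended by zero to the space of free entries, they need only Fubini and the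
    one-dimensional fundamental theorem.

    For f(X) = exp(- tr (Th X)) the Stein identity is a first-order linear partial differential
    equation: the derivative of the Laplace transform in the direction Th + 2 Th Sigma Th is - alpha
    tr (Sigma Th) times the transform. The path Th_s is a characteristic: s Th' = - (Th + 2 Th Sigma
    Th) becomes the linear equation s U' = U + 2 Sigma for U = Th^-1, with U = Psi at s = 1.

    The identity for linear functions gives the logarithmic derivative in B of the integral of w. It
    replaces the change of variables X -> L X L^T and its Jacobian on symmetric matrices. *)

Section posdef_algebra.
Context {R : realType}.

Definition normsq n (u : 'rV[R]_n) : R := (u *m u^T) 0 0.

Lemma normsqE n (u : 'rV[R]_n) : normsq u = \sum_i u 0 i ^+ 2.
Proof. by rewrite /normsq mxE; apply: eq_bigr => i _; rewrite mxE expr2. Qed.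

Lemma normsq_ge0 n (u : 'rV[R]_n) : 0 <= normsq u.
Proof. by rewrite normsqE sumr_ge0// => i _; rewrite sqr_ge0. Qed.

Lemma normsq_gt0 n (u : 'rV[R]_n) : u != 0 -> 0 < normsq u.
Proof.
move=> u0; rewrite lt_def normsq_ge0 andbT; apply: contra_neq u0.
rewrite normsqE => /eqP; rewrite psumr_eq0 => [/allP h|i _]; last exact: sqr_ge0.
apply/rowP => j; rewrite mxE; apply/eqP; rewrite -sqrf_eq0.
by rewrite (implyP (h j (mem_index_enum _)))//.
Qed.

Lemma sqr_coord_le_normsq n (u : 'rV[R]_n) i : u 0 i ^+ 2 <= normsq u.
Proof.
by rewrite normsqE (bigD1 i)//= lerDl sumr_ge0// => j _; rewrite sqr_ge0.
Qed.

Lemma normsq_mulmx_bound m n (M : 'M[R]_(m, n)) :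
  exists2 C, 0 < C & forall u, normsq (u *m M) <= C * normsq u.
Proof.
exists (1 + \sum_j (\sum_k `|M k j|) ^+ 2).
  by rewrite ltr_pwDl// sumr_ge0// => j _; rewrite sqr_ge0.
move=> u; rewrite (le_trans (_ : _ <= (\sum_j (\sum_k `|M k j|) ^+ 2) * normsq u))//; last first.
  by rewrite ler_wpM2r ?normsq_ge0// lerDr.
rewrite normsqE mulr_suml; apply: ler_sum => j _.
rewrite -(sqr_sqrtr (normsq_ge0 u)) -exprMn -[leLHS]real_normK ?num_real//.
rewrite lerXn2r ?nnegrE ?mulr_ge0 ?sumr_ge0 ?sqrtr_ge0//.
rewrite mxE (le_trans (ler_norm_sum _ _ _))// mulr_suml ler_sum// => k _.
rewrite normrM mulrC ler_wpM2l//.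
by rewrite -[leLHS]sqrtr_sqr ler_wsqrtr// sqr_coord_le_normsq.
Qed.

Definition qform n (u : 'rV[R]_n) (S : 'M[R]_n) : R := (u *m S *m u^T) 0 0.

Lemma qformD n (u : 'rV[R]_n) S T : qform u (S + T) = qform u S + qform u T.
Proof. by rewrite /qform mulmxDr mulmxDl mxE. Qed.

Lemma qformZ n (u : 'rV[R]_n) a S : qform u (a *: S) = a * qform u S.
Proof. by rewrite /qform -scalemxAr -scalemxAl mxE. Qed.

Lemma qform_congr n (u : 'rV[R]_n) S (A : 'M[R]_n) :
  qform u (A *m S *m A^T) = qform (u *m A) S.
Proof. by rewrite /qform trmx_mul !mulmxA. Qed.

Lemma qform_gram n (u : 'rV[R]_n) (L : 'M[R]_n) :
  qform u (L^T *m L) = normsq (u *m L^T).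
Proof. by rewrite /qform /normsq trmx_mul trmxK !mulmxA. Qed.

(** Cholesky factorization, by induction on the size through the Schur complement of the upper left
    entry. The factor stands in for the spectral theorem in what follows: signs of determinants and
    traces and lower bounds of quadratic forms are read off it. *)
Lemma posdef_gram n (S : 'M[R]_n) : posdefmx S -> exists L : 'M[R]_n, S = L^T *m L.
Proof.
elim: n S => [|n IHn] S [symS pS].
  by exists 0; apply/matrixP => -[].
rewrite -[n.+1]/(1 + n)%N in S symS pS *.
set a := ulsubmx S 0 0; set y := ursubmx S; set Z := drsubmx S.
have SE : S = block_mx a%:M y y^T Z.
  rewrite -[S]submxK; congr block_mx; first by rewrite [LHS]mx11_scalar.
  by rewrite /y trmx_ursub symS.
have ZT : Z^T = Z by rewrite /Z trmx_drsub symS.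
have qE (t : R) v : qform (row_mx t%:M v) S =
   t ^+ 2 * a + 2 * t * (v *m y^T) 0 0 + qform v Z.
  rewrite /qform SE mul_row_block tr_row_mx mul_row_col !mulmxDl tr_scalar_mx.
  rewrite !mul_scalar_mx !mul_mx_scalar -!scalemxAl.
  have -> : y *m v^T = (v *m y^T)^T by rewrite trmx_mul trmxK.
  by rewrite !mxE eqxx/= mulr1n; ring.
have a0 : 0 < a.
  have := pS (row_mx 1%:M (0 : 'rV_n)); rewrite -/(qform _ S) qE mul0mx /qform !mul0mx !mxE.
  rewrite mulr0 !addr0 expr1n mul1r; apply.
  apply/eqP => /matrixP/(_ 0 (lshift _ 0)); rewrite row_mxEl !mxE/= => /eqP.
  by rewrite oner_eq0.
have [|L' L'E] := IHn (Z - a^-1 *: (y^T *m y)).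
  split=> [|v v0]; first by rewrite linearB linearZ/= trmx_mul trmxK ZT.
  rewrite -/(qform _ _) -scaleNr qformD qformZ.
  (* This [t] minimizes the form of [S] at (t, v) for fixed [v]; the minimum is the form of the
     Schur complement at [v]. *)
  pose t := - a^-1 * (v *m y^T) 0 0.
  have := pS (row_mx t%:M v); rewrite -/(qform _ S) qE => /(_ _)/lt_le_trans; apply.
    apply: contra_neq v0 => /matrixP h; apply/rowP => j.
    by have := h 0 (rshift _ j); rewrite row_mxEr !mxE.
  have -> : qform v (y^T *m y) = (v *m y^T) 0 0 ^+ 2.
    rewrite /qform -!mulmxA [RHS]expr2 mulmxA mxE big_ord1; congr *%R.
    by rewrite (_ : y *m v^T = (v *m y^T)^T) ?mxE// trmx_mul trmxK.
  by rewrite /t le_eqVlt; apply/orP; left; apply/eqP; field; rewrite gt_eqF.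
exists (block_mx (Num.sqrt a)%:M ((Num.sqrt a)^-1 *: y) 0 L').
have s0 : Num.sqrt a != 0 by rewrite gt_eqF// sqrtr_gt0.
rewrite tr_block_mx mulmx_block trmx0 !mul0mx !mulmx0 !addr0 tr_scalar_mx.
rewrite [LHS]SE; congr block_mx.
- by rewrite -scalar_mxM -expr2 sqr_sqrtr// ltW.
- by rewrite mul_scalar_mx scalerA divff// scale1r.
- by rewrite mul_mx_scalar linearZ/= scalerA divff// scale1r.
- rewrite [(_ *: y)^T]linearZ/= -scalemxAl -scalemxAr scalerA -invfM -expr2 sqr_sqrtr ?ltW//.
  by rewrite -L'E addrC subrK.
Qed.

Lemma posdef_psd n (S : 'M[R]_n) : posdefmx S -> psdmx S.
Proof. by move/posdefmxE => []. Qed.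

Lemma posdef_det_gt0 n (S : 'M[R]_n) : posdefmx S -> 0 < \det S.
Proof.
move=> pS; have [_ dS] := (posdefmxE S).1 pS.
have [L LE] := posdef_gram pS; move: dS; rewrite {}LE det_mulmx det_tr -expr2.
by move=> d0; rewrite lt_def d0 sqr_ge0.
Qed.

Lemma posdef_unit n (S : 'M[R]_n) : posdefmx S -> S \in unitmx.
Proof. by move=> pS; rewrite unitmxE unitfE gt_eqF// posdef_det_gt0. Qed.

(** The form is the squared norm of u L^T, and u is recovered from u L^T by a bounded map; this
    gives the smallest-eigenvalue bound without compactness of the sphere. *)
Lemma posdef_lower n (S : 'M[R]_n) : posdefmx S ->
  exists2 c, 0 < c & forall u, c * normsq u <= qform u S.
Proof.
move=> pS; have [L LE] := posdef_gram pS.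
have uL : L^T \in unitmx.
  by move: (posdef_unit pS); rewrite LE unitmx_mul => /andP[].
have [C C0 hC] := normsq_mulmx_bound (invmx L^T).
exists C^-1; first by rewrite invr_gt0.
move=> u; rewrite LE qform_gram ler_pdivrMl//.
by have := hC (u *m L^T); rewrite mulmxK.
Qed.

(** With S = L^T L, the trace equals tr (L A L^T), the sum of the values of the form of [A] at the
    rows of [L]. *)
Lemma psd_trace_mul_ge0 n (A S : 'M[R]_n) : psdmx A -> posdefmx S ->
  0 <= \tr (A *m S).
Proof.
move=> [_ pA] /posdef_gram[L ->]; rewrite mulmxA mxtrace_mulC mulmxA.
rewrite /mxtrace sumr_ge0// => i _.
suff -> : (L *m A *m L^T) i i = qform (row i L) A by exact: pA.
by rewrite /qform -row_mul mxE [RHS]mxE; apply: eq_bigr => k _; rewrite !mxE.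
Qed.

Lemma psdZ n a (A : 'M[R]_n) : 0 <= a -> psdmx A -> psdmx (a *: A).
Proof.
move=> a0 [sA pA]; split=> [|u]; first by rewrite linearZ/= sA.
by rewrite -/(qform _ _) qformZ mulr_ge0//; exact: pA.
Qed.

Lemma posdefDpsd n (A B : 'M[R]_n) : posdefmx A -> psdmx B -> posdefmx (A + B).
Proof.
move=> [sA pA] [sB pB]; split=> [|u u0]; first by rewrite linearD/= sA sB.
by rewrite -/(qform _ _) qformD ltr_pwDl//; [exact: pA|exact: pB].
Qed.

Lemma posdefD n (A B : 'M[R]_n) : posdefmx A -> posdefmx B -> posdefmx (A + B).
Proof. by move=> pA /posdef_psd; exact: posdefDpsd. Qed.

Lemma posdefZ n a (A : 'M[R]_n) : 0 < a -> posdefmx A -> posdefmx (a *: A).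
Proof.
move=> a0 [sA pA]; split=> [|u u0]; first by rewrite linearZ/= sA.
by rewrite -/(qform _ _) qformZ mulr_gt0//; exact: pA.
Qed.

Lemma posdef1 n : posdefmx (1%:M : 'M[R]_n).
Proof.
by split=> [|u u0]; [rewrite tr_scalar_mx|rewrite mulmx1; exact: normsq_gt0].
Qed.

Lemma psd_congr n (A B : 'M[R]_n) : psdmx A -> psdmx (B *m A *m B^T).
Proof.
move=> [sA pA]; split=> [|u].
  by rewrite !trmx_mul trmxK sA mulmxA.
by rewrite -/(qform _ _) qform_congr; exact: pA.
Qed.

Lemma posdef_inv n (A : 'M[R]_n) : posdefmx A -> posdefmx (invmx A).
Proof.
move=> pA; have uA := posdef_unit pA; have sA := pA.1.
apply/posdefmxE; split; last first.
  by rewrite -unitfE -unitmxE unitmx_inv.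
rewrite -[invmx A]mul1mx -(mulVmx uA).
rewrite -{2}[invmx A]trmxK trmx_inv sA; apply: psd_congr.
exact: posdef_psd.
Qed.

Lemma psd_diag_ge0 n (S : 'M[R]_n) i : psdmx S -> 0 <= S i i.
Proof.
by move=> [_ /(_ (delta_mx 0 i))]; rewrite -rowE trmx_delta -colE !mxE.
Qed.

(** Testing the form on e_i + t e_j with t = 1 and t = -1 gives 2 |S_ij| <= S_ii + S_jj. Hence a
    bound on a trace bounds all entries, which is how compactness is obtained on the cone. *)
Lemma psd_coord_bound n (S : 'M[R]_n) i j : psdmx S -> `|S i j| <= \tr S.
Proof.
move=> pS; have dS k := psd_diag_ge0 k pS.
have [<-|ij] := eqVneq i j.
  by rewrite ger0_norm// /mxtrace (bigD1 i)//= lerDl sumr_ge0.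
have le : S i i + S j j <= \tr S.
  rewrite /mxtrace (bigD1 i)//= (bigD1 j) 1?eq_sym//= addrA lerDl.
  by rewrite sumr_ge0.
have qE (t : R) : t ^+ 2 = 1 -> 0 <= S i i + S j j + 2 * t * S i j.
  move=> t2; have := pS.2 (delta_mx 0 i + t *: delta_mx 0 j).
  rewrite mulmxDl linearD/= linearZ/= !mulmxDr !mulmxDl -!scalemxAl -!scalemxAr.
  rewrite -!rowE !trmx_delta -!colE !mxE mulrA -expr2 t2 mul1r.
  have -> : S j i = S i j by rewrite -[in RHS]pS.1 mxE.
  by lra.
have := qE 1 (expr1n _ _); have := qE (-1); rewrite sqrrN expr1n => /(_ erefl).
have := dS i; have := dS j.
by rewrite ler_norml; lra.
Qed.

Lemma posdef_trace_lower n (A : 'M[R]_n) : posdefmx A ->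
  exists2 c, 0 < c & forall S, posdefmx S -> c * \tr S <= \tr (A *m S).
Proof.
move=> pA; have [c c0 hc] := posdef_lower pA; exists c => // S pS.
have : 0 <= \tr ((A - c%:M) *m S).
  apply: psd_trace_mul_ge0 => //; split=> [|u].
    by rewrite linearB/= tr_scalar_mx pA.1.
  rewrite -/(qform _ _) qformD -scaleN1r qformZ -scalemx1 qformZ.
  by rewrite {2}/qform mulmx1 mulN1r subr_ge0; exact: hc.
by rewrite mulmxBl linearB/= mul_scalar_mx linearZ/= subr_ge0.
Qed.

Lemma posdef_coord_bound n (A : 'M[R]_n) : posdefmx A ->
  exists2 C, 0 < C &
    forall S, posdefmx S -> forall i j, `|S i j| <= C * \tr (A *m S).
Proof.
move=> /posdef_trace_lower[c c0 hc]; exists c^-1; first by rewrite invr_gt0.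
move=> S pS i j; rewrite ler_pdivlMl//.
apply: le_trans (hc _ pS); rewrite ler_pM2l//.
exact/psd_coord_bound/posdef_psd.
Qed.

Lemma posdef_trace_mul_gt0 n (A S : 'M[R]_n) : (0 < n)%N ->
  posdefmx A -> posdefmx S -> 0 < \tr (A *m S).
Proof.
case: n A S => // n A S _ /posdef_trace_lower[c c0 hc] pS.
apply: lt_le_trans (hc _ pS); rewrite mulr_gt0//.
have dS k := psd_diag_ge0 k (posdef_psd pS).
rewrite /mxtrace (bigD1 0)//= ltr_pwDl ?sumr_ge0//.
have := pS.2 (delta_mx 0 0); rewrite -rowE trmx_delta -colE !mxE; apply.
apply/eqP => /matrixP/(_ 0 0); rewrite !mxE !eqxx => /eqP.
by rewrite oner_eq0.
Qed.

Lemma qform_bound n (u : 'rV[R]_n) (D : 'M[R]_n) e : 0 <= e ->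
  (forall i j, `|D i j| <= e) -> `|qform u D| <= e * n%:R ^+ 2 * normsq u.
Proof.
move=> e0 hD; rewrite /qform mxE (le_trans (ler_norm_sum _ _ _))//.
rewrite (@le_trans _ _ (\sum_(j < n) e * n%:R * normsq u))//; last first.
  by rewrite sumr_const card_ord -[leLHS]mulr_natl; nra.
apply: ler_sum => j _; rewrite !mxE normrM.
have hu k : `|u 0 k| <= Num.sqrt (normsq u).
  by rewrite -[leLHS]sqrtr_sqr ler_wsqrtr// sqr_coord_le_normsq.
rewrite -(sqr_sqrtr (normsq_ge0 u)) expr2 mulrA ler_pM//.
rewrite (le_trans (ler_norm_sum _ _ _))//.
rewrite (@le_trans _ _ (\sum_(k < n) e * Num.sqrt (normsq u)))//; last first.
  by rewrite sumr_const card_ord -[leLHS]mulr_natl; nra.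
by apply: ler_sum => k _; rewrite normrM mulrC ler_pM.
Qed.

(** Openness holds only among symmetric matrices: the cone has empty interior in the space of all
    matrices as soon as n > 1. *)
Lemma posdef_open n (S : 'M[R]_n) : posdefmx S ->
  exists2 e, 0 < e & forall T, T^T = T ->
    (forall i j, `|T i j - S i j| < e) -> posdefmx T.
Proof.
move=> pS; have [c c0 hc] := posdef_lower pS.
have k0 : 0 < n%:R ^+ 2 + 1 :> R by rewrite ltr_pwDr// sqr_ge0.
(* An entrywise perturbation of size e changes the form by at most e n^2 |u|^2; the extra 1 keeps
   this strictly below c |u|^2 and the denominator positive. *)
exists (c / (n%:R ^+ 2 + 1)) => [|T sT hT]; first by rewrite divr_gt0.
split=> // u u0; rewrite -/(qform _ _).
have := @qform_bound _ u (T - S) _ (ltW (divr_gt0 c0 k0)).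
move=> /(_ (fun i j => _))H; have {}H := H _.
have : `|qform u (T - S)| <= c / (n%:R ^+ 2 + 1) * n%:R ^+ 2 * normsq u.
  by apply: H => i j; rewrite !mxE ltW.
rewrite -scaleN1r qformD qformZ mulN1r ler_norml => /andP[h _].
have := hc u; have N0 := normsq_gt0 u0.
have : c / (n%:R ^+ 2 + 1) * n%:R ^+ 2 * normsq u < c * normsq u.
  by rewrite ltr_pM2r// mulrAC ltr_pdivrMr// ltr_pM2l// ltrDl.
lra.
Qed.

End posdef_algebra.

(** * Differential calculus on the cone *)

Section determinant_derivative.
Context {R : realType}.

(** For t <> 0 the determinant is t^n times the characteristic polynomial of - K at 1 / t, that is,
    the reversed polynomial at t. Its leading coefficients 1 and tr K become the constant and linear
    terms, and the other coefficients form [p]. *)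
Lemma det_1addZ n (K : 'M[R]_n) : exists p : {poly R}, forall t : R,
  \det (1%:M + t *: K) = 1 + t * \tr K + t ^+ 2 * p.[t].
Proof.
case: n K => [|n] K.
  by exists 0 => t; rewrite det_mx00 /mxtrace big_ord0 horner0 !mulr0 !addr0.
pose q := char_poly (- K).
exists (\poly_(k < n) q`_(n.-1 - k)) => t.
have [->|t0] := eqVneq t 0.
  by rewrite scale0r addr0 det1 expr2 !mul0r !addr0.
have -> : 1%:M + t *: K = t *: (t^-1%:M - (- K)).
  by rewrite opprK scalerDr scale_scalar_mx mulfV.
have sq : size q = n.+2 by rewrite size_char_poly.
rewrite detZ; have -> : \det (t^-1%:M - (- K)) = q.[t^-1].
  rewrite /q /char_poly -horner_evalE -det_map_mx; congr (\det _).
  by apply/matrixP => i j; rewrite !mxE /= horner_evalE !hornerE hornerMn hornerX.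
rewrite horner_coef sq !big_ord_recr/= mulrDr mulrDr addrAC -addrA addrC.
have -> : q`_n.+1 = 1 by have /monicP := char_poly_monic (- K); rewrite lead_coefE sq.
have -> : q`_n = \tr K.
  by have := char_poly_trace (- K) isT; rewrite linearN/= opprK.
rewrite mul1r -exprMn mulfV// expr1n.
have -> : t ^+ n.+1 * (\tr K * t^-1 ^+ n) = t * \tr K.
  by rewrite mulrCA exprS -[t * _ * _]mulrA -exprMn mulfV// expr1n mulr1 mulrC.
congr (1 + _ + _).
rewrite horner_poly !mulr_sumr [RHS](reindex_inj rev_ord_inj)/=.
apply: eq_bigr => k _.
have -> : (n.-1 - (n - k.+1) = k)%N by have := ltn_ord k; lia.
rewrite mulrCA [RHS]mulrCA; congr *%R.
rewrite exprVn -exprB; last 2 first.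
  by have := ltn_ord k; lia.
  by rewrite unitfE.
rewrite -exprD; congr (_ ^+ _).
by have := ltn_ord k; lia.
Qed.

Lemma is_derive_det_line n (S H : 'M[R]_n) (S0 : \det S != 0) :
  is_derive (0 : R) (1 : R) (fun t => \det (t *: H + S))
    (\det S * \tr (invmx S *m H)).
Proof.
have uS : S \in unitmx by rewrite unitmxE unitfE.
have [p pE] := det_1addZ (invmx S *m H).
have -> : (fun t => \det (t *: H + S)) =
    horner ((\det S)%:P * (1 + (\tr (invmx S *m H)) *: 'X + 'X^2 * p)).
  apply/funext => t.
  have -> : t *: H + S = S *m (1%:M + t *: (invmx S *m H)).
    by rewrite mulmxDr mulmx1 -scalemxAr mulKVmx// addrC.
  by rewrite det_mulmx pE !hornerE [in RHS]mulrC; ring.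
apply: is_derive_eq.
rewrite !poly.derivE !hornerE ?hornerMn ?hornerXn/=.
by rewrite expr0n/= !(mul0r, mulr0, mul0rn, addr0, add0r).
Qed.

End determinant_derivative.

Section line_derivative.
Context {R : realType} {V : normedModType R}.
Implicit Types (F G : V -> R).

Lemma is_derive_lineP F (S v : V) l :
  is_derive S v F l <-> is_derive (0 : R) (1 : R) (fun h => F (h *: v + S)) l.
Proof.
have E : 'D_v F S = 'D_1 (fun h : R => F (h *: v + S)) (0 : R).
  rewrite /derive; set g1 := fun h => h^-1 *: _; set g2 := fun h => h^-1 *: _.
  suff -> : g1 = g2 by [].
  by rewrite /g1 /g2; apply/funext => h /=; rewrite addr0 scale0r add0r [_%:A]mulr1.
have [D1 D2] := derivable1P F S v.
split=> -[dF <-]; split.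
- exact: D1.
- exact: esym E.
- exact: D2.
- exact: E.
Qed.

Lemma is_derive_comp_real F (phi : R -> R) (S v : V) l l' :
  is_derive S v F l -> is_derive (F S) (1 : R) phi l' ->
  is_derive S v (phi \o F) (l' * l).
Proof.
move=> /is_derive_lineP dF dphi; apply/is_derive_lineP.
apply: (@is_derive1_comp _ phi (fun h => F (h *: v + S))).
by rewrite scale0r add0r.
Qed.

End line_derivative.

Section cone_calculus.
Context {R : realType}.

Lemma cvg_sumr {T} (Fl : set_system T) {FF : Filter Fl} (I : Type) (r : seq I)
    (P : pred I) (f : I -> T -> R) (l : I -> R) :
  (forall i, P i -> f i @ Fl --> l i) ->
  (fun t => \sum_(i <- r | P i) f i t) @ Fl --> \sum_(i <- r | P i) l i.
Proof.
have ac : continuous (fun x : R * R => x.1 + x.2).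
  by move=> x; exact: add_continuous.
by move=> fl; apply: (@cvg_big _ _ _ _ _ ac _ Fl).
Qed.

Lemma cvg_prodr {T} (Fl : set_system T) {FF : Filter Fl} (I : Type) (r : seq I)
    (P : pred I) (f : I -> T -> R) (l : I -> R) :
  (forall i, P i -> f i @ Fl --> l i) ->
  (fun t => \prod_(i <- r | P i) f i t) @ Fl --> \prod_(i <- r | P i) l i.
Proof.
have ac : continuous (fun x : R * R => x.1 * x.2).
  by move=> x; exact: mul_continuous.
by move=> fl; apply: (@cvg_big _ _ _ _ _ ac _ Fl).
Qed.

Lemma cvg_det {T} (Fl : set_system T) {FF : Filter Fl} n
    (M : T -> 'M[R]_n) (M0 : 'M[R]_n) :
  (forall i j, (fun t => M t i j) @ Fl --> M0 i j) ->
  (fun t => \det (M t)) @ Fl --> \det M0.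
Proof.
move=> MM0; apply: cvg_sumr => s _.
by apply: cvgM; [exact: cvg_cst|exact: cvg_prodr].
Qed.

(** The cofactor formula makes the entries rational functions of the matrix. It describes [invmx]
    only on invertible matrices, hence the condition near the limit. *)
Lemma cvg_invmx {T} (Fl : set_system T) {FF : Filter Fl} n
    (M : T -> 'M[R]_n) (M0 : 'M[R]_n) i j :
  (\forall t \near Fl, M t \in unitmx) -> M0 \in unitmx ->
  (forall i j, (fun t => M t i j) @ Fl --> M0 i j) ->
  (fun t => invmx (M t) i j) @ Fl --> invmx M0 i j.
Proof.
move=> uM uM0 MM0.
have adjE (A : 'M[R]_n) : A \in unitmx -> invmx A i j =
    (\det A)^-1 * ((-1) ^+ (j + i) * \det (row' j (col' i A))).
  by move=> uA; rewrite /invmx uA !mxE.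
rewrite adjE//.
have : (fun t => (\det (M t))^-1 * ((-1) ^+ (j + i) * \det (row' j (col' i (M t)))))
   @ Fl --> (\det M0)^-1 * ((-1) ^+ (j + i) * \det (row' j (col' i M0))).
  apply: cvgM.
    by apply: cvgV; [rewrite -unitfE -unitmxE|exact: cvg_det].
  apply: cvgM; first exact: cvg_cst.
  apply: cvg_det => k l; under eq_fun do rewrite !mxE.
  by rewrite !mxE; exact: MM0.
apply: cvg_trans; apply: near_eq_cvg.
by apply: filterS uM => t ut; rewrite adjE.
Qed.

Context {d : nat}.
Implicit Types (F G : 'M[R]_d -> R) (S H : 'M[R]_d).

Definition cont_cone F := {within @posdefmx R d, continuous F}.

Lemma cont_coneP F : cont_cone F <->
  forall S, posdefmx S -> F @ within (@posdefmx R d) (nbhs S) --> F S.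
Proof. exact: subspace_continuousP. Qed.

Lemma eq_cont_cone F G : (forall S, posdefmx S -> F S = G S) ->
  cont_cone F -> cont_cone G.
Proof.
move=> FG /cont_coneP cF; apply/cont_coneP => S pS; rewrite -FG//.
apply: cvg_trans (cF _ pS); apply: near_eq_cvg.
by apply: filterS (withinT _ _) => T /= ?; rewrite FG.
Qed.

Lemma cont_coneT F : continuous F -> cont_cone F.
Proof. exact: continuous_subspaceT. Qed.

Lemma cont_cone_cst c : cont_cone (cst c).
Proof. by apply: cont_coneT; exact: cst_continuous. Qed.

Lemma cont_cone_coord i j : cont_cone (fun S => S i j).
Proof. by apply: cont_coneT; exact: coord_continuous. Qed.

Lemma cont_coneD F G : cont_cone F -> cont_cone G ->
  cont_cone (fun S => F S + G S).
Proof.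
move=> /cont_coneP cF /cont_coneP cG; apply/cont_coneP => S pS.
by apply: cvgD; [exact: cF|exact: cG].
Qed.

Lemma cont_coneM F G : cont_cone F -> cont_cone G ->
  cont_cone (fun S => F S * G S).
Proof.
move=> /cont_coneP cF /cont_coneP cG; apply/cont_coneP => S pS.
by apply: cvgM; [exact: cF|exact: cG].
Qed.

Lemma cont_cone_sum (I : Type) (r : seq I) (P : pred I) (F : I -> 'M[R]_d -> R) :
  (forall i, cont_cone (F i)) -> cont_cone (fun S => \sum_(i <- r | P i) F i S).
Proof.
move=> cF; apply/cont_coneP => S pS; apply: cvg_sumr => i _.
by move/cont_coneP : (cF i); exact.
Qed.

Lemma cont_cone_comp F (phi : R -> R) :
  (forall S, posdefmx S -> {for F S, continuous phi}) -> cont_cone F ->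
  cont_cone (phi \o F).
Proof.
move=> cphi /cont_coneP cF; apply/cont_coneP => S pS.
exact: (cvg_comp _ _ (cF _ pS) (cphi _ pS)).
Qed.

Lemma cont_cone_trace (A B : 'M[R]_d -> 'M[R]_d) :
  (forall i j, cont_cone (fun S => A S i j)) ->
  (forall i j, cont_cone (fun S => B S i j)) ->
  cont_cone (fun S => \tr (A S *m B S)).
Proof.
move=> cA cB; apply: cont_cone_sum => i.
apply: (@eq_cont_cone (fun S => \sum_j A S i j * B S j i)).
  by move=> S _; rewrite mxE.
by apply: cont_cone_sum => j; exact: cont_coneM.
Qed.

Lemma cont_cone_det : cont_cone determinant.
Proof.
apply: cont_coneT => S; apply: (@cvg_det _ (nbhs S) (nbhs_filter S)) => i j.
exact: coord_continuous.
Qed.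

Lemma cont_cone_invmx i j : cont_cone (fun S => invmx S i j).
Proof.
apply/cont_coneP => S pS; apply: cvg_invmx; last 2 first.
- exact: posdef_unit.
- by move=> k l; exact: (proj1 (cont_coneP _) (@cont_cone_coord k l)).
by apply: filterS (withinT _ _) => T; exact: posdef_unit.
Qed.

(* Only the directions [free_dir i j] matter: they span the symmetric matrices. *)
Definition C1_with F (DF : 'M[R]_d -> 'M[R]_d -> R) := cont_cone F /\
  forall i j, cont_cone (DF (free_dir i j)) /\
    forall S, posdefmx S -> is_derive S (free_dir i j) F (DF (free_dir i j) S).

Lemma C1_with_cst c : C1_with (cst c) (fun _ _ => 0).
Proof.
split=> [|i j]; first exact: cont_cone_cst.
by split=> [|S _]; [exact: cont_cone_cst|exact: is_derive_cst].
Qed.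

Lemma C1_with_coord k l : C1_with (fun S => S k l) (fun H _ => H k l).
Proof.
split=> [|i j]; first exact: cont_cone_coord.
split=> [|S _]; first exact: cont_cone_cst.
apply/is_derive_lineP.
rewrite (_ : (fun h : R => _) = (fun h : R => h * free_dir i j k l + S k l)).
  apply: is_derive_eq.
  by rewrite scaler0 add0r addr0 [_%:A]mulr1.
by apply/funext => h; rewrite !mxE.
Qed.

Lemma C1_withD F G DF DG : C1_with F DF -> C1_with G DG ->
  C1_with (fun S => F S + G S) (fun H S => DF H S + DG H S).
Proof.
move=> [cF dF] [cG dG]; split=> [|i j]; first exact: cont_coneD.
have [cdF hF] := dF i j; have [cdG hG] := dG i j.
split=> [|S pS]; first exact: cont_coneD.
by apply: is_deriveD; [exact: hF|exact: hG].
Qed.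

Lemma C1_withM F G DF DG : C1_with F DF -> C1_with G DG ->
  C1_with (fun S => F S * G S) (fun H S => F S * DG H S + G S * DF H S).
Proof.
move=> [cF dF] [cG dG]; split=> [|i j]; first exact: cont_coneM.
have [cdF hF] := dF i j; have [cdG hG] := dG i j.
split=> [|S pS]; first by apply: cont_coneD; exact: cont_coneM.
by apply: is_deriveM; [exact: hF|exact: hG].
Qed.

Lemma C1_with_sum (I : Type) (r : seq I) (F : I -> 'M[R]_d -> R) DF :
  (forall i, C1_with (F i) (DF i)) ->
  C1_with (fun S => \sum_(i <- r) F i S) (fun H S => \sum_(i <- r) DF i H S).
Proof.
move=> hF; elim: r => [|i r IH].
  rewrite (_ : (fun S => _) = cst 0); last by apply/funext => S; rewrite big_nil.
  rewrite (_ : (fun H S => _) = (fun _ _ => 0)); first exact: C1_with_cst.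
  by apply/funext => H; apply/funext => S; rewrite big_nil.
rewrite (_ : (fun S => _) = (fun S => F i S + \sum_(i <- r) F i S)); last first.
  by apply/funext => S; rewrite big_cons.
have -> : (fun H S => \sum_(i0 <- i :: r) DF i0 H S) =
    (fun H S => DF i H S + \sum_(i0 <- r) DF i0 H S).
  by apply/funext => H; apply/funext => S; rewrite big_cons.
exact: C1_withD.
Qed.

Lemma C1_with_comp F DF (phi phi' : R -> R) :
  (forall S, posdefmx S -> is_derive (F S) (1 : R) phi (phi' (F S))) ->
  (forall S, posdefmx S -> {for F S, continuous phi'}) ->
  C1_with F DF -> C1_with (phi \o F) (fun H S => phi' (F S) * DF H S).
Proof.
move=> dphi cphi' [cF dF]; split=> [|i j].
  apply: cont_cone_comp => // S pS; apply: differentiable_continuous.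
  by apply/derivable1_diffP; have [] := dphi _ pS.
have [cdF hF] := dF i j; split=> [|S pS].
  by apply: cont_coneM => //; exact: cont_cone_comp.
by apply: is_derive_comp_real; [exact: hF|exact: dphi].
Qed.

Lemma C1_with_eq F DF DF' :
  (forall i j S, posdefmx S -> DF (free_dir i j) S = DF' (free_dir i j) S) ->
  C1_with F DF -> C1_with F DF'.
Proof.
move=> E [cF dF]; split=> // i j; have [cdF hF] := dF i j; split.
  by apply: eq_cont_cone cdF => S; exact: E.
by move=> S pS; rewrite -E//; exact: hF.
Qed.

Lemma C1_with_trace (B : 'M[R]_d) :
  C1_with (fun S => \tr (B *m S)) (fun H _ => \tr (B *m H)).
Proof.
have trE S : \tr (B *m S) = \sum_i \sum_j B i j * S j i.
  by apply: eq_bigr => i _; rewrite mxE.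
rewrite (_ : (fun S => _) = (fun S => \sum_i \sum_j B i j * S j i)); last first.
  exact/funext.
apply: (@C1_with_eq _ (fun H S => \sum_i \sum_j (B i j * H j i + S j i * 0))).
  move=> i j S _; rewrite trE; apply: eq_bigr => k _; apply: eq_bigr => l _.
  by rewrite mulr0 addr0.
apply: C1_with_sum => i; apply: C1_with_sum => j.
by apply: C1_withM; [exact: C1_with_cst|exact: C1_with_coord].
Qed.

Lemma is_derive_lndet S H : posdefmx S ->
  is_derive S H (fun S => ln (\det S)) (\tr (invmx S *m H)).
Proof.
move=> pS; have dS := posdef_det_gt0 pS.
have -> : \tr (invmx S *m H) = (\det S)^-1 * (\det S * \tr (invmx S *m H)).
  by rewrite mulKf// gt_eqF.
apply: is_derive_comp_real; last exact: is_derive1_ln.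
by apply/is_derive_lineP; apply: is_derive_det_line; rewrite gt_eqF.
Qed.

Lemma C1_with_lndet :
  C1_with (fun S => ln (\det S)) (fun H S => \tr (invmx S *m H)).
Proof.
split=> [|i j].
  apply: cont_cone_comp cont_cone_det => S pS; apply: continuous_ln.
  exact: posdef_det_gt0.
split=> [|S pS].
  by apply: cont_cone_trace => k l; [exact: cont_cone_invmx|exact: cont_cone_cst].
exact: is_derive_lndet.
Qed.

End cone_calculus.

(** * Divergence theorem on the cone *)

Section lebesgue_tuple_theory.
Context {R : realType}.
Local Notation leb := (@lebesgue_measure R).

Definition vanish_far (h : R -> R) := exists M : R, forall x, M < `|x| -> h x = 0.

Lemma integral_derive_vanish_far (h h' : R -> R) :
  (forall x, is_derive x (1 : R) h (h' x)) -> continuous h' -> vanish_far h ->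
  (\int[leb]_x (h' x)%:E = 0)%E.
Proof.
(* [M0] may be negative and its bound is strict; |M0| + 1 is a positive endpoint at which [h]
   already vanishes. *)
move=> dh ch' [M0 hM0]; pose M := `|M0| + 1.
have hM x : M <= `|x| -> h x = 0.
  move=> Mx; apply: hM0; apply: lt_le_trans Mx.
  by rewrite (le_lt_trans (ler_norm _))// ltrDl.
have M_gt0 : 0 < M by rewrite ltr_pwDr.
have ch : continuous h.
  move=> x; apply: differentiable_continuous; apply/derivable1_diffP.
  by have [] := dh x.
have h'0 x : `]- M, M[%classic x \/ h' x = 0.
  have [Mx|xM] := ltP `|x| M; [left; rewrite /= in_itv/= -ltr_norml //|right].
  have {}xM : M0 < `|x|.
    by apply: lt_le_trans xM; rewrite (le_lt_trans (ler_norm _))// ltrDl.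
  have := dh x => -[_ <-].
  rewrite (@near_eq_derive _ _ _ h (cst 0)) ?derive_cst//.
  have /cvgr_gt/(_ _ xM) : `|y| @[y --> x] --> `|x|.
    exact: (@norm_continuous R R).
  by apply: filterS => y /hM0.
transitivity (\int[leb]_(x in `[(- M)%R, M]%classic) (h' x)%:E)%E.
  rewrite [RHS]integral_mkcond; apply: eq_integral => x _.
  rewrite patchE; case: ifPn => // /negP xM; have [xM'|->//] := h'0 x.
  by exfalso; apply: xM; rewrite inE; exact: subset_itv_oo_cc.
rewrite (@continuous_FTC2 _ h' h)//.
- by rewrite !hM ?subee// ?normrN ger0_norm// ltW.
- by rewrite gtrN.
- exact: continuous_subspaceT.
- split.
  + by move=> x _; have [] := dh x.
  + exact/cvg_at_right_filter/ch.
  + exact/cvg_at_left_filter/ch.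
- by move=> x _; rewrite derive1E; have [] := dh x.
Qed.

Local Notation consT x t := [tuple of x :: t].

Lemma measurable_consT n (x : R) :
  measurable_fun setT (fun t : n.-tuple R => consT x t).
Proof. by apply: measurable_cons => //; exact: measurable_cst. Qed.

Lemma ge0_integral_lebesgue_tupleS n (f : n.+1.-tuple R -> \bar R) :
  measurable_fun setT f -> (forall t, (0 <= f t)%E) ->
  (\int[lebesgue_tuple n.+1]_t f t =
   \int[leb]_x \int[lebesgue_tuple n]_t f (consT x t))%E.
Proof.
move=> mf f0; rewrite /= /cons_measure ge0_integral_pushforward//; last first.
  exact: measurable_cons_pair.
rewrite preimage_setT fubini_tonelli1//.
  by apply: measurableT_comp => //; exact: measurable_cons_pair.
by move=> p; exact: f0.
Qed.

Lemma integrable_lebesgue_tupleS n (f : n.+1.-tuple R -> \bar R) :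
  (lebesgue_tuple n.+1).-integrable setT f ->
  (leb \x lebesgue_tuple n)%E.-integrable setT (f \o @cons_pair R n).
Proof.
move=> /integrableP[mf foo]; apply/integrableP; split.
  by apply: measurableT_comp => //; exact: measurable_cons_pair.
move: foo; rewrite /= /cons_measure ge0_integral_pushforward//.
  exact: measurable_cons_pair.
exact: measurableT_comp.
Qed.

Lemma integral_lebesgue_tupleS n (f : n.+1.-tuple R -> \bar R) :
  (lebesgue_tuple n.+1).-integrable setT f ->
  (\int[lebesgue_tuple n.+1]_t f t =
   \int[leb \x lebesgue_tuple n]_p f (cons_pair p))%E.
Proof.
move=> intf; have mf := measurable_int _ intf.
rewrite /= /cons_measure integral_pushforward//.
  exact: measurable_cons_pair.
exact: integrable_lebesgue_tupleS.
Qed.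

Definition upd n (t : n.-tuple R) (k : 'I_n) (x : R) : n.-tuple R :=
  [tuple if i == k then x else tnth t i | i < n].

Lemma upd_cons0 n x (t : n.-tuple R) y : upd (consT x t) ord0 y = consT y t.
Proof.
apply: eq_from_tnth => i; rewrite tnth_mktuple.
by case: (unliftP ord0 i) => [j ->|->]; rewrite ?tnthS.
Qed.

Lemma upd_consS n x (t : n.-tuple R) k y :
  upd (consT x t) (lift ord0 k) y = consT x (upd t k y).
Proof.
apply: eq_from_tnth => i; rewrite tnth_mktuple.
case: (unliftP ord0 i) => [j ->|->]; rewrite ?tnthS//.
by rewrite (inj_eq (@lift_inj _ ord0)) tnth_mktuple.
Qed.

(** Integrating first in coordinate [k], the inner integral vanishes by the fundamental theorem of
    calculus. The induction on [n] peels off head coordinates until [k] is the head. *)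
Lemma integral_partial_eq0 n (g g' : n.-tuple R -> R) (k : 'I_n) :
  (lebesgue_tuple n).-integrable setT (EFin \o g') ->
  (forall t, [/\ forall x, is_derive x (1 : R) (g \o upd t k) (g' (upd t k x)),
     continuous (g' \o upd t k) & vanish_far (g \o upd t k)]) ->
  (\int[lebesgue_tuple n]_t (g' t)%:E = 0)%E.
Proof.
elim: n => [|n IH] in g g' k *; first by case: k.
move=> ig' H; have mg' := measurable_int _ ig'.
have ig'2 := integrable_lebesgue_tupleS ig'.
rewrite (integral_lebesgue_tupleS ig').
case: (unliftP ord0 k) => [j kE|kE].
(* Here [k] lies in the tail. The section at x is integrable only for almost every x, so the
   induction hypothesis gives an inner integral that vanishes almost everywhere. *)
- rewrite -[LHS](integral12_prod_meas1 ig'2)/=.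
  rewrite (@ae_eq_integral _ _ _ _ setT (cst 0%E)) ?integral0//.
    exact: measurable_fubini_F ig'2.
  have := ae_integrable1 ig'2; apply: filterS => x ix _ /=.
  apply: (IH (fun t : n.-tuple R => g (consT x t)) (fun t : n.-tuple R => g' (consT x t)) j).
    exact: ix.
  move=> t; have [] := H (consT x t).
  have E y : upd (consT x t) k y = consT x (upd t j y) by rewrite kE upd_consS.
  have -> : g \o upd (consT x t) k = (fun t : n.-tuple R => g (consT x t)) \o upd t j.
    by apply/funext => y /=; rewrite E.
  have -> : g' \o upd (consT x t) k = (fun t : n.-tuple R => g' (consT x t)) \o upd t j.
    by apply/funext => y /=; rewrite E.
  by move=> h1 h2 h3; split => // y; rewrite -E; exact: h1.
(* Here [k] is the head: the order of integration is reversed and the inner integral vanishes for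
   every tail. The head 0 in [consT 0 t] is a placeholder that [upd] overwrites. *)
- rewrite -[LHS](integral21_prod_meas1 ig'2)/=.
  rewrite (eq_integral (cst 0%E)) ?integral0// => t _ /=.
  have [] := H (consT 0 t).
  have E y : upd (consT 0 t) k y = consT y t by rewrite kE upd_cons0.
  have -> : g \o upd (consT 0 t) k = (fun y => g (consT y t)).
    by apply/funext => y /=; rewrite E.
  have -> : g' \o upd (consT 0 t) k = (fun y => g' (consT y t)).
    by apply/funext => y /=; rewrite E.
  move=> h1 h2 h3; apply: (integral_derive_vanish_far _ h2 h3) => x.
  by have := h1 x; rewrite E.
Qed.

Definition box n (M : R) : set (n.-tuple R) := [set t | forall i, `|tnth t i| <= M].

Arguments box : clear implicits.

Lemma measurable_box n M : measurable (box n M).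
Proof.
rewrite (_ : box n M = \bigcap_(i in [set: 'I_n]) [set t | `|tnth t i| <= M]).
  apply: fin_bigcap_measurable => // i _; rewrite -[X in measurable X]setTI.
  apply: measurable_fun_le => //; apply: measurableT_comp => //.
  exact: measurable_tnth.
by apply/seteqP; split=> t /= h i; [move=> _; exact: h|exact: h].
Qed.

Lemma lebesgue_tuple_box n M : (lebesgue_tuple n (box n M) < +oo)%E.
Proof.
elim: n => [|n IH].
  by rewrite /= diracE; case: (_ \in _); rewrite ltry.
have [M0|M0] := ltP M 0.
  rewrite (_ : box _ _ = set0) ?measure0//.
  rewrite -subset0 => t /(_ ord0) /=; rewrite leNgt => /negP; apply.
  exact: lt_le_trans M0 _.
have E : @cons_pair R n @^-1` (box n.+1 M) = `[- M, M]%classic `*` box n M.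
  apply/seteqP; split=> -[x t] /=.
    move=> h; split.
      by have := h ord0; rewrite /= tnth0 in_itv/= -ler_norml.
    by move=> i; have := h (lift ord0 i); rewrite tnthS.
  move=> -[+ h] i; rewrite in_itv/= -ler_norml => xM.
  by case: (unliftP ord0 i) => [j ->|->]; rewrite ?tnthS//; exact: h.
rewrite /= /cons_measure /pushforward E product_measure1E//; last first.
  exact: measurable_box.
have L : (lebesgue_measure (`[(- M)%R, M]%classic : set R) < +oo)%E.
  by rewrite lebesgue_measure_itv/=; case: ifP; rewrite ?ltry.
by apply: lte_mul_pinfty => //; rewrite ge0_fin_numE.
Qed.

End lebesgue_tuple_theory.

(** * Topology of matrices and compact exhaustion of the cone *)

Section matrix_topology.
Context {R : realType}.

Lemma cvg_mx {T} (Fl : set_system T) {FF : Filter Fl} m n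
    (M : T -> 'M[R]_(m, n)) (M0 : 'M[R]_(m, n)) :
  (forall i j, (fun t => M t i j) @ Fl --> M0 i j) -> M @ Fl --> M0.
Proof.
move=> MM0; apply/cvg_ballP => e e0.
have : \forall t \near Fl, forall ij, ball (M0 ij.1 ij.2) e (M t ij.1 ij.2).
  apply: (@filter_forall _ ('I_m * 'I_n)%type) => -[i j] /=.
  by move/cvg_ballP : (MM0 i j); exact.
by apply: filterS => t h; split=> // i j; exact: (h (i, j)).
Qed.

(** The sigma-algebra is generated by the entries, so an open set is written as the union of the
    countably many cubes of rational center and radius 1 / (N + 1) that it contains. *)
Lemma open_measurable_mx m n (U : set 'M[R]_(m, n)) : open U -> measurable U.
Proof.
move=> oU; pose bx (q : 'M[rat]_(m, n) * nat) : set 'M[R]_(m, n) :=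
  [set T | forall i j, ball (ratr (q.1 i j) : R) q.2.+1%:R^-1 (T i j)].
have mbx q : measurable (bx q).
  rewrite (_ : bx q = \bigcap_(ij in [set: 'I_m * 'I_n])
      [set T | ball (ratr (q.1 ij.1 ij.2) : R) q.2.+1%:R^-1 (T ij.1 ij.2)]).
    apply: fin_bigcap_measurable => // ij _; rewrite -[X in measurable X]setTI.
    have mb : measurable (ball (ratr (q.1 ij.1 ij.2) : R) q.2.+1%:R^-1).
      by apply: open_measurable; exact: (@ball_open R R^o).
    exact: (@measurable_mx_coord R m n ij.1 ij.2 measurableT _ mb).
  apply/seteqP; split=> T /= h; first by move=> [i j] _; exact: h.
  by move=> i j; exact: (h (i, j)).
rewrite (_ : U = \bigcup_q (if `[< bx q `<=` U >] then bx q else set0)).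
  apply: countable_bigcupT_measurable => // q.
  by case: ifP => // _; exact: measurable0.
apply/seteqP; split=> T /=; last first.
  by move=> [q _]; case: asboolP => // h /h.
move=> UT; move: oU; rewrite openE => /(_ _ UT)/nbhs_ballP[e /= e0 he].
(* Twice the radius: any two points of a cube are compared through its center. *)
have [N N0] : exists N : nat, 2 * N.+1%:R^-1 < e.
  have e20 : 0 < e / 2 by rewrite divr_gt0.
  have [N _ /(_ N (leqnn N))/= hN] := near_infty_natSinv_lt (PosNum e20).
  by exists N; rewrite mulrC -ltr_pdivlMr.
have N1 : 0 < N.+1%:R^-1 :> R by rewrite invr_gt0.
have /choice[q hq] : forall ij : 'I_m * 'I_n,
    exists q : rat, ball (T ij.1 ij.2) N.+1%:R^-1 (ratr q : R).
  move=> [i j]; have bne : ball (T i j) N.+1%:R^-1 !=set0.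
    by exists (T i j); exact: ballxx.
  have [x [ux [q _ qE]]] := dense_rat bne (ball_open _ _).
  by exists q; rewrite qE.
exists (\matrix_(i, j) q (i, j), N) => //.
case: asboolP => [_ i j|/=]; first by rewrite /= mxE; exact/ball_sym/(hq (i, j)).
case=> T' hT'; apply: he; split=> // i j.
have := hT' i j; have := hq (i, j); rewrite /= mxE /ball/= => h1 h2.
rewrite (le_lt_trans (ler_distD (ratr (q (i, j))) _ _))//.
by rewrite (lt_trans _ N0)// mulr_natl mulr2n ltrD.
Qed.

(** Heine-Borel for row vectors, transported by the continuous surjection [vec_mx]. *)
Lemma bounded_closed_compact_mx m n (A : set 'M[R]_(m, n)) M :
  (forall S, A S -> forall i j, `|S i j| <= M) -> closed A -> compact A.
Proof.
move=> bA cA.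
have cvec : continuous (fun v : 'rV[R]_(m * n) => vec_mx v).
  move=> v; apply: (@cvg_mx _ (nbhs v) (nbhs_filter v)) => i j.
  under eq_fun do rewrite mxE.
  by rewrite mxE; exact: coord_continuous.
rewrite (_ : A = vec_mx @` (vec_mx @^-1` A)); last first.
  apply/seteqP; split=> [S AS|_ [v Av <-]//].
  by exists (mxvec S); rewrite /= mxvecK.
apply: continuous_compact; first exact: continuous_subspaceT.
apply: bounded_closed_compact; last first.
  by apply: closed_comp => // v _; exact: cvec.
exists `|M|; split=> // y My v /= /bA bv.
rewrite /Num.norm/= mx_normrE; apply: bigmax_le => [|[i k] _ /=].
  by apply: ltW; apply: le_lt_trans My.
rewrite ord1; case/mxvec_indexP : k => k l.
have := bv k l; rewrite mxE => /le_trans; apply.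
by rewrite (le_trans (ler_norm _))// ltW.
Qed.

Context {d : nat}.
Local Notation M := 'M[R]_d.

Lemma cont_cone_measurable (F : M -> R) :
  cont_cone F -> measurable_fun (@posdefmx R d) F.
Proof.
move=> /continuousP cF; apply: (measurability _ (RGenOpens.measurableE R)).
move=> _ [_ [a [b ->] <-]].
have /cF/open_subspaceP[V oV VE] : open `]a, b[%classic by exact: interval_open.
rewrite setIC [X in measurable X](_ : _ = V `&` @posdefmx R d); last by rewrite VE.
apply: measurableI; first exact: open_measurable_mx.
exact: measurable_posdefmx.
Qed.

Lemma qform_continuous (u : 'rV[R]_d) : continuous (qform u).
Proof.
move=> S; rewrite /continuous_at.
have E T : qform u T = \sum_j (\sum_i u 0 i * T i j) * u 0 j.
  by rewrite /qform mxE; apply: eq_bigr => j _; rewrite !mxE.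
rewrite (_ : qform u = fun T => \sum_j (\sum_i u 0 i * T i j) * u 0 j); last exact/funext.
apply: (@cvg_sumr _ _ (nbhs S) (nbhs_filter S)) => j _.
apply: cvgM; last exact: cvg_cst.
apply: (@cvg_sumr _ _ (nbhs S) (nbhs_filter S)) => i _.
apply: cvgM; first exact: cvg_cst.
exact: coord_continuous.
Qed.

Lemma trace_mul_continuous (B : M) : continuous (fun S : M => \tr (B *m S)).
Proof.
move=> S; apply: (@cvg_sumr _ _ (nbhs S) (nbhs_filter S)) => i _.
under eq_fun do rewrite mxE.
rewrite mxE; apply: (@cvg_sumr _ _ (nbhs S) (nbhs_filter S)) => j _.
apply: cvgM; first exact: cvg_cst.
exact: coord_continuous.
Qed.

Lemma det_continuous : continuous (@determinant R d).
Proof.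
move=> S; apply: (@cvg_det _ _ (nbhs S) (nbhs_filter S)) => i j.
exact: coord_continuous.
Qed.

Lemma closed_psdmx : closed (@psdmx R d).
Proof.
have -> : @psdmx R d = [set S | S^T = S] `&`
    \bigcap_(u in [set: 'rV[R]_d]) [set S | 0 <= qform u S].
  apply/seteqP; split=> S /= [sS pS]; split=> // u; first by move=> _; exact: pS.
  exact: pS.
apply: closedI.
  rewrite (_ : mkset _ = \bigcap_(ij in [set: 'I_d * 'I_d])
      (fun S : M => S ij.1 ij.2 - S ij.2 ij.1) @^-1` [set 0]); last first.
    apply/seteqP; split=> S /= h.
      by move=> [i j] _ /=; rewrite -[in X in _ - X]h mxE subrr.
    by apply/matrixP => i j; rewrite mxE; apply/eqP; rewrite -subr_eq0 (h (j, i)).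
  apply: closed_bigI => -[i j] _; apply: closed_comp => [S _|]; last exact: closed_eq.
  exact: cvgB (@coord_continuous R d d i j S) (@coord_continuous R d d j i S).
apply: closed_bigI => u _; apply: (@closed_comp _ _ (qform u) [set x | 0 <= x]).
  by move=> S _; exact: qform_continuous.
exact: closed_ge.
Qed.

(** Compact exhaustion of the cone: the determinant bound keeps away from the boundary, the trace
    bound from infinity. Semidefiniteness and weak inequalities make the set closed among all
    matrices. The bounds exp(- c) and c are matched to cutoffs in log |S| / c and tr (B S) / c that
    vanish once their argument has modulus at least 1. *)
Definition cone_core (B : M) (c : R) : set M :=
  [set S | [/\ psdmx S, expR (- c) <= \det S & \tr (B *m S) <= c]].

Lemma closed_cone_core B c : closed (cone_core B c).
Proof.
rewrite (_ : cone_core B c = @psdmx R d `&` (determinant @^-1` [set x | expR (- c) <= x])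
   `&` (fun S => \tr (B *m S)) @^-1` [set x | x <= c]); last first.
  by apply/seteqP; split=> S /= [] => [h1 h2 h3|[h1 h2] h3].
apply: closedI; first apply: closedI; first exact: closed_psdmx.
- apply: closed_comp => [S _|]; [exact: det_continuous|exact: closed_ge].
- apply: closed_comp => [S _|]; [exact: trace_mul_continuous|exact: closed_le].
Qed.

Lemma cone_core_posdef B c S : cone_core B c S -> posdefmx S.
Proof.
move=> [pS dS _]; apply/posdefmxE; split=> //.
by rewrite gt_eqF// (lt_le_trans _ dS)// expR_gt0.
Qed.

Lemma compact_cone_core B c : posdefmx B -> compact (cone_core B c).
Proof.
move=> /posdef_coord_bound[C C0 hC].
apply: (@bounded_closed_compact_mx _ _ _ (C * c)); last exact: closed_cone_core.
move=> S cS i j; have := hC S (cone_core_posdef cS) i j.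
by move=> /le_trans; apply; rewrite ler_pM2l//; case: cS.
Qed.

Lemma cont_cone_bounded_core (F : M -> R) B c : posdefmx B -> cont_cone F ->
  exists N, forall S, cone_core B c S -> `|F S| <= N.
Proof.
move=> pB cF; have : compact (F @` cone_core B c).
  apply: continuous_compact; last exact: compact_cone_core.
  apply: continuous_subspaceW cF => S; exact: cone_core_posdef.
move=> /compact_bounded [N [_ hN]]; exists (N + 1) => S cS.
by apply: hN; [rewrite ltrDl|exists S].
Qed.

End matrix_topology.

(* The rank given to the free entry (i, j) by [sym_of_tuple]. *)
Definition tri (i j : nat) : nat := ('C((maxn i j).+1, 2) + minn i j)%N.

Lemma tri_bin i j : (tri i j < 'C((maxn i j).+2, 2))%N.
Proof. by rewrite /tri [X in (_ < X)%N]binS bin1 ltn_add2l ltnS; case: leqP => //; lia. Qed.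

Lemma tri_lt d (i j : 'I_d) : (tri i j < 'C(d.+1, 2))%N.
Proof.
apply: leq_trans (tri_bin i j) _; apply: leq_bin2l.
by rewrite ltnS gtn_max !ltn_ord.
Qed.

(** Column m of the upper triangle occupies the ranks from C(m + 1, 2) to C(m + 2, 2) - 1, so the
    rank determines first the larger index, then the smaller. *)
Lemma tri_inj i j a b : tri i j = tri a b ->
  maxn i j = maxn a b /\ minn i j = minn a b.
Proof.
move=> E; have le x y z t : tri x y = tri z t -> (maxn x y <= maxn z t)%N.
  move=> {}E; rewrite leqNgt; apply/negP => lt.
  have := tri_bin z t; rewrite -E ltnNge => /negP; apply.
  by rewrite (leq_trans (leq_bin2l _ (_ : _ <= (maxn x y).+1)%N))// /tri leq_addr.
have M : maxn i j = maxn a b by apply/eqP; rewrite eqn_leq !le.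
by split=> //; move: E; rewrite /tri M => /addnI.
Qed.

Lemma tri_surj d k : (k < 'C(d.+1, 2))%N -> exists i j : 'I_d, k = tri i j.
Proof.
elim: d => [|d IH]; first by rewrite bin_small.
move=> kd; have [/IH[i [j ->]]|dk] := ltnP k 'C(d.+1, 2).
  by exists (widen_ord (leqnSn d) i), (widen_ord (leqnSn d) j).
move: kd; rewrite binS bin1 => kd.
have id : (k - 'C(d.+1, 2) < d.+1)%N by rewrite ltn_subLR// addnC.
exists (Ordinal id), ord_max; rewrite /tri /=.
by rewrite (maxn_idPr _) ?(minn_idPl _)// ?subnKC// -ltnS.
Qed.

Section cone_divergence.
Context {R : realType} {d : nat}.
Local Notation M := 'M[R]_d.

(** In the coordinates of [sym_of_tuple], [free_dir i j] is the unit vector of rank [tri i j]. This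
    identifies the partial derivatives of the statement with one-variable updates of a tuple. *)
Lemma free_dirE (i j a b : 'I_d) :
  free_dir i j a b = (tri a b == tri i j)%:R :> R.
Proof.
rewrite /free_dir; case: (eqVneq i j) => [<-|ij]; rewrite !mxE.
  congr ((nat_of_bool _)%:R); apply/idP/eqP => [/andP[/eqP-> /eqP->]//|/tri_inj[]].
  rewrite maxnn minnn => h1 h2.
  by apply/andP; split; apply/eqP/val_inj; rewrite /=; lia.
have ijv : (i != j :> nat) by [].
have -> : (tri a b == tri i j) = ((a == i) && (b == j)) || ((a == j) && (b == i)).
  apply/eqP/idP => [/tri_inj[h1 h2]|].
    by rewrite -!val_eqE /=; lia.
  by case/orP => /andP[/eqP-> /eqP->]//; rewrite /tri maxnC minnC.
case: (eqVneq a i) => [->|ai] /=; last by rewrite add0r.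
rewrite (negbTE ij) /= orbF addr0.
by [].
Qed.

Lemma free_dir_sym (i j : 'I_d) : (free_dir i j)^T = free_dir i j :> M.
Proof. by apply/matrixP => a b; rewrite mxE !free_dirE /tri (maxnC b) (minnC b). Qed.

Lemma sym_of_tuple_tnth (t : 'C(d.+1, 2).-tuple R) (i j : 'I_d) :
  sym_of_tuple t i j = tnth t (Ordinal (tri_lt i j)).
Proof. by rewrite mxE (tnth_nth 0). Qed.

Lemma sym_of_tuple_sym (t : 'C(d.+1, 2).-tuple R) :
  (sym_of_tuple t)^T = sym_of_tuple t :> M.
Proof. by apply/matrixP => a b; rewrite !mxE maxnC minnC. Qed.

Lemma sym_of_tuple_upd (t : 'C(d.+1, 2).-tuple R) (i j : 'I_d) x :
  let k := Ordinal (tri_lt i j) in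
  sym_of_tuple (upd t k x) = sym_of_tuple t + (x - tnth t k) *: free_dir i j.
Proof.
move=> k; apply/matrixP => a b; rewrite [RHS]mxE [in X in _ + X]mxE free_dirE.
rewrite !sym_of_tuple_tnth tnth_mktuple -val_eqE /=.
case: eqP => [E|_]; last by rewrite mulr0 addr0.
rewrite mulr1 (_ : Ordinal _ = k) ?subrKC//; last exact: val_inj.
Qed.

Lemma tnth_sym_of_tuple (t : 'C(d.+1, 2).-tuple R) k :
  exists i j, tnth t k = (sym_of_tuple t : M) i j.
Proof.
have [i [j kE]] := tri_surj (ltn_ord k); exists i, j.
by rewrite sym_of_tuple_tnth; congr tnth; apply: val_inj.
Qed.

Section affine_line.
Variables (S0 H : M) (a : R).
Let L (x : R) : M := S0 + (x - a) *: H.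

Lemma line_continuous : continuous L.
Proof.
move=> x; apply: (@cvg_mx _ _ (nbhs x) (nbhs_filter x)) => i j.
rewrite /L; under eq_fun do rewrite !mxE; rewrite !mxE.
apply: cvgD; first exact: cvg_cst.
by apply: cvgM; [apply: cvgB; [exact: cvg_id|exact: cvg_cst]|exact: cvg_cst].
Qed.

Hypotheses (S0sym : S0^T = S0) (Hsym : H^T = H).

Lemma near_line_posdef x : posdefmx (L x) -> \forall y \near x, posdefmx (L y).
Proof.
move=> /posdef_open[e e0 he].
have /cvg_ballP/(_ _ e0) := @line_continuous x.
apply: filterS => y [_ h]; apply: he => [|i j].
  by rewrite /L linearD linearZ/= S0sym Hsym.
by rewrite distrC; exact: h.
Qed.

Lemma near_line_core B c x : ~ cone_core B c (L x) ->
  \forall y \near x, ~ cone_core B c (L y).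
Proof.
move=> nc; have : open (~` cone_core B c) by apply/closed_openC/closed_cone_core.
by rewrite openE => /(_ (L x) nc); apply: line_continuous.
Qed.

Variables (F : M -> R) (DF : M -> R) (B : M) (c : R).
Hypotheses (cDF : cont_cone DF) (dF : forall S, posdefmx S -> is_derive S H F (DF S)).
Hypothesis F0 : forall S, posdefmx S -> ~ cone_core B c S -> F S = 0.

Lemma is_derive_line x : posdefmx (L x) ->
  is_derive x (1 : R) (F \o L) (DF (L x)).
Proof.
move=> pS; have /is_derive_lineP dl := dF pS.
have -> : F \o L = (fun h => F (h *: H + L x)) \o (fun y => y - x).
  apply/funext => y /=; congr F; rewrite /L addrCA -scalerDl.
  by congr (_ + _ *: _); ring.
rewrite -[DF (L x)]mulr1.
apply: (@is_derive1_comp _ (fun h => F (h *: H + L x)) (fun y : R => y - x)).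
  by rewrite subrr.
by apply: is_derive_eq; rewrite subr0.
Qed.

Lemma derive_off_core x : posdefmx (L x) -> ~ cone_core B c (L x) -> DF (L x) = 0.
Proof.
move=> pS nc; have [_ <-] := is_derive_line pS.
rewrite (@near_eq_derive _ _ _ _ (cst 0)) ?derive_cst//.
apply: filterS2 (near_line_posdef pS) (near_line_core nc) => y p n /=.
exact: F0.
Qed.

Let Fz := F \_ (@posdefmx R d).
Let Dz := DF \_ (@posdefmx R d).

Lemma patch_off_core x : ~ cone_core B c (L x) -> Fz (L x) = 0 /\ Dz (L x) = 0.
Proof.
move=> nc; rewrite /Fz /Dz !patchE; case: ifPn => // /set_mem p.
by rewrite F0// derive_off_core.
Qed.

(** A point of the line is either in the cone, where the extension by zero agrees with [F] nearby,
    or outside the closed set [cone_core B c], where the extension vanishes nearby. So the extension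
    is differentiable on the whole line, across the boundary of the cone as well. *)
Lemma patch_is_derive x : is_derive x (1 : R) (Fz \o L) (Dz (L x)).
Proof.
have [p|np] := pselect (posdefmx (L x)).
  have E : \forall y \near x, (F \o L) y = (Fz \o L) y.
    apply: filterS (near_line_posdef p) => y py /=.
    by rewrite /Fz patchE mem_set.
  rewrite /Dz patchE mem_set//.
  exact: (near_eq_is_derive E (is_derive_line p)).
have nc : ~ cone_core B c (L x) by move=> /cone_core_posdef.
have [_ ->] := patch_off_core nc.
have E : \forall y \near x, (cst 0 : R -> R) y = (Fz \o L) y.
  by apply: filterS (near_line_core nc) => y ny /=; case: (patch_off_core ny).
exact: (near_eq_is_derive E (is_derive_cst _ _ _)).
Qed.

Lemma patch_derive_continuous : continuous (Dz \o L).
Proof.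
move=> x; have [p|np] := pselect (posdefmx (L x)).
  have E : \forall y \near x, (DF \o L) y = (Dz \o L) y.
    apply: filterS (near_line_posdef p) => y py /=.
    by rewrite /Dz patchE mem_set.
  apply: cvg_trans (near_eq_cvg E) _.
  rewrite /= /Dz patchE mem_set//.
  have := (cont_coneP _).1 cDF _ p => h.
  apply: (@cvg_comp _ _ _ L DF (nbhs x) (within (@posdefmx R d) (nbhs (L x)))) h.
  move=> A /= A0; have := @line_continuous x _ A0.
  rewrite /= /nbhs/=; apply: filterS2 (near_line_posdef p).
  by move=> y py; exact.
have nc : ~ cone_core B c (L x) by move=> /cone_core_posdef.
have E : \forall y \near x, (cst 0 : R -> R) y = (Dz \o L) y.
  by apply: filterS (near_line_core nc) => y ny /=; case: (patch_off_core ny).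
apply: cvg_trans (near_eq_cvg E) _.
rewrite [(Dz \o L) x](patch_off_core nc).2; exact: cvg_cst.
Qed.

End affine_line.

Local Notation cone := (@posdefmx R d).
Local Notation leb := (lebesgue_tuple 'C(d.+1, 2)).

Lemma patch_core_box (G : M -> R) B c : posdefmx B ->
  (forall S, posdefmx S -> ~ cone_core B c S -> G S = 0) ->
  exists K, forall t, ~ @box R _ K t -> (G \_ cone) (sym_of_tuple t) = 0.
Proof.
move=> /posdef_coord_bound[C C0 hC] G0; exists (C * c) => t nbt.
rewrite patchE; case: ifPn => // /set_mem p; apply: G0 => // -[_ _ tc].
apply: nbt => k; have [i [j ->]] := tnth_sym_of_tuple t k.
by rewrite (le_trans (hC _ p _ _))// ler_pM2l.
Qed.

Lemma integrable_patch_core (G : M -> R) B c : posdefmx B -> cont_cone G ->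
  (forall S, posdefmx S -> ~ cone_core B c S -> G S = 0) ->
  leb.-integrable setT (EFin \o ((G \_ cone) \o sym_of_tuple)).
Proof.
move=> pB cG G0; have [K hK] := patch_core_box pB G0.
have mG : measurable_fun setT (G \_ cone).
  apply/(measurable_restrictT _ _).1; first exact: measurable_posdefmx.
  exact: cont_cone_measurable.
have mGs : measurable_fun setT ((G \_ cone) \o sym_of_tuple).
  by apply: measurableT_comp => //; exact: measurable_sym_of_tuple.
have [N hN] := cont_cone_bounded_core c pB cG.
have ib : leb.-integrable (@box R _ K) (EFin \o ((G \_ cone) \o sym_of_tuple)).
  apply: measurable_bounded_integrable.
  - exact: measurable_box.
  - exact: lebesgue_tuple_box.
  - exact: measurable_funTS.
  - exists `|N|; split => // y Ny t _ /=; rewrite patchE; case: ifPn => [/set_mem p|_].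
      have [cS|nc] := pselect (cone_core B c (sym_of_tuple t)).
        by rewrite (le_trans (hN _ cS))// (le_trans (ler_norm _))// ltW.
      by rewrite G0// normr0 ltW// (le_lt_trans _ Ny).
    by rewrite normr0 ltW// (le_lt_trans _ Ny).
move/(integrable_mkcond _ (@measurable_box R _ K)) : ib.
congr (_.-integrable _ _); apply/funext => t; rewrite patchE.
by case: ifPn => // /negP tb; rewrite /= hK// => tb'; apply: tb; rewrite inE.
Qed.

Lemma integrable_core (G : M -> R) B c : posdefmx B -> cont_cone G ->
  (forall S, posdefmx S -> ~ cone_core B c S -> G S = 0) ->
  sym_lebesgue.-integrable cone (EFin \o G) /\
  (\int[sym_lebesgue]_(X in cone) (G X)%:E =
   \int[leb]_t ((G \_ cone) (sym_of_tuple t))%:E)%E.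
Proof.
move=> pB cG G0; have iG := integrable_patch_core pB cG G0.
have mG : measurable_fun setT (EFin \o (G \_ cone)).
  apply/measurable_EFinP.
  apply/(measurable_restrictT _ _).1; first exact: measurable_posdefmx.
  exact: cont_cone_measurable.
have mc := @measurable_posdefmx R d.
split.
  apply/(integrable_mkcond _ mc); rewrite restrict_EFin /sym_lebesgue.
  by apply: integrable_pushforward => //; exact: measurable_sym_of_tuple.
transitivity (\int[sym_lebesgue]_X (EFin \o (G \_ cone)) X)%E.
  by rewrite integral_mkcond -restrict_EFin.
rewrite /sym_lebesgue integral_pushforward//; last exact: measurable_sym_of_tuple.
Qed.

(** Extended by zero, [F] has bounded support and is C^1 along each free entry, so
    [integral_partial_eq0] applies with the coordinate of rank [tri i j]. The support condition
    replaces any boundary term. *)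
Lemma cone_divergence (F : M -> R) DF B c (i j : 'I_d) : posdefmx B ->
  C1_with F DF ->
  (forall S, posdefmx S -> ~ cone_core B c S -> F S = 0) ->
  sym_lebesgue.-integrable cone (EFin \o DF (free_dir i j)) /\
  (\int[sym_lebesgue]_(X in cone) (DF (free_dir i j) X)%:E = 0)%E.
Proof.
move=> pB [cF dF] F0; have [cDF hD] := dF i j.
have DF0 S : posdefmx S -> ~ cone_core B c S -> DF (free_dir i j) S = 0.
  move=> pS nc.
  have := @derive_off_core S (free_dir i j) 0 pS.1 (free_dir_sym i j) F _ B c hD F0 0.
  by rewrite subr0 scale0r addr0; exact.
have [iD ->] := integrable_core pB cDF DF0; split=> //.
apply: (@integral_partial_eq0 _ _ ((F \_ cone) \o sym_of_tuple)
   ((DF (free_dir i j) \_ cone) \o sym_of_tuple) (Ordinal (tri_lt i j))).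
  exact: integrable_patch_core pB cDF DF0.
move=> t; set k := Ordinal _.
have updE x := sym_of_tuple_upd t i j x.
have sS := @sym_of_tuple_sym t.
have compE (G : M -> R) : (G \o sym_of_tuple) \o upd t k =
    G \o (fun x => sym_of_tuple t + (x - tnth t k) *: free_dir i j).
  by apply/funext => x /=; rewrite updE.
split.
- move=> x /=; rewrite updE compE.
  exact: (patch_is_derive (tnth t k) sS (free_dir_sym i j) hD F0).
- rewrite compE; exact: (patch_derive_continuous sS (free_dir_sym i j) cDF hD F0).
- have [K hK] := patch_core_box pB F0.
  exists K => x Kx /=; apply: hK => /(_ k); rewrite tnth_mktuple eqxx.
  by rewrite leNgt Kx.
Qed.

End cone_divergence.

(** * Stein identity *)

Section cutoff.
Context {R : realType}.

(** The square makes the positive part C^1 at 0, which is all the regularity that a cutoff needs: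
    only its first derivative enters a divergence. *)
Definition pospart2 (y : R) : R := Num.max 0 y ^+ 2.

Lemma is_derive_pospart2 y : is_derive y (1 : R) pospart2 (2 * Num.max 0 y).
Proof.
have [y0|y0|->] := ltgtP y 0.
- rewrite mulr0.
  apply: near_eq_is_derive (is_derive_cst (0 : R) y 1).
  have : \forall z \near y, z < 0 by exact: lt_nbhsl.
  by apply: filterS => z z0; rewrite /pospart2 max_l ?ltW// expr2 mul0r.
- apply: (@near_eq_is_derive _ _ _ (fun z : R => z ^+ 2)).
    have : \forall z \near y, 0 < z by exact: lt_nbhsr.
    by apply: filterS => z z0; rewrite /pospart2 max_r ?ltW.
  by apply: is_derive_eq; rewrite /GRing.scale/=; ring.
(* At 0 the difference quotient is max(0, h)^2 / h, of modulus at most |h|. *)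
- rewrite mulr0; suff h : h^-1 *: (pospart2 (h *: 1 + 0) - pospart2 0) @[h --> 0^'] --> (0 : R).
    by split; [apply/cvg_ex; exists 0|exact/cvg_lim].
  have E (h : R) : `|h^-1 *: (pospart2 (h *: 1 + 0) - pospart2 0)| <= `|h|.
    rewrite addr0 [_%:A]mulr1 /pospart2 maxxx expr0n subr0 normrM normrX normfV.
    have [->|h0] := eqVneq h 0; first by rewrite maxxx normr0 expr0n mulr0.
    rewrite ler_pdivrMl ?normr_gt0// -expr2 lerXn2r ?nnegrE//.
    by rewrite /Num.max; case: ifP; rewrite ?normr0.
  apply/cvgrPdist_lt => e e0; near=> h; rewrite sub0r normrN.
  apply: le_lt_trans (E h) _; rewrite -[h]subr0 distrC; near: h.
  exact: nbhs_dnbhs (nbhsx_ballx _ _ e0).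
Unshelve. all: end_near. Qed.

Definition bump (x : R) : R := pospart2 (1 - x ^+ 2).
Definition bump' (x : R) : R := 2 * Num.max 0 (1 - x ^+ 2) * (- (2 * x)).

Lemma is_derive_bump x : is_derive x (1 : R) bump (bump' x).
Proof.
apply: (@is_derive1_comp _ pospart2 (fun x : R => 1 - x ^+ 2)).
  exact: is_derive_pospart2.
by apply: is_derive_eq; rewrite /GRing.scale/=; ring.
Qed.

Lemma bump'_continuous : continuous bump'.
Proof.
move=> x; apply: cvgM; last by apply: cvgN; apply: cvgM; [exact: cvg_cst|exact: cvg_id].
apply: cvgM; first exact: cvg_cst.
under eq_fun do rewrite maxr_absE; rewrite maxr_absE.
have c1 : 1 - y ^+ 2 @[y --> x] --> 1 - x ^+ 2.
  by apply: cvgB; [exact: cvg_cst|exact: exprn_continuous].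
apply: cvgM; last exact: cvg_cst.
apply: cvgD; first by apply: cvgD => //; exact: cvg_cst.
by apply: cvg_norm; apply: cvgB => //; exact: cvg_cst.
Qed.

Lemma bump0 : bump 0 = 1.
Proof. by rewrite /bump /pospart2 expr0n subr0 max_r// expr1n. Qed.

Lemma bump_ge0 x : 0 <= bump x. Proof. exact: sqr_ge0. Qed.

Lemma bump_le1 x : bump x <= 1.
Proof.
rewrite /bump /pospart2 expr_le1// ?le_max ?lexx// ge_max ler01/=.
by rewrite gerBl sqr_ge0.
Qed.

Lemma bump_eq0 x : 1 <= `|x| -> bump x = 0.
Proof.
move=> x1; rewrite /bump /pospart2 max_l ?expr0n//.
by rewrite subr_le0 -real_normK ?num_real// exprn_ege1.
Qed.

Lemma bump'_le x : `|bump' x| <= 4.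
Proof.
have [x1|x1] := leP 1 `|x|.
  rewrite /bump' max_l ?mulr0 ?mul0r ?normr0//.
  by rewrite subr_le0 -real_normK ?num_real// exprn_ege1.
rewrite /bump' normrM normrN !normrM !(ger0_norm (ler0n _ _)).
have : `|Num.max 0 (1 - x ^+ 2)| <= 1.
  rewrite ger0_norm ?le_max ?lexx// ge_max ler01/=.
  by rewrite gerBl sqr_ge0.
by have := normr_ge0 (Num.max 0 (1 - x ^+ 2)); have := normr_ge0 x; nra.
Qed.

End cutoff.

(** Domination for the limit of the cutoffs: x1 and x2 are the bumps in log |S| and tr (B S), y1 and
    y2 their derivatives, e = 1 / (n + 1), and a, s, t are the Stein operator and the two
    first-order traces. The constant 16 is the outer 4 times the bound 4 on the derivative of a
    bump. *)
Lemma cutoff_bound (R : realType) (w x1 x2 y1 y2 e a s t : R) :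
  0 <= x1 -> x1 <= 1 -> 0 <= x2 -> x2 <= 1 -> `|y1| <= 4 -> `|y2| <= 4 ->
  0 <= e -> e <= 1 ->
  `|4 * (w * (x1 * x2 * (a / 4) + x1 * y2 * (e * (t / 2)) + x2 * y1 * (e * s)))|
  <= `|w * a| + 16 * (`|w * s| + `|w * t|).
Proof.
move=> x10 x11 x20 x21 hy1 hy2 e0 e1.
have -> : 4 * (w * (x1 * x2 * (a / 4) + x1 * y2 * (e * (t / 2)) + x2 * y1 * (e * s)))
  = x1 * x2 * (w * a) + (2 * (x1 * y2 * e) * (w * t) + 4 * (x2 * y1 * e) * (w * s)).
  by field.
have h x y : 0 <= x -> x <= 1 -> `|y| <= 4 -> `|x * y * e| <= 4.
  move=> x0 x1' hy; rewrite !normrM (ger0_norm x0) (ger0_norm e0).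
  rewrite -[4](mulr1) ler_pM// ?mulr_ge0//.
  by rewrite -[4]mul1r ler_pM.
rewrite (le_trans (ler_normD _ _))// lerD//.
  rewrite normrM -[leRHS]mul1r ler_wpM2r// ger0_norm ?mulr_ge0//.
  by rewrite mulr_ile1.
rewrite (le_trans (ler_normD _ _))// mulrDr addrC lerD//.
  by rewrite normrM ler_wpM2r// normrM ger0_norm//; have := h x2 y1 x20 x21 hy1; lra.
by rewrite normrM ler_wpM2r// normrM ger0_norm//; have := h x1 y2 x10 x11 hy2; lra.
Qed.

Section stein_identity.
Context {R : realType} {d : nat}.
Local Notation M := 'M[R]_d.
Local Notation cone := (@posdefmx R d).

(** On the cone this is |S|^b exp(- tr (B S)). Writing it as one exponential makes it positive at
    every matrix and differentiable by a single chain rule. *)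
Definition weight (b : R) (B : M) (S : M) : R :=
  expR (b * ln (\det S) - \tr (B *m S)).

Lemma C1_with_weight b B : C1_with (weight b B)
  (fun H S => weight b B S * (b * \tr (invmx S *m H) - \tr (B *m H))).
Proof.
have C : C1_with (fun S => b * ln (\det S) - \tr (B *m S))
    (fun H S => b * \tr (invmx S *m H) - \tr (B *m H)).
  apply: (@C1_with_eq _ _ _ (fun H S => (b * \tr (invmx S *m H) + ln (\det S) * 0)
     + \tr (- B *m H))).
    by move=> i j S _; rewrite mulr0 addr0 mulNmx linearN.
  have -> : (fun S => b * ln (\det S) - \tr (B *m S)) =
     (fun S : M => b * ln (\det S) + \tr (- B *m S)).
    by apply/funext => S; rewrite mulNmx linearN.
  apply: C1_withD; last exact: C1_with_trace.
  by apply: C1_withM; [exact: C1_with_cst|exact: C1_with_lndet].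
apply: (C1_with_comp (phi' := expR)) C => // S _.
exact: continuous_expR.
Qed.

Definition cutoff (e : R) (B S : M) : R :=
  bump (e * ln (\det S)) * bump (e * \tr (B *m S)).

Lemma C1_with_cutoff e B : C1_with (cutoff e B) (fun H S =>
  bump (e * ln (\det S)) * (bump' (e * \tr (B *m S)) * (e * \tr (B *m H))) +
  bump (e * \tr (B *m S)) * (bump' (e * ln (\det S)) * (e * \tr (invmx S *m H)))).
Proof.
apply: C1_withM.
- apply: (C1_with_comp (F := fun S => e * ln (\det S)) (phi' := bump')).
  + by move=> S _; exact: is_derive_bump.
  + by move=> S _; exact: bump'_continuous.
  apply: (@C1_with_eq _ _ _ (fun H S => (e * \tr (invmx S *m H) + ln (\det S) * 0))).
    by move=> *; rewrite mulr0 addr0.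
  by apply: C1_withM; [exact: C1_with_cst|exact: C1_with_lndet].
- apply: (C1_with_comp (F := fun S => e * \tr (B *m S)) (phi' := bump')).
  + by move=> S _; exact: is_derive_bump.
  + by move=> S _; exact: bump'_continuous.
  apply: (@C1_with_eq _ _ _ (fun H S => (e * \tr (B *m H) + \tr (B *m S) * 0))).
    by move=> *; rewrite mulr0 addr0.
  by apply: C1_withM; [exact: C1_with_cst|exact: C1_with_trace].
Qed.

Lemma cutoff_off_core c B S : posdefmx B -> 0 < c -> posdefmx S ->
  ~ cone_core B c S -> cutoff c^-1 B S = 0.
Proof.
move=> pB c0 pS nc; rewrite /cutoff.
have [dS|dS] := leP (expR (- c)) (\det S); last first.
  rewrite bump_eq0 ?mul0r// -normrN ler_normr; apply/orP; left.
  rewrite -mulrN ler_pdivlMl// mulr1 lerNr -[leRHS]expRK ler_ln ?posrE ?expR_gt0//.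
    exact: ltW.
  exact: posdef_det_gt0.
have [tS|tS] := leP (\tr (B *m S)) c; first by case: nc; split=> //; exact: posdef_psd.
rewrite [X in _ * X]bump_eq0 ?mulr0// ler_normr; apply/orP; left.
by rewrite ler_pdivlMl// mulr1 ltW.
Qed.

Lemma C1_with_derive (F : M -> R) DF : C1_with F DF ->
  C1_with F (fun H S => 'D_H F S).
Proof.
move=> hF; apply: C1_with_eq (hF) => i j S pS.
by have [_ /(_ i j)[_ /(_ S pS)[_ <-]]] := hF.
Qed.

Lemma C1_posdef_with (F : M -> R) : cont_cone F -> C1_posdef F ->
  C1_with F (fun H S => 'D_H F S).
Proof.
move=> cF hF; split=> // i j; have [dF cD] := hF i j; split=> // S pS.
by apply: DeriveDef => //; exact: dF.
Qed.

Lemma C2_posdef_nabla (f : M -> R) l i : C2_posdef f ->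
  C1_with (nabla l i f) (fun H S => 'D_H (nabla l i f) S).
Proof.
move=> [h1 h2]; apply: C1_with_derive.
by apply: C1_withM; [exact: C1_with_cst|apply: C1_posdef_with; [exact: (h1 l i).2|exact: h2]].
Qed.

Local Notation coef i j := ((1 + (i == j)%:R) / 2 : R).

(** The factor of the symmetric gradient turns [free_dir j k] into the symmetrized matrix unit (E_jk
    + E_kj) / 2, on the diagonal as well as off it. Sums over free entries thereby become sums over
    all pairs of indices. *)
Lemma coef_free_dir (j k a b : 'I_d) : coef j k * free_dir j k a b =
  ((a == j)%:R * (b == k)%:R + (a == k)%:R * (b == j)%:R) / 2 :> R.
Proof.
rewrite /free_dir; case: eqVneq => [<-|jk]; rewrite !mxE -!mulnb !natrM.
  by rewrite mulr1n; field.
by rewrite mulr0n; field.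
Qed.

Lemma sum_sum_delta (A : M) p q :
  \sum_a \sum_b A a b * ((a == p)%:R * (b == q)%:R) = A p q.
Proof.
rewrite (bigD1 p)//= (bigD1 q)//= !eqxx !mulr1 big1 ?addr0; last first.
  by move=> j /negbTE ->; rewrite !mulr0.
by rewrite big1 ?addr0// => i /negbTE ->; rewrite big1// => j _; rewrite mul0r mulr0.
Qed.

Lemma coef_trace_free_dir (A : M) (j k : 'I_d) : A^T = A ->
  coef j k * \tr (A *m free_dir j k) = A j k.
Proof.
move=> sA; have -> : coef j k * \tr (A *m free_dir j k) =
    \sum_a \sum_b A a b * (coef j k * free_dir j k b a).
  rewrite mulr_sumr; apply: eq_bigr => a _; rewrite mxE mulr_sumr.
  by apply: eq_bigr => b _; rewrite mulrCA.
under eq_bigr => a _ do under eq_bigr => b _ do rewrite coef_free_dir.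
have -> : A j k = (A k j + A j k) / 2 by rewrite -[in A k j]sA mxE; field.
rewrite -(sum_sum_delta A k j) -(sum_sum_delta A j k) -big_split/= mulr_suml.
apply: eq_bigr => a _; rewrite -big_split/= mulr_suml.
by apply: eq_bigr => b _; field.
Qed.

Variables (Sigma : M) (pSigma : posdefmx Sigma) (alpha : R) (f : M -> R).
Let B : M := 2^-1 *: invmx Sigma.
Let b : R := (alpha - d%:R - 1) / 2.

Let pB : posdefmx B.
Proof. by apply: posdefZ; rewrite ?invr_gt0//; exact: posdef_inv. Qed.

(* The field is [Sigma *m grad f S *m S]; the sum over j, k of its derivatives,
   weighted by the coefficients of the symmetric gradient, is its divergence. *)
Definition vfield k j (S : M) : R :=
  \sum_i \sum_l Sigma k l * nabla l i f S * S i j.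

Definition Dvfield k j (H S : M) : R := \sum_i \sum_l
  (Sigma k l * nabla l i f S * H i j + S i j * (Sigma k l * 'D_H (nabla l i f) S)).

Lemma vfieldE k j S : vfield k j S = (Sigma *m grad f S *m S) k j.
Proof.
rewrite mxE; apply: eq_bigr => i _; rewrite mxE mulr_suml.
by apply: eq_bigr => l _; rewrite !mxE.
Qed.

Lemma C1_with_vfield k j : C2_posdef f -> C1_with (vfield k j) (Dvfield k j).
Proof.
move=> hf; apply: C1_with_sum => i; apply: C1_with_sum => l.
apply: (@C1_with_eq _ _ _ (fun H S => Sigma k l * nabla l i f S * H i j +
   S i j * (Sigma k l * 'D_H (nabla l i f) S + nabla l i f S * 0))).
  by move=> i' j' S _; rewrite mulr0 addr0.
apply: C1_withM; last exact: C1_with_coord.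
by apply: C1_withM; [exact: C1_with_cst|exact: C2_posdef_nabla].
Qed.

(** Product rule: derivatives falling on the gradient of f form the second-order term. Those falling
    on the factor S_ij contribute, after summation over j, (d + 1) / 2 when i = k and 0 otherwise;
    this is the shift between the exponent [b] and alpha / 2. *)
Lemma sum_coef_Dvfield S :
  \sum_j \sum_k coef j k * Dvfield k j (free_dir j k) S =
  tr_second_order Sigma f S + (d%:R + 1) / 2 * \tr (Sigma *m grad f S).
Proof.
have -> : tr_second_order Sigma f S = \sum_j \sum_k \sum_i \sum_l
    S i j * Sigma k l * nabla j k (nabla l i f) S.
  rewrite /tr_second_order [LHS]exchange_big/=; apply: eq_bigr => j _.
  by rewrite [LHS]exchange_big.
have -> : (d%:R + 1) / 2 * \tr (Sigma *m grad f S) = \sum_j \sum_k \sum_i \sum_l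
    Sigma k l * nabla l i f S * (coef j k * free_dir j k i j).
  rewrite [RHS]exchange_big/= [X in _ * X](_ : _ =
      \sum_k \sum_i \sum_l Sigma k l * nabla l i f S * (i == k)%:R); last first.
    apply: eq_bigr => k _; rewrite mxE exchange_big/=; apply: eq_bigr => l _.
    rewrite (bigD1 k)//= eqxx mulr1 mxE big1 ?addr0// => i /negbTE ->.
    by rewrite mulr0.
  rewrite mulr_sumr; apply: eq_bigr => k _.
  rewrite [RHS]exchange_big/= mulr_sumr; apply: eq_bigr => i _.
  rewrite [RHS]exchange_big/= mulr_sumr; apply: eq_bigr => l _.
  rewrite -mulr_sumr mulrCA; congr *%R.
  under eq_bigr do rewrite coef_free_dir eqxx mulr1.
  rewrite -mulr_suml big_split/=.
  have -> : \sum_(j < d) (i == k)%:R = d%:R * (i == k)%:R :> R.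
    by rewrite sumr_const card_ord mulr_natl.
  have -> : \sum_(j < d) (i == j)%:R * (j == k)%:R = (i == k)%:R :> R.
    rewrite (bigD1 i)//= eqxx mul1r big1 ?addr0// => j /negbTE; rewrite eq_sym => ->.
    by rewrite mul0r.
  by field.
rewrite -big_split; apply: eq_bigr => j _ /=; rewrite -big_split.
apply: eq_bigr => k _ /=; rewrite -big_split mulr_sumr; apply: eq_bigr => i _ /=.
rewrite -big_split mulr_sumr; apply: eq_bigr => l _ /=.
by rewrite [nabla j k _ S]/nabla /partial; ring.
Qed.

Lemma sum_coef_vfield A S : A^T = A ->
  \sum_j \sum_k coef j k * (vfield k j S * \tr (A *m free_dir j k)) =
  \tr (A *m (Sigma *m grad f S *m S)).
Proof.
move=> sA; apply: eq_bigr => j _; rewrite mxE; apply: eq_bigr => k _.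
by rewrite vfieldE mulrCA coef_trace_free_dir// mulrC.
Qed.

Lemma sum2_lin (I : finType) (x y z : R) (F1 F2 F3 : I -> I -> R) :
  x * (\sum_i \sum_j F1 i j) + y * (\sum_i \sum_j F2 i j) +
  z * (\sum_i \sum_j F3 i j) =
  \sum_i \sum_j (x * F1 i j + y * F2 i j + z * F3 i j).
Proof.
rewrite !mulr_sumr -!big_split/=; apply: eq_bigr => i _.
by rewrite !mulr_sumr -!big_split.
Qed.

(* The divergence of [cutoff e B * weight b B * vfield]. *)
Definition flux_div (e : R) (S : M) : R :=
  weight b B S * (cutoff e B S * (stein_op alpha Sigma f S / 4)
  + bump (e * ln (\det S)) * bump' (e * \tr (B *m S)) * (e * (\tr (S *m grad f S) / 2))
  + bump (e * \tr (B *m S)) * bump' (e * ln (\det S)) * (e * \tr (Sigma *m grad f S))).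

Lemma integral_flux_div c : 0 < c -> C2_posdef f ->
  sym_lebesgue.-integrable cone (EFin \o flux_div c^-1) /\
  (\int[sym_lebesgue]_(X in cone) (flux_div c^-1 X)%:E = 0)%E.
Proof.
move=> c0 hf; set e := c^-1.
(* The derivative of one component of the truncated field, in the shape produced by the product rule
   [C1_withM]. *)
pose DF j k H S := (cutoff e B S * weight b B S) * Dvfield k j H S + vfield k j S *
  (cutoff e B S * (weight b B S * (b * \tr (invmx S *m H) - \tr (B *m H))) +
   weight b B S * (bump (e * ln (\det S)) * (bump' (e * \tr (B *m S)) * (e * \tr (B *m H))) +
  bump (e * \tr (B *m S)) * (bump' (e * ln (\det S)) * (e * \tr (invmx S *m H))))).
have D j k : sym_lebesgue.-integrable cone (EFin \o DF j k (free_dir j k)) /\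
    (\int[sym_lebesgue]_(X in cone) (DF j k (free_dir j k) X)%:E = 0)%E.
  apply: (@cone_divergence _ _ (fun S => cutoff e B S * weight b B S * vfield k j S)
     (DF j k) B c) => //.
    apply: C1_withM; last exact: C1_with_vfield.
    by apply: C1_withM; [exact: C1_with_cutoff|exact: C1_with_weight].
  by move=> S pS nc; rewrite cutoff_off_core// !mul0r.
have FE S : cone S -> flux_div e S = \sum_j \sum_k coef j k * DF j k (free_dir j k) S.
  move=> pS; have uS := posdef_unit pS; have sS := pS.1.
  have sI : (invmx S)^T = invmx S by rewrite trmx_inv sS.
  have sB : B^T = B by exact: pB.1.
  (* The gradient S^-1 of log |S| cancels the factor S of the field, and the gradient B of tr (B S)
     cancels Sigma up to 1 / 2. The choice of cutoffs and field rests on these two cancellations. *)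
  have T1 : \tr (invmx S *m (Sigma *m grad f S *m S)) = \tr (Sigma *m grad f S).
    by rewrite mxtrace_mulC mulmxK.
  have T2 : \tr (B *m (Sigma *m grad f S *m S)) = \tr (S *m grad f S) / 2.
    rewrite /B -scalemxAl linearZ/= !mulmxA mulVmx ?posdef_unit// mul1mx.
    by rewrite mxtrace_mulC mulrC.
  have -> : \sum_j \sum_k coef j k * DF j k (free_dir j k) S =
    cutoff e B S * weight b B S *
      (\sum_j \sum_k coef j k * Dvfield k j (free_dir j k) S) +
    (cutoff e B S * weight b B S * b + weight b B S *
        bump (e * \tr (B *m S)) * bump' (e * ln (\det S)) * e) *
      (\sum_j \sum_k coef j k * (vfield k j S * \tr (invmx S *m free_dir j k))) +
    (- (cutoff e B S * weight b B S) + weight b B S *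
        bump (e * ln (\det S)) * bump' (e * \tr (B *m S)) * e) *
      (\sum_j \sum_k coef j k * (vfield k j S * \tr (B *m free_dir j k))).
    rewrite sum2_lin; apply: eq_bigr => j _; apply: eq_bigr => k _.
    by rewrite /DF; ring.
  (* Where no cutoff is differentiated, tr (Sigma grad f) has coefficient b + (d + 1) / 2 = alpha /
     2, tr (S grad f) has - 1 / 2 and the second-order term has 1: a quarter of [stein_op]. *)
  rewrite sum_coef_Dvfield !sum_coef_vfield// T1 T2 /flux_div /stein_op /b.
  rewrite mulmxBl -scalemxAl linearB linearZ/=.
  by field.
have iFE : sym_lebesgue.-integrable cone
    (fun S => \sum_j \sum_k (coef j k * DF j k (free_dir j k) S)%:E)%E.
  apply: integrable_sum => [|j _]; first exact: measurable_posdefmx.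
  apply: integrable_sum => [|k _]; first exact: measurable_posdefmx.
  under eq_fun do rewrite EFinM.
  by apply: integrableZl; [exact: measurable_posdefmx|exact: (D j k).1].
have E S : cone S -> (flux_div e S)%:E =
    (\sum_j \sum_k (coef j k * DF j k (free_dir j k) S)%:E)%E.
  by move=> pS; rewrite FE// -sumEFin; apply: eq_bigr => j _; rewrite -sumEFin.
split.
  apply: eq_integrable iFE; first exact: measurable_posdefmx.
  by move=> S /set_mem pS; rewrite /= E.
rewrite (eq_integral (fun S => (\sum_j \sum_k (coef j k * DF j k (free_dir j k) S)%:E)%E)); last first.
  by move=> S /set_mem pS; rewrite E.
rewrite integral_sum//; last 2 first.
  exact: measurable_posdefmx.
  move=> j; apply: integrable_sum => [|k _]; first exact: measurable_posdefmx.
  under eq_fun do rewrite EFinM.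
  by apply: integrableZl; [exact: measurable_posdefmx|exact: (D j k).1].
rewrite big1// => j _; rewrite integral_sum//; last 2 first.
  exact: measurable_posdefmx.
  move=> k; under eq_fun do rewrite EFinM.
  by apply: integrableZl; [exact: measurable_posdefmx|exact: (D j k).1].
rewrite big1// => k _; under eq_integral do rewrite EFinM.
rewrite integralZl//; [|exact: measurable_posdefmx|exact: (D j k).1].
by rewrite (D j k).2 mule0.
Qed.

Lemma cvg_flux_div S :
  4 * flux_div n.+1%:R^-1 S @[n --> \oo] --> weight b B S * stein_op alpha Sigma f S.
Proof.
(* The limit is put in the form of [flux_div] with 0 for 1 / (n + 1), so that the convergence can be
   proved factor by factor; [bump0] is what identifies it. *)
rewrite [X in _ --> X](_ : _ = 4 * (weight b B S * (bump (0 * ln (\det S)) *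
   bump (0 * \tr (B *m S)) * (stein_op alpha Sigma f S / 4)
  + bump (0 * ln (\det S)) * bump' (0 * \tr (B *m S)) * (0 * (\tr (S *m grad f S) / 2))
  + bump (0 * \tr (B *m S)) * bump' (0 * ln (\det S)) * (0 * \tr (Sigma *m grad f S))))); last first.
  by rewrite !mul0r !mulr0 !addr0 bump0; field.
have c0 : (n.+1%:R^-1 : R) @[n --> \oo] --> (0 : R) by exact: cvg_harmonic.
have cl (u : R) : n.+1%:R^-1 * u @[n --> \oo] --> 0 * u.
  by apply: cvgM => //; exact: cvg_cst.
have cb : continuous (@bump R).
  move=> x; apply: differentiable_continuous; apply/derivable1_diffP.
  by have [] := is_derive_bump x.
have cbl (u : R) : bump (n.+1%:R^-1 * u) @[n --> \oo] --> bump (0 * u).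
  exact: (cvg_comp _ _ (cl u) (cb _)).
have cbl' (u : R) : bump' (n.+1%:R^-1 * u) @[n --> \oo] --> bump' (0 * u).
  exact: (cvg_comp _ _ (cl u) (@bump'_continuous R _)).
apply: cvgM; first exact: cvg_cst.
apply: cvgM; first exact: cvg_cst.
apply: cvgD; first apply: cvgD.
- by apply: cvgM; [exact: cvgM|exact: cvg_cst].
- by apply: cvgM; [exact: cvgM|exact: cl].
- by apply: cvgM; [exact: cvgM|exact: cl].
Qed.

Local Open Scope ereal_scope.

(* The integral of the flux vanishes because both correction terms are
   bounded by integrable functions times [c^-1]; this is where the first two
   integrability conditions on [f] enter. *)
Lemma stein_identity : C2_posdef f ->
  sym_lebesgue.-integrable cone
    (EFin \o (fun S => weight b B S * \tr (Sigma *m grad f S))%R) ->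
  sym_lebesgue.-integrable cone
    (EFin \o (fun S => weight b B S * \tr (S *m grad f S))%R) ->
  sym_lebesgue.-integrable cone
    (EFin \o (fun S => weight b B S * tr_second_order Sigma f S)%R) ->
  sym_lebesgue.-integrable cone
    (EFin \o (fun S => weight b B S * stein_op alpha Sigma f S)%R) /\
  \int[sym_lebesgue]_(S in cone) (weight b B S * stein_op alpha Sigma f S)%:E = 0.
Proof.
move=> hf i1 i2 i3; have mc := @measurable_posdefmx R d.
have iA : sym_lebesgue.-integrable cone
    (EFin \o (fun S => weight b B S * stein_op alpha Sigma f S)%R).
  have -> : EFin \o (fun S => weight b B S * stein_op alpha Sigma f S)%R =
    (fun S => (2 * alpha)%:E * (weight b B S * \tr (Sigma *m grad f S))%:E +
     (- 2)%:E * (weight b B S * \tr (S *m grad f S))%:E +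
      4%:E * (weight b B S * tr_second_order Sigma f S)%:E).
    apply/funext => S; rewrite /stein_op /= -!EFinM -!EFinD mulmxBl -scalemxAl.
    by rewrite linearB linearZ/=; congr EFin; ring.
  by apply: integrableD => //; [apply: integrableD => //|]; exact: integrableZl.
split=> //.
have ig : sym_lebesgue.-integrable cone (fun S =>
   `|(weight b B S * stein_op alpha Sigma f S)%:E| +
   16%:E * (`|(weight b B S * \tr (Sigma *m grad f S))%:E| +
           `|(weight b B S * \tr (S *m grad f S))%:E|)).
  apply: integrableD => //; first exact: integrable_abse.
  by apply: integrableZl => //; apply: integrableD => //; exact: integrable_abse.
pose fn (n : nat) S := (4 * flux_div n.+1%:R^-1 S)%:E.
have ifn n : sym_lebesgue.-integrable cone (fn n) /\
   \int[sym_lebesgue]_(S in cone) fn n S = 0.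
  have [h1 h2] := @integral_flux_div n.+1%:R (ltr0Sn R n) hf; split.
    by rewrite /fn; under eq_fun do rewrite EFinM; exact: integrableZl.
  rewrite /fn; under eq_integral do rewrite EFinM.
  by rewrite integralZl// h2 mule0.
have cv S : cone S -> fn n S @[n --> \oo] --> (weight b B S * stein_op alpha Sigma f S)%:E.
  move=> _; apply: cvg_EFin; first exact: nearW.
  exact: cvg_flux_div.
have bd n S : cone S -> `|fn n S| <=
   `|(weight b B S * stein_op alpha Sigma f S)%:E| +
   16%:E * (`|(weight b B S * \tr (Sigma *m grad f S))%:E| +
           `|(weight b B S * \tr (S *m grad f S))%:E|).
  move=> _; suff : (`|4 * flux_div n.+1%:R^-1 S| <=
      `|weight b B S * stein_op alpha Sigma f S| +
      16 * (`|weight b B S * \tr (Sigma *m grad f S)| +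
            `|weight b B S * \tr (S *m grad f S)|))%R by rewrite -lee_fin.
  rewrite /flux_div /cutoff.
  have w0 : (0 <= weight b B S)%R by exact: expR_ge0.
  set e := (n.+1%:R^-1)%R.
  have e0 : (0 <= e)%R by rewrite invr_ge0.
  have e1 : (e <= 1)%R by rewrite invf_le1// ler1n.
  have b0 x := @bump_ge0 R x; have b1 x := @bump_le1 R x; have b' x := @bump'_le R x.
  exact: cutoff_bound.
have [_ _] := @dominated_convergence _ _ _ sym_lebesgue _ mc fn
   (EFin \o (fun S => weight b B S * stein_op alpha Sigma f S)%R) _
   (fun n => measurable_int _ (ifn n).1) (measurable_int _ iA) (aeW _ cv) ig
   (aeW _ (fun S n => bd n S)).
under eq_fun do rewrite (ifn _).2.
by move/cvg_lim => <- //; rewrite lim_cst.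
Qed.

End stein_identity.

(** * Normalization of the Wishart density *)

Section integral_density.
Local Open Scope ereal_scope.
Context d (T : measurableType d) (R : realType).
Variables (mu nu : {measure set T -> \bar R}) (D : set T) (mD : measurable D).
Variables (p : T -> R) (mp : measurable_fun setT p) (p0 : forall x, (0 <= p x)%R).
Hypothesis nuE : forall A, measurable A -> A `<=` D ->
  nu A = \int[mu]_(x in A) (p x)%:E.

Let mpD : measurable_fun D (EFin \o p).
Proof. by apply/measurable_EFinP; exact: measurable_funTS. Qed.

Let integral_density_indic E : measurable E ->
  \int[nu]_(x in D) (\1_E x)%:E = \int[mu]_(x in D) ((\1_E x)%:E * (p x)%:E).
Proof.
move=> mE; rewrite integral_indic// nuE//; last exact: measurableI.
rewrite setIC integral_mkcondr/=; apply: eq_integral => x _.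
by rewrite patchE indicE; case: ifPn => xE; rewrite ?mul1e ?mul0e.
Qed.

Import HBNNSimple.

Let integral_density_nnsfun (h : {nnsfun T >-> R}) :
  \int[nu]_(x in D) (h x)%:E = \int[mu]_(x in D) ((h x)%:E * (p x)%:E).
Proof.
under [LHS]eq_integral do rewrite fimfunE -fsumEFin//.
rewrite [LHS]ge0_integral_fsum//; last 2 first.
  - by move=> r; exact/measurable_EFinP/measurableT_comp.
  - by move=> n x _; rewrite EFinM nnfun_muleindic_ge0.
under [RHS]eq_integral.
  move=> x xD; rewrite fimfunE -fsumEFin// ge0_mule_fsuml; last first.
    by move=> r; rewrite EFinM nnfun_muleindic_ge0.
  over.
rewrite [RHS]ge0_integral_fsum//; last 2 first.
  - move=> r; apply: emeasurable_funM => //.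
    by apply/measurable_EFinP; do 2 apply/measurableT_comp => //.
  - by move=> n x _; apply: mule_ge0; [rewrite EFinM nnfun_muleindic_ge0|rewrite lee_fin].
apply: eq_fsbigr => r _; rewrite integralZl_indic_nnsfun//.
rewrite integral_density_indic//.
have [r0|r0] := leP 0%R r.
  rewrite -ge0_integralZl//.
  - by apply: eq_integral => x _; rewrite EFinM muleA.
  - by apply: emeasurable_funM => //; exact/measurable_EFinP/measurable_indic.
  - by move=> x _; rewrite mule_ge0 ?lee_fin.
rewrite (_ : h @^-1` [set r] = set0); last first.
  by rewrite -subset0 => x /= hx; have : (0 <= h x)%R by []; rewrite hx leNgt r0.
rewrite !integral0_eq ?mule0// => x _.
  by rewrite indic0 mulr0 mul0e.
by rewrite indic0 mul0e.
Qed.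

(** Indicators, then simple functions, then monotone limits. The density formula is assumed for
    subsets of [D] only, which fits [wishart], defined by integrals over sets cut with the cone. *)
Lemma ge0_integral_density (f : T -> \bar R) :
  measurable_fun D f -> (forall x, D x -> 0 <= f x) ->
  \int[nu]_(x in D) f x = \int[mu]_(x in D) (f x * (p x)%:E).
Proof.
move=> mf f0; pose f_ := nnsfun_approx mD mf.
transitivity (limn (fun n => \int[nu]_(x in D) (f_ n x)%:E)).
  rewrite -monotone_convergence//=.
  - apply: eq_integral => x /[!inE] xD; apply/esym/cvg_lim => //=.
    exact: cvg_nnsfun_approx.
  - by move=> n; exact/measurable_EFinP/measurable_funTS.
  - by move=> n x _; rewrite lee_fin.
  - by move=> x _ m n mn; rewrite lee_fin; exact/lefP/nd_nnsfun_approx.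
under eq_fun do rewrite integral_density_nnsfun.
rewrite -monotone_convergence//=.
- apply: eq_integral => x /[!inE] xD; apply: cvg_lim => //=.
  apply: cvgeZr => //; exact: cvg_nnsfun_approx.
- move=> n; apply: emeasurable_funM => //.
  exact/measurable_EFinP/measurable_funTS.
- by move=> n x _; rewrite mule_ge0 ?lee_fin.
- move=> x _ m n mn; rewrite lee_wpmul2r ?lee_fin//.
  exact/lefP/nd_nnsfun_approx.
Qed.

Lemma integrable_density (f : T -> R) : measurable_fun D f ->
  nu.-integrable D (EFin \o f) <->
  mu.-integrable D (EFin \o (fun x => p x * f x)%R).
Proof.
move=> mf; have mpf : measurable_fun D (fun x => p x * f x)%R.
  by apply: measurable_funM => //; exact: measurable_funTS.
have E : \int[nu]_(x in D) `|(f x)%:E| = \int[mu]_(x in D) `|(p x * f x)%:E|.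
  rewrite ge0_integral_density//; last first.
    by apply: measurableT_comp => //; exact/measurable_EFinP.
  by apply: eq_integral => x _; rewrite !abse_EFin normrM (ger0_norm (p0 x)) EFinM muleC.
split=> /integrableP[_ i]; apply/integrableP; split; try exact/measurable_EFinP.
  by rewrite -E.
by rewrite E.
Qed.

Lemma integral_density (f : T -> R) : measurable_fun D f ->
  \int[nu]_(x in D) (f x)%:E = \int[mu]_(x in D) (p x * f x)%:E.
Proof.
move=> mf; have mE : measurable_fun D (EFin \o f) by exact/measurable_EFinP.
rewrite integralE [RHS]integralE !ge0_integral_density//; last 2 first.
  exact: measurable_funeneg.
  exact: measurable_funepos.
congr (_ - _); apply: eq_integral => x _.
  rewrite !funeposE -[0%E]/(0%R%:E) -!EFin_max -EFinM; congr EFin.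
  by rewrite mulrC maxr_pMr// mulr0.
rewrite !funenegE -[0%E]/(0%R%:E) -!EFinN -!EFin_max -EFinM; congr EFin.
by rewrite mulrC maxr_pMr// mulr0 mulrN.
Qed.

End integral_density.

(** * Dilations of Lebesgue measure *)

Section scaling.
Context {R : realType}.
Local Open Scope ereal_scope.
Local Notation leb := (@lebesgue_measure R).

Lemma measurable_mulr (c : R) : measurable_fun setT (fun x : R => (c * x)%R).
Proof. by apply: measurable_funM => //; exact: measurable_cst. Qed.

(** By uniqueness of Lebesgue measure: c times its image under x -> c x gives half-open intervals
    their length. *)
Lemma ge0_integral_lebesgue_scale (c : R) (f : R -> \bar R) : (0 < c)%R ->
  measurable_fun setT f -> (forall x, 0 <= f x) ->
  \int[leb]_x f x = c%:E * \int[leb]_x f (c * x)%R.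
Proof.
move=> c0 mf f0; pose k : {nonneg R} := NngNum (ltW c0).
have mc := measurable_mulr c.
pose phi (x : measurableTypeR R) : measurableTypeR R := (c * x)%R.
have mphi : measurable_fun setT phi by exact: mc.
pose nu : {measure set (measurableTypeR R) -> \bar R} :=
  mscale k (measure_function_pushforward__canonical__measure_function_Measure leb mphi).
have E : forall A, measurable A -> leb A = nu A.
  apply: lebesgue_measure_unique => X /ocitvP[->|[[a b] /= ab ->]].
    by rewrite !measure0.
  rewrite /nu /mscale/= /pushforward /phi.
  rewrite [X in _ * leb X](_ : _ = `](a / c)%R, (b / c)%R]%classic); last first.
    apply/seteqP; split=> x /=; rewrite !in_itv/= => /andP[h1 h2].
      by rewrite ltr_pdivrMr// mulrC h1 ler_pdivlMr// mulrC.
    by rewrite mulrC -ltr_pdivrMr// h1 -ler_pdivlMr.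
  rewrite !lebesgue_measure_itv/= !lte_fin ab ltr_pM2r ?invr_gt0// ab.
  by rewrite -!EFinB -EFinM; congr EFin; field; rewrite gt_eqF.
rewrite (eq_measure_integral nu); last by move=> A mA _; exact: E.
by rewrite ge0_integral_mscale//= ge0_integral_pushforward.
Qed.

Definition scale_tuple n (c : R) (t : n.-tuple R) : n.-tuple R :=
  [tuple of map (fun x => c * x)%R t].

Lemma measurable_scale_tuple n c : measurable_fun setT (@scale_tuple n c).
Proof.
apply/measurable_fun_tnthP => i.
rewrite (_ : _ \o _ = (fun t : n.-tuple R => (c * tnth t i)%R)); last first.
  by apply/funext => t /=; rewrite tnth_map.
by apply: measurable_funM => //; exact: measurable_tnth.
Qed.

Lemma ge0_integral_lebesgue_tuple_scale n (c : R) (f : n.-tuple R -> \bar R) :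
  (0 < c)%R -> measurable_fun setT f -> (forall x, 0 <= f x) ->
  \int[lebesgue_tuple n]_t f t =
  (c ^+ n)%:E * \int[lebesgue_tuple n]_t f (scale_tuple c t).
Proof.
move=> c0; elim: n f => [|n IH] f mf f0.
  rewrite expr0 mul1e; apply: eq_integral => t _; congr f.
  by rewrite [t]tuple0 [scale_tuple _ _]tuple0.
have mfc : measurable_fun setT (fun p : R * n.-tuple R => f (cons_pair p)).
  by apply: measurableT_comp => //; exact: measurable_cons_pair.
have mfs : measurable_fun setT (f \o scale_tuple c).
  by apply: measurableT_comp => //; exact: measurable_scale_tuple.
rewrite !ge0_integral_lebesgue_tupleS//.
pose F (x : R) := \int[lebesgue_tuple n]_t f [tuple of x :: t].
have mF : measurable_fun setT F.
  apply: (measurable_fun_fubini_tonelli_F (f \o @cons_pair R n)) => //.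
  by move=> p; exact: f0.
have F0 x : 0 <= F x by apply: integral_ge0 => t _; exact: f0.
rewrite (ge0_integral_lebesgue_scale c0)// exprS EFinM -muleA; congr *%E.
pose G (x : R) := \int[lebesgue_tuple n]_t (f \o scale_tuple c) [tuple of x :: t].
have mG : measurable_fun setT G.
  apply: (measurable_fun_fubini_tonelli_F ((f \o scale_tuple c) \o @cons_pair R n)).
    by apply: measurableT_comp => //; exact: measurable_cons_pair.
  by move=> p; exact: f0.
rewrite -[RHS]ge0_integralZl//; last 2 first.
  by move=> x _; apply: integral_ge0 => t _; exact: f0.
  by rewrite lee_fin exprn_ge0// ltW.
apply: eq_integral => x _; rewrite IH//; last first.
  by apply: measurableT_comp => //; exact: measurable_consT.
congr *%E; apply: eq_integral => t _ /=; congr f; exact: val_inj.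
Qed.

End scaling.

Section gamma_integral.
Context {R : realType} {d : nat}.
Local Notation M := 'M[R]_d.
Local Notation cone := (@posdefmx R d).

Definition gamma_integral (b : R) (B : M) : \bar R :=
  (\int[sym_lebesgue]_(X in cone) (weight b B X)%:E)%E.

Lemma measurable_weight b B : measurable_fun cone (weight b B).
Proof. by apply: cont_cone_measurable; have [] := C1_with_weight b B. Qed.

Lemma weight_gt0 b B (S : M) : 0 < weight b B S.
Proof. exact: expR_gt0. Qed.

Lemma sym_of_scale_tuple c (t : 'C(d.+1, 2).-tuple R) :
  sym_of_tuple (scale_tuple c t) = c *: sym_of_tuple t :> M.
Proof.
apply/matrixP => i j; rewrite [RHS]mxE !sym_of_tuple_tnth.
by rewrite tnth_map.
Qed.

Lemma ge0_integral_sym_lebesgue (f : M -> R) :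
  measurable_fun cone f -> (forall S, 0 <= f S) ->
  (\int[sym_lebesgue]_(X in cone) (f X)%:E =
   \int[lebesgue_tuple 'C(d.+1, 2)]_t ((f \_ cone) (sym_of_tuple t))%:E)%E.
Proof.
move=> mf f0; rewrite integral_mkcond -/(comp EFin f) restrict_EFin.
rewrite ge0_integral_pushforward//.
- exact: measurable_sym_of_tuple.
- apply/measurable_EFinP/(measurable_restrictT _ _).1 => //.
  exact: measurable_posdefmx.
- by move=> S _; rewrite /= lee_fin patchE; case: ifP => // _; exact: f0.
Qed.

(** Scalar dilations are the only changes of variables made on the cone. They carry finiteness from
    the identity to c times the identity, and [posdef_trace_lower] then dominates the weight of an
    arbitrary positive definite B. *)
Lemma gamma_integral_scale b c : 0 < c ->
  gamma_integral b 1%:M = ((c ^+ 'C(d.+1, 2) * expR (b * (d%:R * ln c)))%:E *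
    gamma_integral b c%:M)%E.
Proof.
move=> c0; rewrite /gamma_integral !ge0_integral_sym_lebesgue//; last 4 first.
- exact: measurable_weight.
- by move=> S; exact/ltW/weight_gt0.
- exact: measurable_weight.
- by move=> S; exact/ltW/weight_gt0.
have mW B : measurable_fun setT (fun t : 'C(d.+1, 2).-tuple R =>
    ((weight b B \_ cone) (sym_of_tuple t))%:E).
  apply/measurable_EFinP; apply: measurableT_comp; last exact: measurable_sym_of_tuple.
  apply/(measurable_restrictT _ _).1; first exact: measurable_posdefmx.
  exact: measurable_weight.
have W0 B S : 0 <= (weight b B \_ cone) S.
  by rewrite patchE; case: ifP => // _; exact/ltW/weight_gt0.
have Wt0 (t : 'C(d.+1, 2).-tuple R) :
    (0%R <= ((weight b 1%:M \_ cone) (sym_of_tuple t))%:E)%E.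
  by rewrite lee_fin; exact: W0.
apply: (etrans (ge0_integral_lebesgue_tuple_scale c0 (mW 1%:M) Wt0)).
rewrite EFinM -muleA; congr *%E.
rewrite -ge0_integralZl//; last by move=> t _; rewrite lee_fin; exact: W0.
apply: eq_integral => t _; rewrite sym_of_scale_tuple -EFinM; congr EFin.
have coneE (S : M) : (c *: S \in (cone : set M)) = (S \in (cone : set M)).
  apply/idP/idP => /set_mem p; apply/mem_set; last exact: posdefZ.
  rewrite -[S]scale1r -(mulVf (lt0r_neq0 c0)) -scalerA; apply: posdefZ => //.
  by rewrite invr_gt0.
rewrite !patchE coneE; case: ifPn => [/set_mem p|_]; last by rewrite mulr0.
rewrite /weight -expRD; congr expR.
rewrite detZ lnM ?posrE ?exprn_gt0 ?posdef_det_gt0// lnXn// mul1mx mul_scalar_mx -mulr_natl.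
by ring.
Qed.

End gamma_integral.

Lemma trace_scale_mul (R : realType) d a (A B : 'M[R]_d) :
  \tr ((a *: A) *m B) = a * \tr (A *m B).
Proof. by rewrite -scalemxAl linearZ. Qed.

Lemma is_derive_trace_mul (R : realType) d (C H S : 'M[R]_d) :
  is_derive S H (fun S => \tr (C *m S)) (\tr (C *m H)).
Proof.
apply/is_derive_lineP.
have -> : (fun h : R => \tr (C *m (h *: H + S))) =
    (fun h => h * \tr (C *m H) + \tr (C *m S)).
  by apply/funext => h; rewrite mulmxDr -scalemxAr linearD linearZ.
by apply: is_derive_eq; rewrite /GRing.scale/=; ring.
Qed.

Section derive_weight_integral.
Context {R : realType} {d : nat}.
Local Notation M := 'M[R]_d.
Local Notation cone := (@posdefmx R d).
Variables (mu : {measure set M -> \bar R}) (b : R) (Th dTh : R -> M) (u v : R).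
Hypothesis dTh_is : forall s, s \in `]u, v[ -> forall i j,
  is_derive s (1 : R) (fun s => Th s i j) (dTh s i j).
Hypothesis iTh : forall s, s \in `]u, v[ ->
  mu.-integrable cone (EFin \o weight b (Th s)).

Lemma is_derive_trace_path (X : M) s : s \in `]u, v[ ->
  is_derive s (1 : R) (fun s => \tr (Th s *m X)) (\tr (dTh s *m X)).
Proof.
move=> sI; pose h (i j : 'I_d) : R -> R := fun s => Th s i j * X j i.
have -> : (fun s => \tr (Th s *m X)) = \sum_i \sum_j h i j.
  apply/funext => t; rewrite fct_sumE; apply: eq_bigr => i _.
  by rewrite mxE fct_sumE.
have -> : \tr (dTh s *m X) = \sum_i \sum_j dTh s i j * X j i.
  by apply: eq_bigr => i _; rewrite mxE.
apply: is_derive_sum => i; apply: is_derive_sum => j.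
have dij := dTh_is sI i j; rewrite /h.
apply: is_derive_eq.
by rewrite /GRing.scale/=; ring.
Qed.

Lemma is_derive_weight_path (X : M) s : s \in `]u, v[ ->
  is_derive s (1 : R) (fun s => weight b (Th s) X)
    (- \tr (dTh s *m X) * weight b (Th s) X).
Proof.
move=> sI; have dt := is_derive_trace_path X sI.
rewrite mulrC /weight; apply: (@is_derive1_comp _ expR (fun s => b * ln (\det X) - \tr (Th s *m X))).
have := is_deriveB (is_derive_cst (b * ln (\det X)) s 1) dt.
by rewrite sub0r; exact.
Qed.

Variable G : M -> R.
Hypotheses (G0 : forall X, 0 <= G X) (iG : mu.-integrable cone (EFin \o G)).
Hypothesis GTh : forall s X, s \in `]u, v[ -> cone X ->
  `|\tr (dTh s *m X) * weight b (Th s) X| <= G X.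

(** Differentiation under the integral sign, stated for a general measure and path because it serves
    twice: for [sym_lebesgue] along a segment, and with b = 0 for the Laplace transform of a law
    along [laplace_path]. *)
Lemma is_derive_weight_integral a : a \in `]u, v[ ->
  is_derive a (1 : R) (fun s => \int[mu]_(X in cone) weight b (Th s) X)
    (\int[mu]_(X in cone) (- \tr (dTh a *m X) * weight b (Th a) X)).
Proof.
move=> aI; pose f s X := weight b (Th s) X.
have Ia : `]u, v[%classic a by [].
have mc := @measurable_posdefmx R d.
have pE s X : s \in `]u, v[ -> partial1of2 f s X = - \tr (dTh s *m X) * weight b (Th s) X.
  by move=> sI; rewrite partial1of2E; have [] := is_derive_weight_path X sI.
have derf s X : `]u, v[%classic s -> cone X -> derivable (f ^~ X) s 1.
  by move=> sI _; have [] := is_derive_weight_path X sI.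
have bd s X : `]u, v[%classic s -> cone X -> `|partial1of2 f s X| <= G X.
  by move=> sI cX; rewrite pE// mulNr normrN; exact: GTh.
apply: DeriveDef.
  exact: (derivable_under_integral mc Ia iTh derf G0 iG bd).
rewrite -derive1E (differentiation_under_integral mc Ia iTh derf G0 iG bd).
by congr fine; apply: eq_integral => X _; rewrite pE.
Qed.

End derive_weight_integral.

Section gamma_normalization.
Context {R : realType} {d : nat}.
Local Notation M := 'M[R]_d.
Local Notation cone := (@posdefmx R d).
Variable b : R.

Lemma trace_mul_bound (C B : M) : posdefmx B ->
  exists2 K, 0 < K & forall S, cone S -> `|\tr (C *m S)| <= K * \tr (B *m S).
Proof.
move=> pB; have /posdef_coord_bound[K K0 hK] := pB.
exists (\sum_i \sum_j `|C i j| * K + K).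
  by rewrite ltr_wpDl// sumr_ge0// => i _; rewrite sumr_ge0// => j _; rewrite mulr_ge0// ltW.
move=> S cS; rewrite mulrDl (@le_trans _ _ ((\sum_i \sum_j `|C i j| * K) * \tr (B *m S)))//.
  rewrite mulr_suml (le_trans (ler_norm_sum _ _ _))// ler_sum// => i _.
  rewrite mxE mulr_suml (le_trans (ler_norm_sum _ _ _))// ler_sum// => j _.
  by rewrite normrM -mulrA ler_wpM2l// hK.
rewrite lerDl mulr_ge0 ?(ltW K0)//; apply: psd_trace_mul_ge0 => //.
exact: posdef_psd.
Qed.

Lemma ler_weight (B1 B2 S : M) : \tr (B1 *m S) <= \tr (B2 *m S) ->
  weight b B2 S <= weight b B1 S.
Proof. by move=> h; rewrite ler_expR lerD2l lerN2. Qed.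

(* [x <= (2 / t) e^(t x / 2)] is used with [t x = tr (B S)] *)
Lemma trace_weight_bound (C B : M) : posdefmx B ->
  exists2 K, 0 < K & forall S, cone S ->
    `|\tr (C *m S)| * weight b B S <= K * weight b (2^-1 *: B) S.
Proof.
move=> pB; have [K K0 hK] := trace_mul_bound C pB.
exists (2 * K) => [|S cS]; first by rewrite mulr_gt0.
rewrite (le_trans (ler_wpM2r (ltW (weight_gt0 _ _ _)) (hK S cS)))//.
rewrite -mulrA mulrCA -!mulrA ler_pM2l//.
rewrite /weight trace_scale_mul; set x := \tr (B *m S).
have -> : b * ln (\det S) - x = b * ln (\det S) - 2^-1 * x + - (2^-1 * x) by field.
rewrite [expR (_ + - (2^-1 * x))]expRD mulrCA [leRHS]mulrC ler_pM2l ?expR_gt0//.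
have := expR_ge1Dx (2^-1 * x); rewrite expRN ler_pdivrMr ?expR_gt0//; lra.
Qed.

Lemma gamma_integral_lt_pinfty : (gamma_integral b (1%:M : M) < +oo)%E ->
  forall B, posdefmx B -> sym_lebesgue.-integrable cone (EFin \o weight b B).
Proof.
move=> J1 B pB; have [c c0 hc] := posdef_trace_lower pB.
have mw (B' : M) : measurable_fun cone (EFin \o weight b B').
  by apply/measurable_EFinP; exact: measurable_weight.
have w0 (B' : M) S : cone S -> (0 <= (weight b B' S)%:E)%E.
  by move=> _; rewrite lee_fin; exact/ltW/weight_gt0.
apply/integrableP; split; first exact: mw.
under eq_integral => S _ do rewrite /= ger0_norm ?(ltW (weight_gt0 _ _ _))//.
apply: (@le_lt_trans _ _ (gamma_integral b (c%:M : M))).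
  apply: ge0_le_integral => //; try exact: mw; try exact: w0.
    exact: measurable_posdefmx.
  move=> S cS; rewrite lee_fin; apply: ler_weight.
  by rewrite mul_scalar_mx linearZ/=; exact: hc.
move: J1; rewrite (gamma_integral_scale _ c0); apply: contraTT.
rewrite -!leNgt !leye_eq => /eqP ->; rewrite gt0_muley//.
by rewrite lte_fin mulr_gt0 ?exprn_gt0 ?expR_gt0.
Qed.

Hypothesis J1 : (gamma_integral b (1%:M : M) < +oo)%E.

Lemma integrable_trace_weight (C B : M) : posdefmx B ->
  sym_lebesgue.-integrable cone (EFin \o (fun S => weight b B S * \tr (C *m S))).
Proof.
move=> pB; have [K K0 hK] := trace_weight_bound C pB.
have mc := @measurable_posdefmx R d.
have mt : measurable_fun cone (fun S => weight b B S * \tr (C *m S)).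
  apply: measurable_funM; first exact: measurable_weight.
  by apply: cont_cone_measurable; exact: cont_coneT (@trace_mul_continuous _ _ _).
apply: (@le_integrable _ _ _ _ _ mc _ (EFin \o (fun S => K * weight b (2^-1 *: B) S))).
- exact/measurable_EFinP.
- move=> S cS; rewrite /= lee_fin normrM mulrC (ger0_norm (ltW (weight_gt0 b B S))).
  by rewrite (le_trans (hK _ cS))// ler_norm.
- rewrite (_ : EFin \o _ = fun S => (K%:E * (weight b (2^-1 *: B) S)%:E)%E)//.
  apply: integrableZl => //; apply: gamma_integral_lt_pinfty => //.
  by apply: posdefZ => //; rewrite invr_gt0.
Qed.

Local Notation coef i j := ((1 + (i == j)%:R) / 2 : R).

Lemma nabla_trace_mul (C : M) i j : C^T = C ->
  nabla i j (fun S : M => \tr (C *m S)) = fun=> C i j.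
Proof.
move=> sC; apply/funext => S; rewrite /nabla /partial.
have [_ ->] := is_derive_trace_mul C (free_dir i j) S.
exact: coef_trace_free_dir.
Qed.

Lemma C2_posdef_trace_mul (C : M) : C2_posdef (fun S : M => \tr (C *m S)).
Proof.
have E i j : partial i j (fun S : M => \tr (C *m S)) = cst (\tr (C *m free_dir i j)).
  by apply/funext => S; rewrite /partial; have [_ ->] := is_derive_trace_mul C (free_dir i j) S.
split=> i j.
  split=> [S _|]; last by rewrite E; exact: cont_cone_cst.
  by have [] := is_derive_trace_mul C (free_dir i j) S.
rewrite E => k l; split=> [S _|]; first exact: derivable_cst.
rewrite (_ : partial _ _ _ = cst 0); first exact: cont_cone_cst.
by apply/funext => S; rewrite /partial derive_cst.
Qed.

(** Stein identity for S -> tr (C S), whose gradient is the constant C and whose second-order term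
    is zero. Read as a derivative in B, it says that the integral of the weight varies like a power
    of |B|. *)
Lemma gamma_first_moment (C B : M) : posdefmx B -> C^T = C ->
  \int[sym_lebesgue]_(X in cone) (\tr (C *m X) * weight b B X) =
  (b + (d%:R + 1) / 2) * \tr (invmx B *m C) *
    \int[sym_lebesgue]_(X in cone) weight b B X.
Proof.
(* The parameters for which the weight of the Stein identity is the given [weight b B]. *)
move=> pB sC; pose Sigma := 2^-1 *: invmx B; pose alpha := 2 * b + d%:R + 1.
pose f (S : M) := \tr (C *m S).
have pS : posdefmx Sigma by apply: posdefZ; rewrite ?invr_gt0//; exact: posdef_inv.
have BE : 2^-1 *: invmx Sigma = B.
  rewrite /Sigma invmxZ ?unitfE ?unitmx_inv ?posdef_unit// invmxK invrK scalerA.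
  by rewrite mulVf// scale1r.
have bE : (alpha - d%:R - 1) / 2 = b by rewrite /alpha; field.
have gE S : grad f S = C.
  by apply/matrixP => i j; rewrite mxE nabla_trace_mul.
have t0 S : tr_second_order Sigma f S = 0.
  rewrite /tr_second_order big1// => i _; rewrite big1// => j _.
  rewrite big1// => k _; rewrite big1// => l _; rewrite nabla_trace_mul//.
  by rewrite {1}/nabla /partial derive_cst !mulr0.
have mc := @measurable_posdefmx R d.
have iw := gamma_integral_lt_pinfty J1 pB.
have it := integrable_trace_weight C pB.
have := @stein_identity R d Sigma pS alpha f (C2_posdef_trace_mul C).
rewrite BE bE => /(_ _ _ _) H.
have {H}[|||_] := H.
- rewrite (_ : EFin \o _ = fun S => ((\tr (Sigma *m C))%:E * (weight b B S)%:E)%E).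
    exact: integrableZl.
  by apply/funext => S; rewrite /= gE mulrC EFinM.
- rewrite (_ : EFin \o _ = EFin \o (fun S => weight b B S * \tr (C *m S)))//.
  by apply/funext => S; rewrite /= gE mxtrace_mulC.
- rewrite (_ : EFin \o _ = cst 0%E); first exact: integrable0.
  by apply/funext => S; rewrite /= t0 mulr0.
move=> /(congr1 fine); rewrite -[LHS]/(\int[_]_(_ in _) _) /=.
rewrite (@eq_Rintegral _ _ _ _ _ (fun S => (2 * alpha * \tr (Sigma *m C)) * weight b B S
    - 2 * (\tr (C *m S) * weight b B S))); last first.
  move=> S _; rewrite /stein_op gE t0 mulmxBl -scalemxAl linearB linearZ/=.
  by rewrite (mxtrace_mulC S); ring.
have it' : sym_lebesgue.-integrable cone (EFin \o (fun S => \tr (C *m S) * weight b B S)).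
  by rewrite (_ : EFin \o _ = EFin \o (fun S => weight b B S * \tr (C *m S)))//;
    apply/funext => S /=; rewrite mulrC.
rewrite RintegralB//; last 2 first.
- by rewrite (_ : EFin \o _ = fun S => ((2 * alpha * \tr (Sigma *m C))%:E * (weight b B S)%:E)%E)//; exact: integrableZl.
- by rewrite (_ : EFin \o _ = fun S => (2%:E * (\tr (C *m S) * weight b B S)%:E)%E)//; exact: integrableZl.
rewrite !RintegralZl// /Sigma trace_scale_mul /alpha => h.
by lra.
Qed.

Lemma is_derive_gamma_line (A H : M) s0 : posdefmx A -> H^T = H ->
  is_derive s0 (1 : R)
    (fun s => \int[sym_lebesgue]_(X in cone) weight b (A + (s - s0) *: H) X)
    (- ((b + (d%:R + 1) / 2) * \tr (invmx A *m H) *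
      \int[sym_lebesgue]_(X in cone) weight b A X)).
Proof.
move=> pA sH; pose L s := A + (s - s0) *: H.
have pA2 : posdefmx (2^-1 *: A) by apply: posdefZ => //; rewrite invr_gt0.
(* Half of A absorbs the perturbation and the other half remains, so nearby weights are dominated by
   the weight of A / 2. The factor tr (H X) costs another half, hence A / 4 in the dominating
   function. *)
have [e /= e0 he] : nbhs s0 [set s | posdefmx (2^-1 *: A + (s - s0) *: H)].
  apply: near_line_posdef => //; first exact: pA2.1.
  by rewrite subrr scale0r addr0.
have {}he s : s \in `]s0 - e, s0 + e[ -> posdefmx (2^-1 *: A + (s - s0) *: H).
  move=> sI; apply: he; rewrite /= ltr_distlC.
  by move: sI; rewrite in_itv.
have LE s : L s = 2^-1 *: A + (s - s0) *: H + 2^-1 *: A.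
  rewrite addrAC -scalerDl /L (_ : 2^-1 + 2^-1 = 1) ?scale1r//; by field.
have [K K0 hK] := trace_weight_bound H pA2.
have pA4 : posdefmx (2^-1 *: (2^-1 *: A)) by apply: posdefZ => //; rewrite invr_gt0.
have mc := @measurable_posdefmx R d.
have := @is_derive_weight_integral R d sym_lebesgue b L (fun=> H) (s0 - e) (s0 + e) _ _
  (fun X => K * weight b (2^-1 *: (2^-1 *: A)) X) _ _ _ s0.
rewrite (_ : \int[_]_(X in _) (- \tr (H *m X) * weight b (L s0) X) =
  - ((b + (d%:R + 1) / 2) * \tr (invmx A *m H) *
      \int[sym_lebesgue]_(X in cone) weight b A X)); last first.
  rewrite -gamma_first_moment// -mulN1r -RintegralZl//; last first.
    rewrite (_ : EFin \o _ = EFin \o (fun S => weight b A S * \tr (H *m S))).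
      exact: integrable_trace_weight.
    by apply/funext => S /=; rewrite mulrC.
  apply: eq_Rintegral => X _.
  by rewrite /L subrr scale0r addr0 mulN1r mulNr.
apply.
- move=> s _ i j; rewrite (_ : (fun s => L s i j) = fun s => A i j + (s - s0) * H i j).
    by apply: is_derive_eq; rewrite /GRing.scale/=; ring.
  by apply/funext => t; rewrite !mxE.
- move=> s sI; apply: gamma_integral_lt_pinfty => //.
  by rewrite LE; apply: posdefD => //; exact: he.
- by move=> X; rewrite mulr_ge0 ?(ltW K0)//; exact/ltW/weight_gt0.
- rewrite (_ : EFin \o _ = fun X => (K%:E * (weight b (2^-1 *: (2^-1 *: A)) X)%:E)%E)//.
  by apply: integrableZl => //; exact: gamma_integral_lt_pinfty.
- move=> s X sI cX; apply: le_trans (hK X cX).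
  rewrite normrM ler_wpM2l// ger0_norm ?(ltW (weight_gt0 _ _ _))//.
  apply: ler_weight; rewrite LE mulmxDl linearD/= lerDr.
  by apply: psd_trace_mul_ge0 => //; apply: posdef_psd; exact: he.
- by rewrite in_itv/= ltrBlDr !ltrDl e0.
Qed.

(** Along the segment from the identity to B, which stays in the cone by convexity, the logarithmic
    derivatives of the two factors are opposite, so their product is constant. *)
Lemma gamma_normalization (B : M) : posdefmx B ->
  expR ((b + (d%:R + 1) / 2) * ln (\det B)) *
    \int[sym_lebesgue]_(X in cone) weight b B X =
  \int[sym_lebesgue]_(X in cone) weight b 1%:M X.
Proof.
move=> pB; set a := b + _; pose H : M := B - 1%:M.
have sH : H^T = H by rewrite linearB/= tr_scalar_mx pB.1.
pose L (s : R) : M := 1%:M + (s - 0) *: H.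
have pL (s : R) : 0 <= s -> s <= 1 -> posdefmx (L s).
  rewrite le_eqVlt => /predU1P[<- _|s0]; first by rewrite /L subrr scale0r addr0; exact: posdef1.
  move=> s1; rewrite (_ : L s = s *: B + (1 - s) *: 1%:M).
    apply: posdefDpsd; first exact: posdefZ.
    by apply: psdZ; [rewrite subr_ge0|exact/posdef_psd/posdef1].
  rewrite /L subr0 /H scalerBr scalerBl scale1r.
  by rewrite addrCA.
pose K (s : R) := expR (a * ln (\det (L s))) *
  \int[sym_lebesgue]_(X in cone) weight b (L s) X.
have dK (s : R) : 0 <= s -> s <= 1 -> is_derive s (1 : R) K 0.
  move=> s0 s1; have pLs := pL _ s0 s1.
  have dJ := is_derive_gamma_line s pLs sH.
  have LE t : L s + (t - s) *: H = L t.
    by rewrite /L -addrA -scalerDl; congr (_ + _ *: _); ring.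
  rewrite (_ : (fun t : R => _) = fun t => \int[sym_lebesgue]_(X in cone) weight b (L t) X) in dJ; last first.
    by apply/funext => t; rewrite LE.
  have dD : is_derive s (1 : R) (fun t => ln (\det (L t))) (\tr (invmx (L s) *m H)).
    exact: (@is_derive_line _ _ 1%:M H 0 (fun S => ln (\det S))
      (fun S => \tr (invmx S *m H)) (fun S pS => is_derive_lndet H pS) s pLs).
  have dE : is_derive s (1 : R) (fun t => expR (a * ln (\det (L t))))
      (expR (a * ln (\det (L s))) * (a * \tr (invmx (L s) *m H))).
    exact: (@is_derive1_comp _ expR (fun t => a * ln (\det (L t)))).
  apply: is_derive_eq; rewrite /GRing.scale/=; rewrite -/a; ring.
have [||c _] := @MVT _ K (cst 0) 0 1 ltr01.
- by move=> x; rewrite in_itv/= => /andP[x0 x1]; apply: dK; exact: ltW.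
- apply: derivable_within_continuous => x; rewrite in_itv/= => /andP[x0 x1].
  by have [] := dK _ x0 x1.
rewrite mul0r => /eqP; rewrite subr_eq0 => /eqP; rewrite /K /L !subr0 scale0r addr0.
by rewrite scale1r addrC subrK det1 ln1 mulr0 expR0 mul1r.
Qed.

End gamma_normalization.

(** * Exponential test functions *)

Section frobenius.
Context {R : realType} {d : nat}.
Local Notation M := 'M[R]_d.

Definition sqsum (A : M) : R := \sum_i \sum_j A i j ^+ 2.

Lemma sqsum_ge0 A : 0 <= sqsum A.
Proof. by rewrite sumr_ge0// => i _; rewrite sumr_ge0// => j _; rewrite sqr_ge0. Qed.

Lemma frobenius_normE A : frobenius_norm A ^+ 2 = sqsum A.
Proof. by rewrite sqr_sqrtr// sqsum_ge0. Qed.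

Lemma sqr_le_sqsum (A : M) i j : A i j ^+ 2 <= sqsum A.
Proof.
rewrite /sqsum (bigD1 i)//= (bigD1 j)//= -addrA lerDl addr_ge0//.
  by rewrite sumr_ge0// => k _; rewrite sqr_ge0.
by rewrite sumr_ge0// => k _; rewrite sumr_ge0// => l _; rewrite sqr_ge0.
Qed.

(** A crude constant, enough for finiteness: each of the d^2 entries of the product is at most d
    times the product of the two norms. *)
Lemma sqsum_mul A B : sqsum (A *m B) <= d%:R ^+ 4 * (sqsum A * sqsum B).
Proof.
set a := Num.sqrt (sqsum A); set b := Num.sqrt (sqsum B).
have hA i j : `|A i j| <= a by rewrite -sqrtr_sqr ler_wsqrtr// sqr_le_sqsum.
have hB i j : `|B i j| <= b by rewrite -sqrtr_sqr ler_wsqrtr// sqr_le_sqsum.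
have a2 : a ^+ 2 = sqsum A by rewrite sqr_sqrtr// sqsum_ge0.
have b2 : b ^+ 2 = sqsum B by rewrite sqr_sqrtr// sqsum_ge0.
have hAB i j : (A *m B) i j ^+ 2 <= (d%:R * (a * b)) ^+ 2.
  rewrite -[leLHS]real_normK ?num_real// lerXn2r ?nnegrE ?mulr_ge0 ?sqrtr_ge0//.
  rewrite mxE (le_trans (ler_norm_sum _ _ _))//.
  rewrite (@le_trans _ _ (\sum_(k < d) a * b))//; last first.
    by rewrite sumr_const card_ord mulr_natl.
  by apply: ler_sum => k _; rewrite normrM ler_pM.
rewrite (@le_trans _ _ (\sum_(i < d) \sum_(j < d) (d%:R * (a * b)) ^+ 2))//.
  by apply: ler_sum => i _; apply: ler_sum => j _; exact: hAB.
have -> : \sum_(i < d) \sum_(j < d) (d%:R * (a * b)) ^+ 2 =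
    d%:R * (d%:R * (d%:R * (a * b)) ^+ 2).
  by rewrite !sumr_const card_ord !mulr_natl.
by rewrite -a2 -b2 le_eqVlt; apply/orP; left; apply/eqP; ring.
Qed.

Lemma sqsumZ c A : sqsum (c *: A) = c ^+ 2 * sqsum A.
Proof.
rewrite /sqsum mulr_sumr; apply: eq_bigr => i _; rewrite mulr_sumr.
by apply: eq_bigr => j _; rewrite mxE exprMn.
Qed.

(* No square root is needed here: if [S] had none, [sqrtmx S] would be the
   default point. *)
Lemma sqsum_sqrtmx (S : M) : posdefmx S ->
  sqsum (sqrtmx S) <= \tr S + sqsum (point : M).
Proof.
move=> pS; have t0 : 0 <= \tr S.
  by rewrite sumr_ge0// => i _; exact/psd_diag_ge0/posdef_psd.
have [ex|nex] := pselect (exists B : M, psdmx B /\ B *m B = S); last first.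
  have -> : sqrtmx S = point by apply: xgetPN => B h; apply: nex; exists B.
  by rewrite lerDr.
have [[sB _] BS] := xgetPex point ex; rewrite -/(sqrtmx S) in sB BS *.
set B := sqrtmx S in sB BS *.
rewrite -[in leRHS]BS (_ : \tr (B *m B) = sqsum B) ?lerDl ?sqsum_ge0//.
apply: eq_bigr => i _; rewrite mxE; apply: eq_bigr => j _.
by rewrite expr2 -[in X in _ * X]sB mxE.
Qed.

End frobenius.

Section exponential_test_functions.
Context {R : realType} {d : nat}.
Local Notation M := 'M[R]_d.
Local Notation cone := (@posdefmx R d).

Definition expfun (Th : M) (S : M) : R := expR (- \tr (Th *m S)).

(** The constant [c] makes the family stable under partial derivatives, so the same lemma also gives
    the second derivatives. *)
Lemma is_derive_expfun c (Th H S : M) :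
  is_derive S H (fun S => c * expfun Th S) (- c * \tr (Th *m H) * expfun Th S).
Proof.
have -> : - c * \tr (Th *m H) * expfun Th S =
    (c * - expR (- \tr (Th *m S))) * \tr (Th *m H) by rewrite /expfun; ring.
apply: (@is_derive_comp_real _ _ (fun S => \tr (Th *m S)) (fun x => c * expR (- x))).
  exact: is_derive_trace_mul.
by apply: is_derive_eq; rewrite /GRing.scale/=; ring.
Qed.

Lemma partial_expfun c (Th : M) i j : partial i j (fun S => c * expfun Th S) =
  fun S => (- c * \tr (Th *m free_dir i j)) * expfun Th S.
Proof.
by apply/funext => S; rewrite /partial;
  have [_ ->] := is_derive_expfun c Th (free_dir i j) S.
Qed.

Lemma nabla_expfun c (Th : M) i j : Th^T = Th ->
  nabla i j (fun S => c * expfun Th S) = fun S => (- c * Th i j) * expfun Th S.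
Proof.
move=> sT; apply/funext => S; rewrite /nabla partial_expfun.
by rewrite -(coef_trace_free_dir i j sT); ring.
Qed.

Lemma expfun1 (Th : M) : expfun Th = (fun S => 1 * expfun Th S).
Proof. by apply/funext => S; rewrite mul1r. Qed.

Lemma grad_expfun (Th S : M) : Th^T = Th -> grad (expfun Th) S = - expfun Th S *: Th.
Proof.
move=> sT; apply/matrixP => i j; rewrite !mxE expfun1 nabla_expfun//=; ring.
Qed.

Lemma tr_second_order_expfun (Sigma Th S : M) : Th^T = Th ->
  tr_second_order Sigma (expfun Th) S = \tr (Th *m Sigma *m Th *m S) * expfun Th S.
Proof.
move=> sT; rewrite mulrC mxtrace_mulC mulr_sumr; apply: eq_bigr => i _.
rewrite mxE mulr_sumr; apply: eq_bigr => j _.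
rewrite mxE mulrCA mulr_sumr.
transitivity (\sum_k \sum_l S i j * (expfun Th S * (Th j k * Sigma k l * Th l i))).
  apply: eq_bigr => k _; apply: eq_bigr => l _.
  by rewrite [in LHS](expfun1 Th) !nabla_expfun//; ring.
rewrite exchange_big/= mulr_sumr; apply: eq_bigr => l _.
rewrite -mulr_sumr; congr *%R; rewrite -mulr_sumr; congr *%R.
by rewrite mxE mulr_suml.
Qed.

Lemma stein_op_expfun alpha (Sigma Th S : M) : Th^T = Th ->
  stein_op alpha Sigma (expfun Th) S = expfun Th S *
    (2 * \tr (Th *m S) + 4 * \tr (Th *m Sigma *m Th *m S) - 2 * alpha * \tr (Sigma *m Th)).
Proof.
move=> sT; rewrite /stein_op tr_second_order_expfun// grad_expfun//.
rewrite -scalemxAr linearZ/= mulmxBl linearB/= trace_scale_mul (mxtrace_mulC S).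
by ring.
Qed.

Lemma cont_cone_expfun (Th : M) : cont_cone (expfun Th).
Proof.
apply: (cont_cone_comp (phi := fun x => expR (- x))).
  by move=> S _; apply: continuous_comp; [exact: opp_continuous|exact: continuous_expR].
exact: cont_coneT (@trace_mul_continuous _ _ _).
Qed.

Lemma C1_posdef_expfun c (Th : M) : C1_posdef (fun S => c * expfun Th S).
Proof.
move=> i j; split=> [S _|]; first by have [] := is_derive_expfun c Th (free_dir i j) S.
by rewrite partial_expfun; apply: cont_coneM; [exact: cont_cone_cst|exact: cont_cone_expfun].
Qed.

Lemma C2_posdef_expfun (Th : M) : C2_posdef (expfun Th).
Proof.
rewrite expfun1; split; first exact: C1_posdef_expfun.
by move=> i j; rewrite partial_expfun; exact: C1_posdef_expfun.
Qed.

(** Meant also for functions built from [sqrtmx], whose measurability is never established: the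
    comparison is made directly between the suprema over simple functions that define the two
    integrals. *)
Lemma finite_mean_bounded (mu : {measure set M -> \bar R}) (g : M -> R) C :
  (mu cone < +oo)%E -> (forall S, cone S -> `|g S| <= C) -> finite_mean mu g.
Proof.
move=> mc gC; rewrite /finite_mean.
apply: (@le_lt_trans _ _ (\int[mu]_(X in cone) `|C|%:E)%E).
  rewrite [leLHS]integral_mkcond [leRHS]integral_mkcond !ge0_integralTE; last 2 first.
  - by move=> S; rewrite patchE; case: ifP.
  - by move=> S; rewrite patchE; case: ifP.
  apply: le_ereal_sup => _ [h hg <-]; exists h => // S.
  apply: le_trans (hg S) _; rewrite !patchE; case: ifPn => // /set_mem cS.
  by rewrite lee_fin (le_trans (gC _ cS))// ler_norm.
rewrite integral_cst; last exact: measurable_posdefmx.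
by rewrite lte_mul_pinfty.
Qed.

Lemma mul_expN_le1 (x : R) : x * expR (- x) <= 1.
Proof. by rewrite expRN ler_pdivrMr ?expR_gt0// mul1r; have := expR_ge1Dx x; lra. Qed.

Lemma C2_stein_expfun alpha (Sigma Th : M) : posdefmx Th ->
  (wishart alpha Sigma cone < +oo)%E -> C2_stein alpha Sigma (expfun Th).
Proof.
move=> pT mW; have sT := pT.1.
have t0 S : cone S -> 0 <= \tr (Th *m S).
  by move=> cS; apply: psd_trace_mul_ge0 => //; exact: posdef_psd.
have e0 S : 0 <= expfun Th S by exact: expR_ge0.
have e1 S : cone S -> expfun Th S <= 1.
  by move=> cS; rewrite -expR0 ler_expR oppr_le0 t0.
have bnd (C : M) : exists K, forall S, cone S -> `|\tr (C *m S)| * expfun Th S <= K.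
  have [K K0 hK] := trace_mul_bound C pT; exists K => S cS.
  rewrite (le_trans (ler_wpM2r (e0 _) (hK _ cS)))// -mulrA -[leRHS]mulr1.
  by rewrite ler_pM2l//; exact: mul_expN_le1.
split.
- exact: C2_posdef_expfun.
- apply: (@finite_mean_bounded _ _ `|\tr (Sigma *m Th)|) => // S cS.
  rewrite grad_expfun// -scalemxAr linearZ/= normrM normrN (ger0_norm (e0 _)).
  by rewrite ler_piMl// e1.
- have [K hK] := bnd Th; apply: (@finite_mean_bounded _ _ K) => // S cS.
  rewrite grad_expfun// -scalemxAr linearZ/= normrM normrN (ger0_norm (e0 _)).
  by rewrite mulrC mxtrace_mulC; exact: hK.
- have [K hK] := bnd (Th *m Sigma *m Th).
  apply: (@finite_mean_bounded _ _ K) => // S cS.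
  by rewrite tr_second_order_expfun// normrM (ger0_norm (e0 _)); exact: hK.
split.
- apply: (@finite_mean_bounded _ _ 1) => // S cS.
  by rewrite ger0_norm// e1.
(* The squared Frobenius norm carries two exponential factors: one absorbs tr S, the other is at
   most 1. The term [k] accounts for the default value in [sqsum_sqrtmx]. *)
have [K hK] := bnd 1%:M.
set k := sqsum (point : M).
apply: (@finite_mean_bounded _ _
   (d%:R ^+ 4 * (d%:R ^+ 4 * ((K + k) * sqsum Th) * sqsum (sqrtmx Sigma)))) => // S cS.
rewrite frobenius_normE ger0_norm ?sqsum_ge0//.
rewrite (le_trans (sqsum_mul _ _))// ler_wpM2l ?exprn_ge0// ler_wpM2r ?sqsum_ge0//.
rewrite (le_trans (sqsum_mul _ _))// ler_wpM2l ?exprn_ge0//.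
rewrite grad_expfun// sqsumZ sqrrN mulrA ler_wpM2r ?sqsum_ge0//.
rewrite expr2 mulrA.
have k0 : 0 <= k by exact: sqsum_ge0.
have h1 := hK _ cS; rewrite mul1mx in h1.
have {}h1 : \tr S * expfun Th S <= K.
  by apply: le_trans h1; rewrite ler_wpM2r// ler_norm.
have h2 : sqsum (sqrtmx S) * expfun Th S <= K + k.
  rewrite (le_trans (ler_wpM2r (e0 S) (sqsum_sqrtmx cS)))// mulrDl lerD//.
  by rewrite ler_piMr// e1.
by rewrite (le_trans _ h2)// ler_piMr ?mulr_ge0 ?sqsum_ge0// e1.
Qed.

End exponential_test_functions.

(** * Uniqueness of Laplace transforms *)

Section sharp_polynomials.
Context {R : realType}.

(* As [n] grows, [(1 - y^n)^(n 2^n)] tends on [0, 1] to the indicator of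
   [y < 1 / 2]. *)
Definition sharp (n : nat) (y : R) : R := (1 - y ^+ n) ^+ (n * 2 ^ n).

Lemma sharp_bound n y : 0 <= y -> y <= 1 -> 0 <= sharp n y <= 1.
Proof.
move=> y0 y1; have h0 : 0 <= 1 - y ^+ n by rewrite subr_ge0 exprn_ile1.
rewrite exprn_ge0//= exprn_ile1// gerBl exprn_ge0//.
Qed.

Lemma one_sub_mul_le_expr (x : R) m : 0 <= x -> x <= 1 -> 1 - m%:R * x <= (1 - x) ^+ m.
Proof.
move=> x0 x1; elim: m => [|m IH]; first by rewrite mul0r subr0 expr0.
rewrite exprS (@le_trans _ _ ((1 - x) * (1 - m%:R * x)))//; last first.
  by rewrite ler_wpM2l// subr_ge0.
by rewrite -natr1; have := ler0n R m; nra.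
Qed.

(** For z < w < 1 one has n (w - z) z^n <= w^(n + 1), by induction; the midpoint of z and 1 serves
    as [w]. *)
Lemma cvg_natmul_expr (z : R) : 0 <= z -> z < 1 -> n%:R * z ^+ n @[n --> \oo] --> (0 : R).
Proof.
move=> z0 z1; pose w := (1 + z) / 2; have zw : z < w by rewrite /w; lra.
have w1 : w < 1 by rewrite /w; lra.
have w0 : 0 < w by rewrite (le_lt_trans z0).
pose k := (w - z)^-1.
have k0 : 0 < k by rewrite invr_gt0 subr_gt0.
have cw : k * w ^+ n.+1 @[n --> \oo] --> (0 : R).
  rewrite -[X in _ --> X](mulr0 k); apply: cvgM; first exact: cvg_cst.
  by rewrite (cvg_shiftS (fun n => w ^+ n)); apply: cvg_expr; rewrite ger0_norm// ltW.
apply: (@squeeze_cvgr _ _ _ _ (cst 0) (fun n => k * w ^+ n.+1)) => //; last exact: cvg_cst.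
apply: nearW => n; rewrite /cst mulr_ge0 ?exprn_ge0//=.
rewrite mulrC ler_pdivlMl ?subr_gt0//.
elim: n => [|n IH]; first by rewrite !mulr0 exprn_ge0// ltW.
have IH' : (w - z) * (z ^+ n * n%:R) * z <= w ^+ n.+1 * z by rewrite ler_wpM2r.
have zn : z ^+ n.+1 <= w ^+ n.+1 by rewrite lerXn2r// ?nnegrE ltW.
have : (w - z) * z ^+ n.+1 <= (w - z) * w ^+ n.+1 by rewrite ler_pM2l// subr_gt0.
rewrite -natr1 [z ^+ n.+1]exprS [w ^+ n.+2]exprS.
by move: IH'; set W := w ^+ n.+1; nra.
Qed.

(** For y < 1 / 2 the Bernoulli inequality bounds [sharp] below by 1 - n (2 y)^n. For y >= 1 / 2, 1
    - x <= exp(- x) bounds it above by exp(- n (2 y)^n) <= exp(- n); the factor n in the exponent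
    settles the case y = 1 / 2. *)
Lemma cvg_sharp y : 0 <= y -> y <= 1 ->
  sharp n y @[n --> \oo] --> ((y < 2^-1)%R%:R : R).
Proof.
move=> y0 y1; have [y2|y2] := ltP y 2^-1; rewrite ?mulr1n ?mulr0n.
- have c : 1 - n%:R * (2 * y) ^+ n @[n --> \oo] --> (1 : R).
    rewrite -[X in _ --> X]subr0; apply: cvgB; first exact: cvg_cst.
    by apply: cvg_natmul_expr; lra.
  apply: (@squeeze_cvgr _ _ _ _ (fun n => 1 - n%:R * (2 * y) ^+ n) (cst 1)) => //; last exact: cvg_cst.
  apply: nearW => n; have /andP[_ ->] := sharp_bound n y0 y1; rewrite andbT.
  rewrite (le_trans _ (one_sub_mul_le_expr _ _ _))// ?exprn_ge0// ?exprn_ile1//.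
  by rewrite natrM natrX exprMn mulrA.
- have c : expR (-1) ^+ n @[n --> \oo] --> (0 : R).
    apply: cvg_expr; rewrite ger0_norm ?expR_ge0// -expR0 ltr_expR; lra.
  apply: (@squeeze_cvgr _ _ _ _ (cst 0) (fun n => expR (-1) ^+ n)) => //; last exact: cvg_cst.
  apply: nearW => n; have /andP[-> _] := sharp_bound n y0 y1; rewrite /=.
  have h0 : 0 <= 1 - y ^+ n by rewrite subr_ge0 exprn_ile1.
  have h1 : 1 - y ^+ n <= expR (- y ^+ n) by exact: expR_ge1Dx.
  rewrite (@le_trans _ _ (expR (- y ^+ n) ^+ (n * 2 ^ n)))//.
    by rewrite lerXn2r ?nnegrE ?expR_ge0.
  rewrite -!expRM_natl ler_expR natrM natrX mulrN1 mulrN lerN2 -mulrA -exprMn.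
  by rewrite ler_peMr// exprn_ege1//; lra.
Qed.

End sharp_polynomials.

Section laplace_uniqueness.
Context {R : realType} {d : nat}.
Local Notation M := 'M[R]_d.
Local Notation cone := (@posdefmx R d).

(** The algebra generated by the exponentials of the cone; Th = 0 supplies the constants. Products
    stay inside because exponents add and the cone is closed under addition, so equal Laplace
    transforms give equal integrals of polynomials in exponentials. *)
Inductive expsum : (M -> R) -> Prop :=
| expsum0 : expsum (cst 0)
| expsum_cons c Th h : posdefmx Th \/ Th = 0 -> expsum h ->
    expsum (fun S => c * expfun Th S + h S).

Lemma expsumD h k : expsum h -> expsum k -> expsum (fun S => h S + k S).
Proof.
elim=> [|c Th h' hT _ IH] ek.
  by rewrite (_ : (fun S => _) = k)//; apply/funext => S; rewrite add0r.
rewrite (_ : (fun S => _) = fun S => c * expfun Th S + (h' S + k S)).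
  by apply: expsum_cons => //; exact: IH.
by apply/funext => S; rewrite addrA.
Qed.

Lemma expfunD (A B S : M) : expfun (A + B) S = expfun A S * expfun B S.
Proof. by rewrite /expfun mulmxDl linearD opprD expRD. Qed.

Lemma expsum_term_mul c Th k : posdefmx Th \/ Th = 0 -> expsum k ->
  expsum (fun S => c * expfun Th S * k S).
Proof.
move=> hT; elim=> [|c' Th' k' hT' _ IH].
  by rewrite (_ : (fun S => _) = cst 0); [exact: expsum0|apply/funext => S; rewrite mulr0].
rewrite (_ : (fun S => _) = fun S => (c * c') * expfun (Th + Th') S + c * expfun Th S * k' S).
  apply: expsum_cons => //.
  case: hT => [pT|->]; last by rewrite add0r.
  by case: hT' => [pT'|->]; [left; exact: posdefD|rewrite addr0; left].
by apply/funext => S; rewrite expfunD; ring.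
Qed.

Lemma expsumM h k : expsum h -> expsum k -> expsum (fun S => h S * k S).
Proof.
elim=> [|c Th h' hT _ IH] ek.
  by rewrite (_ : (fun S => _) = cst 0); [exact: expsum0|apply/funext => S; rewrite mul0r].
rewrite (_ : (fun S => _) = fun S => c * expfun Th S * k S + h' S * k S).
  by apply: expsumD; [exact: expsum_term_mul|exact: IH].
by apply/funext => S; rewrite mulrDl.
Qed.

Lemma expsum_exp c (Th : M) : posdefmx Th \/ Th = 0 -> expsum (fun S => c * expfun Th S).
Proof.
move=> hT; have := expsum_cons c hT expsum0.
by congr expsum; apply/funext => S; rewrite addr0.
Qed.

Lemma expsum_cst c : expsum (cst c).
Proof.
have := @expsum_exp c 0 (or_intror erefl).
by congr expsum; apply/funext => S; rewrite /expfun mul0mx mxtrace0 oppr0 expR0 mulr1.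
Qed.

Lemma expsumX h m : expsum h -> expsum (fun S => h S ^+ m).
Proof.
move=> eh; elim: m => [|m IH].
  by have := expsum_cst 1; congr expsum; apply/funext => S; rewrite expr0.
by have := expsumM eh IH; congr expsum; apply/funext => S; rewrite exprS.
Qed.

Lemma expsum_prod (I : eqType) (r : seq I) (h : I -> M -> R) :
  (forall i, i \in r -> expsum (h i)) -> expsum (fun S => \prod_(i <- r) h i S).
Proof.
elim: r => [|i r IH] eh.
  by have := expsum_cst 1; congr expsum; apply/funext => S; rewrite big_nil.
have ei : expsum (h i) by apply: eh; rewrite mem_head.
have er j : j \in r -> expsum (h j) by move=> jr; apply: eh; rewrite inE jr orbT.
have := expsumM ei (IH er).
by congr expsum; apply/funext => S; rewrite big_cons.
Qed.

Lemma expsum_sharp n (Th : M) : posdefmx Th -> expsum (fun S => sharp n (expfun Th S)).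
Proof.
move=> pT; rewrite /sharp; apply: expsumX.
apply: expsumD; first exact: expsum_cst.
have := expsumM (expsum_cst (-1)) (@expsumX (fun S => 1 * expfun Th S) n (expsum_exp 1 (or_introl pT))).
by congr expsum; apply/funext => S; rewrite mulN1r mul1r.
Qed.

Variables (m1 m2 : {measure set M -> \bar R}).
Hypothesis d0 : (0 < d)%N.
Hypotheses (m1I : forall V, m1 V = m1 (V `&` cone))
  (m2I : forall V, m2 V = m2 (V `&` cone)).
Hypotheses (m1T : m1 cone = 1%E) (m2T : m2 cone = 1%E).
Hypothesis m12 : forall Th, posdefmx Th ->
  (\int[m1]_(X in cone) (expfun Th X)%:E = \int[m2]_(X in cone) (expfun Th X)%:E)%E.

Lemma expfun_le1 (Th S : M) : 0 <= \tr (Th *m S) -> expfun Th S <= 1.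
Proof. by move=> h; rewrite /expfun -[leRHS]expR0 ler_expR oppr_le0. Qed.

Lemma expfun0 (S : M) : expfun 0 S = 1.
Proof. by rewrite /expfun mul0mx mxtrace0 oppr0 expR0. Qed.

Lemma integrable_expfun (m : {measure set M -> \bar R}) Th : m cone = 1%E ->
  posdefmx Th \/ Th = 0 -> m.-integrable cone (EFin \o expfun Th).
Proof.
move=> mT hT; apply: measurable_bounded_integrable.
- exact: measurable_posdefmx.
- by rewrite [X in (X < _)%E]mT ltry.
- by apply: cont_cone_measurable; exact: cont_cone_expfun.
exists 1; split=> // x x1 S cS; rewrite /= ger0_norm ?expR_ge0// (le_trans _ (ltW x1))//.
rewrite -expR0 ler_expR oppr_le0; case: hT => [pT|->]; last by rewrite mul0mx mxtrace0.
by apply: psd_trace_mul_ge0 => //; exact: posdef_psd.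
Qed.

Lemma integral_expfun Th : posdefmx Th \/ Th = 0 ->
  (\int[m1]_(X in cone) (expfun Th X)%:E = \int[m2]_(X in cone) (expfun Th X)%:E)%E.
Proof.
case=> [/m12//|->].
have E (m : {measure set M -> \bar R}) : m cone = 1%E ->
    (\int[m]_(X in cone) (expfun 0 X)%:E = 1)%E.
  move=> mT; rewrite (eq_integral (cst 1%E)).
    by rewrite integral_cst ?mul1e//; exact: measurable_posdefmx.
  by move=> S _; rewrite /expfun mul0mx mxtrace0 oppr0 expR0.
by rewrite !E.
Qed.

Lemma integrable_expsum (m : {measure set M -> \bar R}) h : m cone = 1%E ->
  expsum h -> m.-integrable cone (EFin \o h).
Proof.
move=> mT; have mc := @measurable_posdefmx R d; elim=> [|c Th k hT _ IH].
  exact: integrable0.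
rewrite (_ : EFin \o _ = fun S => (c%:E * (expfun Th S)%:E + (k S)%:E)%E)//.
by apply: integrableD => //; apply: integrableZl => //; exact: integrable_expfun.
Qed.

Lemma integral_expsum h : expsum h ->
  (\int[m1]_(X in cone) (h X)%:E = \int[m2]_(X in cone) (h X)%:E)%E.
Proof.
have mc := @measurable_posdefmx R d; elim=> [|c Th k hT ek IH].
  by rewrite !integral0_eq.
under eq_integral do rewrite EFinD EFinM.
under [RHS]eq_integral do rewrite EFinD EFinM.
have D (m : {measure set M -> \bar R}) : m cone = 1%E ->
  (\int[m]_(X in cone) (c%:E * (expfun Th X)%:E + (k X)%:E) =
   c%:E * \int[m]_(X in cone) (expfun Th X)%:E + \int[m]_(X in cone) (k X)%:E)%E.
  move=> mT; rewrite integralD//.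
  - by rewrite integralZl//; exact: integrable_expfun.
  - by apply: integrableZl => //; exact: integrable_expfun.
  - exact: integrable_expsum.
by rewrite !D// integral_expfun// IH.
Qed.

(** Finite intersections are used so that the sets form a pi-system; the empty list gives the whole
    space. *)
Definition halfspaces (s : seq (M * R)) : set M :=
  [set S | forall p, p \in s -> p.2 < \tr (p.1 *m S)].

Definition halfspace_system : set (set M) :=
  [set A | exists2 s : seq (M * R), (forall p, p \in s -> posdefmx p.1) & A = halfspaces s].

Lemma halfspaces_cons p s : halfspaces (p :: s) =
  [set S | p.2 < \tr (p.1 *m S)] `&` halfspaces s.
Proof.
apply/seteqP; split=> S /= => [h|[h1 h2] q].
  split; first by apply: h; rewrite mem_head.
  by move=> q qs; apply: h; rewrite inE qs orbT.
by rewrite inE => /predU1P[->//|]; exact: h2.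
Qed.

Lemma measurable_halfspaces s : measurable (halfspaces s).
Proof.
elim: s => [|p s IH].
  rewrite (_ : halfspaces [::] = setT)//.
  by apply/seteqP; split=> S.
rewrite halfspaces_cons; apply: measurableI => //.
apply: open_measurable_mx; apply: (@open_comp _ _ (fun S => \tr (p.1 *m S)) [set x | p.2 < x]).
  by move=> S _; exact: trace_mul_continuous.
exact: open_gt.
Qed.

Lemma halfspace_system_setI : setI_closed halfspace_system.
Proof.
move=> A B [s hs ->] [t ht ->]; exists (s ++ t).
  by move=> p; rewrite mem_cat => /orP[/hs|/ht].
apply/seteqP; split=> S /=.
  by move=> [h1 h2] p; rewrite mem_cat => /orP[/h1|/h2].
by move=> h; split=> p ps; apply: h; rewrite mem_cat ps ?orbT.
Qed.

(** The factor ln 2 / c moves the threshold: c < tr (Th S) exactly when the rescaled exponential is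
    below 1 / 2, the jump of the limit of [sharp]. For c <= 0 the half-space contains the whole
    cone, since traces there are positive when d > 0, and the constant 1 is exact. *)
Definition halfspace_approx (n : nat) (p : M * R) (S : M) : R :=
  if 0 < p.2 then sharp n (expfun ((ln 2 / p.2) *: p.1) S) else 1.

Lemma cvg_halfspace_approx p S : posdefmx p.1 -> cone S ->
  halfspace_approx n p S @[n --> \oo] --> ((p.2 < \tr (p.1 *m S))%R%:R : R).
Proof.
move=> pT cS; have t0 := posdef_trace_mul_gt0 d0 pT cS.
rewrite /halfspace_approx; case: ltP => [c0|c0]; last first.
  by rewrite (le_lt_trans c0 t0) mulr1n; exact: cvg_cst.
have l2 : 0 < ln 2 :> R by rewrite ln_gt0// ltr1n.
have -> : (p.2 < \tr (p.1 *m S)) = (expfun ((ln 2 / p.2) *: p.1) S < 2^-1).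
  rewrite /expfun trace_scale_mul -[2^-1]lnK ?posrE ?invr_gt0// ltr_expR lnV ?posrE//.
  by rewrite ltrN2 mulrAC -mulrA ltr_pMr// ltr_pdivlMr// mul1r.
apply: cvg_sharp; first exact: expR_ge0.
apply: expfun_le1; rewrite trace_scale_mul mulr_ge0 ?(ltW t0)//.
by rewrite divr_ge0 ?ltW.
Qed.

Lemma halfspace_approx_bound n p S : posdefmx p.1 -> cone S ->
  0 <= halfspace_approx n p S <= 1.
Proof.
move=> pT cS; rewrite /halfspace_approx; case: ltP => [c0|c0]; last by rewrite ler01 lexx.
have t0 := posdef_trace_mul_gt0 d0 pT cS.
have l2 : 0 < ln 2 :> R by rewrite ln_gt0// ltr1n.
apply: sharp_bound; first exact: expR_ge0.
apply: expfun_le1; rewrite trace_scale_mul mulr_ge0 ?(ltW t0)//.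
by rewrite divr_ge0 ?ltW.
Qed.

Lemma expsum_halfspace_approx n p : posdefmx p.1 -> expsum (halfspace_approx n p).
Proof.
move=> pT; rewrite /halfspace_approx; case: ltP => [c0|c0]; last exact: expsum_cst.
apply: expsum_sharp; apply: posdefZ => //.
by rewrite divr_gt0// ln_gt0// ltr1n.
Qed.

Lemma cvg_measure_halfspaces (m : {measure set M -> \bar R}) s :
  (forall V, m V = m (V `&` cone)) -> m cone = 1%E ->
  (forall p, p \in s -> posdefmx p.1) ->
  (\int[m]_(X in cone) (\prod_(p <- s) halfspace_approx n p X)%:E @[n --> \oo]
    --> m (halfspaces s))%E.
Proof.
move=> mI mT ps; have mc := @measurable_posdefmx R d.
have -> : m (halfspaces s) = (\int[m]_(X in cone) (\1_(halfspaces s) X)%:E)%E.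
  by rewrite integral_indic//; exact: measurable_halfspaces.
have i1 := integrable_expfun mT (or_intror (erefl (0 : M))).
apply: (@dominated_cvg _ _ _ m cone mc _ _ (EFin \o expfun 0)) => //.
- move=> n; apply/measurable_EFinP.
  have := integrable_expsum mT (expsum_prod (r := s) (fun p h => expsum_halfspace_approx n (ps p h))).
  by move=> /(measurable_int _)/measurable_EFinP.
- move=> S cS; apply: cvg_EFin; first exact: nearW.
  have -> : \1_(halfspaces s) S = \prod_(p <- s | p \in s) (p.2 < \tr (p.1 *m S))%R%:R :> R.
    rewrite -big_seq; elim: (s) => [|p r IH].
      rewrite big_nil indicE mem_set//; by move=> q.
    rewrite big_cons halfspaces_cons indicI /= IH; congr *%R.
    rewrite indicE; congr ((nat_of_bool _)%:R).
    by apply/idP/idP => [/set_mem|] //= h; exact: mem_set.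
  rewrite /comp /=; under eq_fun do rewrite big_seq.
  by apply: cvg_prodr => p /ps pp; exact: cvg_halfspace_approx.
- move=> n S cS; rewrite /= expfun0 lee_fin big_seq ger0_norm.
    by apply: prodr_ile1 => p /ps pp; exact: halfspace_approx_bound.
  by apply: prodr_ge0 => p /ps pp; case/andP: (halfspace_approx_bound n pp cS).
Qed.

Lemma measure_halfspaces_eq s : (forall p, p \in s -> posdefmx p.1) ->
  m1 (halfspaces s) = m2 (halfspaces s).
Proof.
move=> ps; have c1 := cvg_measure_halfspaces m1I m1T ps.
have c2 := cvg_measure_halfspaces m2I m2T ps.
have E : (fun n => \int[m1]_(X in cone) (\prod_(p <- s) halfspace_approx n p X)%:E)%E =
   (fun n => \int[m2]_(X in cone) (\prod_(p <- s) halfspace_approx n p X)%:E)%E.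
  apply/funext => n; apply: integral_expsum; apply: expsum_prod => p pi.
  exact/expsum_halfspace_approx/ps.
by move: c1; rewrite E => /cvg_lim <-//; exact/cvg_lim.
Qed.

Local Notation GT := (g_sigma_algebraType halfspace_system).

Lemma measurable_trace_halfspace (Th : M) : posdefmx Th ->
  measurable_fun setT (fun S : GT => \tr (Th *m S)).
Proof.
move=> pT; apply: (measurability _ (RGenOInfty.measurableE R)).
move=> _ [_ [c ->] <-]; rewrite setTI; apply: sub_sigma_algebra.
exists [:: (Th, c)]; first by move=> p; rewrite inE => /eqP ->.
apply/seteqP; split=> S /=; rewrite in_itv/= andbT.
  by move=> h p; rewrite inE => /eqP ->.
by move=> /(_ (Th, c)); apply; rewrite mem_head.
Qed.

(* The entries are differences of traces against positive definite matrices, so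
   that this map is measurable for the sigma-algebra of half-spaces. *)
Definition symmetrize (S : M) : M := \matrix_(i, j)
  (\tr ((2 *: 1%:M + 2^-1 *: (delta_mx i j + delta_mx j i)) *m S) -
   \tr ((2 *: 1%:M) *m S)).

Lemma symmetrize_id S : S^T = S -> symmetrize S = S.
Proof.
move=> sS; apply/matrixP => i j; rewrite mxE mulmxDl linearD/= addrC addKr.
rewrite trace_scale_mul mulmxDl linearD/=.
have E k l : \tr (delta_mx k l *m S) = S l k.
  rewrite /mxtrace (bigD1 k)//= mxE (bigD1 l)//= mxE !eqxx mul1r.
  rewrite !big1 ?addr0// => [m mk|m ml].
    by rewrite mxE big1// => r _; rewrite mxE (negbTE mk) mul0r.
  by rewrite mxE (negbTE ml) andbF mul0r.
by rewrite !E -{1}sS mxE; field.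
Qed.

(** The form at u is 2 |u|^2 + u_i u_j, and |u_i u_j| <= |u|^2. *)
Lemma posdef_symmetrize_weight (i j : 'I_d) :
  posdefmx (2 *: 1%:M + 2^-1 *: (delta_mx i j + delta_mx j i) : M).
Proof.
split=> [|u u0].
  by apply/matrixP => k l; rewrite !mxE [l == k]eq_sym addrC [(l == i) && _]andbC [(l == j) && _]andbC;
    ring.
rewrite -/(qform _ _) qformD !qformZ qformD.
have -> : qform u 1%:M = normsq u by rewrite /qform mulmx1.
have E k l : qform u (delta_mx k l) = u 0 k * u 0 l.
  rewrite /qform mxE (bigD1 l)//= big1 ?addr0.
    rewrite !mxE (bigD1 k)//= big1 ?addr0 ?mxE ?eqxx ?mulr1// => r rk.
    by rewrite mxE (negbTE rk) mulr0.
  move=> r rl; rewrite !mxE big1 ?mul0r// => q _.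
  by rewrite mxE (negbTE rl) andbF mulr0.
rewrite !E.
have := normsq_gt0 u0; have := sqr_coord_le_normsq u i; have := sqr_coord_le_normsq u j.
by nra.
Qed.

(** Two measures that agree on the pi-system of half-spaces agree on the sigma-algebra it generates.
    That sigma-algebra sees only the symmetric part of a matrix; pulling [V] back by [symmetrize]
    lands in it and changes nothing on the cone, which carries both measures. *)
Lemma laplace_unique V : measurable V -> m1 V = m2 V.
Proof.
move=> mV; have mG : halfspace_system `<=` measurable.
  by move=> A [s _ ->]; exact: measurable_halfspaces.
have GT1 : halfspace_system setT.
  by exists [::] => //; apply/seteqP; split=> S //=.
have msym : measurable_fun setT (symmetrize : GT -> M).
  apply: measurable_fun_mx => i j; under eq_fun do rewrite mxE.
  apply: measurable_funB; apply: measurable_trace_halfspace.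
    exact: posdef_symmetrize_weight.
  by apply: posdefZ => //; exact: posdef1.
have GV : <<s halfspace_system >> (symmetrize @^-1` V).
  by rewrite -[X in <<s _ >> X]setTI; exact: msym.
have E (m : {measure set M -> \bar R}) : (forall V, m V = m (V `&` cone)) ->
    m V = m (symmetrize @^-1` V).
  move=> mI; rewrite mI [RHS]mI; congr (m _).
  by apply/seteqP; split=> S /= [h cS]; split=> //; rewrite ?symmetrize_id ?cS.1//;
    move: h; rewrite symmetrize_id ?cS.1.
rewrite (E m1)// (E m2)//.
apply: (@g_sigma_algebra_measure_unique _ _ _ halfspace_system mG (fun=> setT)) => //.
- by apply/seteqP; split=> // S _; exists 0%N.
- exact: halfspace_system_setI.
- by move=> A [s ps ->]; exact: measure_halfspaces_eq.
- by move=> _; rewrite m1I setTI [X in (X < _)%E]m1T ltry.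
Qed.

End laplace_uniqueness.

(** * Wishart expectations *)

Lemma integral_gt0_neq0 d (T : measurableType d) (R : realType)
    (m : {measure set T -> \bar R}) (D : set T) (g : T -> R) :
  measurable D -> measurable_fun D g -> (forall x, D x -> 0 < g x) ->
  m D <> 0%E -> (\int[m]_(x in D) (g x)%:E)%E <> 0%E.
Proof.
move=> mD mg g0 mD0 ig; apply: mD0.
have mE : measurable_fun D (EFin \o g) by exact/measurable_EFinP.
have /(ae_eq_integral_abs m mD mE)[N [mN N0 DN]] :
    (\int[m]_(x in D) `|(EFin \o g) x| = 0)%E.
  rewrite -[RHS]ig; apply: eq_integral => x /set_mem /g0 gx.
  by rewrite /= ger0_norm// ltW.
apply: (subset_measure0 mD mN _ N0) => x Dx; apply: DN => /= /(_ Dx) /eqP.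
by rewrite eqe gt_eqF// g0.
Qed.

Section wishart_weight.
Context {R : realType} {d : nat}.
Local Notation M := 'M[R]_d.
Local Notation cone := (@posdefmx R d).
Variables (alpha : R) (Sigma : M).
Hypothesis pS : posdefmx Sigma.

Let B : M := 2^-1 *: invmx Sigma.
Let b : R := (alpha - d%:R - 1) / 2.
Let Z : R := (\det (2 *: Sigma)) `^ (alpha / 2) * multigamma (d := d) (alpha / 2).

Let pB : posdefmx B.
Proof. by apply: posdefZ; rewrite ?invr_gt0//; exact: posdef_inv. Qed.

Lemma wishart_pdf_weight X : cone X -> wishart_pdf alpha Sigma X = Z^-1 * weight b B X.
Proof.
move=> cX; rewrite /wishart_pdf mulrC; congr *%R.
rewrite /powR gt_eqF ?posdef_det_gt0// -expRD; congr expR.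
rewrite /B /b trace_scale_mul; ring.
Qed.

Lemma multigamma_weight :
  multigamma (d := d) (alpha / 2) = \int[sym_lebesgue]_(X in cone) weight b (1%:M : M) X.
Proof.
apply: eq_Rintegral => X /set_mem cX.
rewrite /powR gt_eqF ?posdef_det_gt0// -expRD; congr expR.
rewrite /b mul1mx; ring.
Qed.

Lemma wishart_density A : measurable A -> A `<=` cone ->
  wishart alpha Sigma A = (\int[sym_lebesgue]_(X in A) (wishart_pdf alpha Sigma X)%:E)%E.
Proof. by move=> _ /setIidPl Ac; rewrite /wishart Ac. Qed.

Lemma wishart_setI_cone V :
  wishart alpha Sigma V = wishart alpha Sigma (V `&` cone).
Proof. by rewrite /wishart -setIA setIid. Qed.

Lemma wishart_degenerate V : multigamma (d := d) (alpha / 2) = 0 ->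
  wishart alpha Sigma V = 0%E.
Proof.
move=> g0; rewrite /wishart integral0_eq// => X _.
by rewrite /wishart_pdf g0 mulr0 invr0 mulr0.
Qed.

Hypothesis g0 : multigamma (d := d) (alpha / 2) <> 0.

Let Z0 : Z != 0.
Proof.
apply: mulf_neq0; last exact/eqP.
rewrite gt_eqF//; apply: powR_gt0; apply: posdef_det_gt0; exact: posdefZ.
Qed.

Let mW (g : M -> R) : measurable_fun cone g ->
  measurable_fun cone (fun S => weight b B S * g S).
Proof. by move=> mg; apply: measurable_funM => //; exact: measurable_weight. Qed.

Lemma wishart_integrable (g : M -> R) : measurable_fun cone g ->
  (wishart alpha Sigma).-integrable cone (EFin \o g) <->
  sym_lebesgue.-integrable cone (EFin \o (fun S => weight b B S * g S)).
Proof.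
move=> mg; have mc := @measurable_posdefmx R d.
rewrite (integrable_density mc (measurable_wishart_pdf alpha Sigma)
  (wishart_pdf_ge0 alpha Sigma) wishart_density mg).
split=> i.
  apply: (eq_integrable mc (fun S => (Z%:E * (wishart_pdf alpha Sigma S * g S)%:E)%E)).
    move=> S /set_mem cS; rewrite /= wishart_pdf_weight// -EFinM; congr EFin.
    by rewrite -[Z^-1 * _ * _]mulrA mulVKf.
  exact: integrableZl.
apply: (eq_integrable mc (fun S => ((Z^-1)%:E * (weight b B S * g S)%:E)%E)).
  by move=> S /set_mem cS; rewrite /= wishart_pdf_weight// -EFinM mulrA.
exact: integrableZl.
Qed.

Lemma wishart_integral (g : M -> R) : measurable_fun cone g ->
  sym_lebesgue.-integrable cone (EFin \o (fun S => weight b B S * g S)) ->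
  (\int[wishart alpha Sigma]_(X in cone) (g X)%:E =
   (Z^-1)%:E * \int[sym_lebesgue]_(X in cone) (weight b B X * g X)%:E)%E.
Proof.
move=> mg i; have mc := @measurable_posdefmx R d.
rewrite (integral_density mc (measurable_wishart_pdf alpha Sigma)
  (wishart_pdf_ge0 alpha Sigma) wishart_density mg).
rewrite -integralZl//; apply: eq_integral => S /set_mem cS.
by rewrite wishart_pdf_weight// -mulrA EFinM.
Qed.

Lemma finite_mean_integrable (g : M -> R) : cont_cone g ->
  finite_mean (wishart alpha Sigma) g ->
  (wishart alpha Sigma).-integrable cone (EFin \o g).
Proof.
move=> cg fg; apply/integrableP; split=> //.
by apply/measurable_EFinP; exact: cont_cone_measurable.
Qed.

Lemma cont_cone_grad (f : M -> R) i j : C2_posdef f -> cont_cone (fun S => grad f S i j).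
Proof.
move=> hf; have [cg _] := C2_posdef_nabla i j hf.
by apply: eq_cont_cone cg => S _; rewrite mxE.
Qed.

Lemma cont_cone_tr_second_order (f : M -> R) : C2_posdef f -> cont_cone (tr_second_order Sigma f).
Proof.
move=> hf; do 4 (apply: cont_cone_sum => ?).
apply: cont_coneM.
  by apply: cont_coneM; [exact: cont_cone_coord|exact: cont_cone_cst].
apply: cont_coneM; first exact: cont_cone_cst.
rewrite /partial.
match goal with |- cont_cone (fun S => 'D_(free_dir ?j ?k) (nabla ?l ?i f) S) =>
  exact: (((C2_posdef_nabla l i hf).2 j k).1) end.
Qed.

Lemma cont_cone_stein_op f : C2_posdef f -> cont_cone (stein_op alpha Sigma f).
Proof.
move=> hf; apply: cont_coneD; apply: cont_coneM; try exact: cont_cone_cst.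
  apply: cont_cone_trace => i j; last exact: cont_cone_grad.
  apply: (@eq_cont_cone _ _ (fun S => alpha * Sigma i j + (-1) * S i j)).
    by move=> S _; rewrite !mxE mulN1r.
  apply: cont_coneD; first exact: cont_cone_cst.
  by apply: cont_coneM; [exact: cont_cone_cst|exact: cont_cone_coord].
exact: cont_cone_tr_second_order.
Qed.

Lemma wishart_stein f : C2_stein alpha Sigma f ->
  (wishart alpha Sigma).-integrable cone (EFin \o stein_op alpha Sigma f) /\
  (\int[wishart alpha Sigma]_(X in cone) (stein_op alpha Sigma f X)%:E = 0)%E.
Proof.
move=> [hf m1 m2 m3 _].
have c1 : cont_cone (fun S => \tr (Sigma *m grad f S)).
  apply: cont_cone_trace => i j; first exact: cont_cone_cst.
  exact: cont_cone_grad.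
have c2 : cont_cone (fun S => \tr (S *m grad f S)).
  apply: cont_cone_trace => i j; first exact: cont_cone_coord.
  exact: cont_cone_grad.
have c3 := cont_cone_tr_second_order hf.
have w g : cont_cone g -> finite_mean (wishart alpha Sigma) g ->
    sym_lebesgue.-integrable cone (EFin \o (fun S => weight b B S * g S)).
  move=> cg fg; apply/wishart_integrable; first exact: cont_cone_measurable.
  exact: finite_mean_integrable.
have [i0 e0] := @stein_identity R d Sigma pS alpha f hf (w _ c1 m1) (w _ c2 m2) (w _ c3 m3).
have mA : measurable_fun cone (stein_op alpha Sigma f).
  by apply: cont_cone_measurable; exact: cont_cone_stein_op.
split; first exact/wishart_integrable.
by rewrite wishart_integral// e0 mule0.
Qed.

Lemma wishart_mass : wishart alpha Sigma cone = 1%E.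
Proof.
have mc := @measurable_posdefmx R d.
(* A nonzero [multigamma] is finite, because [fine] sends +oo to 0. *)
have Jfin : (gamma_integral b (1%:M : M) < +oo)%E.
  move: g0; rewrite multigamma_weight /Rintegral -/(gamma_integral b (1%:M : M)) => gg.
  rewrite ltNge leye_eq; apply/negP => /eqP h.
  by apply: gg; rewrite h.
have iw := gamma_integral_lt_pinfty Jfin pB.
have -> : wishart alpha Sigma cone = (\int[wishart alpha Sigma]_(X in cone) (1 : R)%:E)%E.
  by rewrite integral_cst// mul1e.
have i1 : sym_lebesgue.-integrable cone (EFin \o (fun S => weight b B S * 1)).
  by apply: eq_integrable iw => // S _; rewrite /= mulr1.
rewrite (wishart_integral (measurable_cst (1 : R)) i1).
under eq_integral do rewrite mulr1.
rewrite -[X in (_ * X)%E]fineK; last exact: integrable_fin_num.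
rewrite -EFinM; congr EFin; rewrite -/(\int[_]_(_ in _) _).
have := gamma_normalization Jfin pB; rewrite -multigamma_weight => gE.
apply: (mulfI Z0); rewrite mulVKf// mulr1 /Z -gE mulrA.
rewrite -[LHS]mul1r; congr *%R.
have dS := posdef_det_gt0 pS.
rewrite /powR gt_eqF; last by rewrite posdef_det_gt0//; exact: posdefZ.
rewrite -expRD -[LHS]expR0; congr expR.
(* |B| is the inverse of |2 Sigma|, so the power of |B| in [gamma_normalization] cancels the
   determinant factor of [Z]. *)
rewrite /B !detZ det_inv exprVn -invfM lnV ?posrE ?mulr_gt0 ?exprn_gt0//.
by rewrite /b; field.
Qed.

End wishart_weight.

(** * Differential equation for the Laplace transform *)

(** Resolvent identity: the increment of the inverse over a step h is - h L(s + h)^-1 H L(s)^-1;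
    dividing by h leaves only the continuity of the inverse. *)
Lemma is_derive_invmx_line (R : realType) d (S0 H : 'M[R]_d) a s i j :
  S0^T = S0 -> H^T = H -> posdefmx (S0 + (s - a) *: H) ->
  is_derive s (1 : R) (fun t => invmx (S0 + (t - a) *: H) i j)
    (- (invmx (S0 + (s - a) *: H) *m H *m invmx (S0 + (s - a) *: H)) i j).
Proof.
move=> sS sH; pose L t := S0 + (t - a) *: H; rewrite -/(L s) => ps.
have us : \forall h \near (0 : R)^', L (h + s) \in unitmx.
  have c0 : h + s @[h --> (0 : R)^'] --> s.
    rewrite -[X in _ --> X]add0r; apply: cvgD; last exact: cvg_cst.
    exact: nbhs_dnbhs.
  exact: (c0 _ (filterS (fun t => @posdef_unit _ _ (L t)) (near_line_posdef sS sH ps))).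
have cinv k l : invmx (L (h + s)) k l @[h --> (0 : R)^'] --> invmx (L s) k l.
  apply: cvg_invmx => //; first exact: posdef_unit.
  move=> k' l'; rewrite /L; under eq_fun do rewrite !mxE; rewrite !mxE.
  apply: cvgD; first exact: cvg_cst.
  apply: cvgM; last exact: cvg_cst.
  apply: cvgB; last exact: cvg_cst.
  rewrite -[X in _ --> X]add0r; apply: cvgD; last exact: cvg_cst.
  exact: nbhs_dnbhs.
set l := - (invmx (L s) *m H *m invmx (L s)) i j.
have cl : h^-1 *: (((fun t => invmx (L t) i j) \o shift s) (h *: 1) - invmx (L s) i j)
    @[h --> (0 : R)^'] --> l.
  have cr : - (\sum_k (\sum_l invmx (L (h + s)) i l * H l k) * invmx (L s) k j)
      @[h --> (0 : R)^'] --> l.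
    rewrite /l mxE; apply: cvgN; apply: cvg_sumr => k _.
    apply: cvgM; last exact: cvg_cst.
    rewrite mxE; apply: cvg_sumr => m _.
    by apply: cvgM; [exact: cinv|exact: cvg_cst].
  apply: cvg_trans cr; apply: near_eq_cvg.
  have h0 : \forall h \near (0 : R)^', h != 0 by exact: nbhs_dnbhs_neq.
  apply: filterS2 us h0 => h uh h0.
  have E : invmx (L (h + s)) - invmx (L s) = - (h *: (invmx (L (h + s)) *m H *m invmx (L s))).
    have HE : h *: H = L (h + s) - L s.
      by rewrite /L opprD addrACA subrr add0r -scalerBl; congr (_ *: _); ring.
    rewrite scalemxAl scalemxAr HE mulmxBr mulVmx// mulmxBl mul1mx -mulmxA mulmxV ?posdef_unit//.
    by rewrite mulmx1 opprB.
  rewrite /= [h *: 1]mulr1.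
  have -> : invmx (L (h + s)) i j - invmx (L s) i j =
      (invmx (L (h + s)) - invmx (L s)) i j by rewrite !mxE.
  rewrite E !mxE /GRing.scale/= mulrN mulKf//; congr (- _).
  by apply: eq_bigr => k _; rewrite mxE.
by apply: DeriveDef; [exact: (cvgP _ cl)|exact: (cvg_lim _ cl)].
Qed.

Section laplace_ode.
Context {R : realType} {d : nat}.
Local Notation M := 'M[R]_d.
Local Notation cone := (@posdefmx R d).
Variables (m : {measure set M -> \bar R}) (alpha : R) (Sigma Psi : M).
Hypotheses (mT : m cone = 1%E) (pS : posdefmx Sigma) (pP : posdefmx Psi).
Hypothesis stein0 : forall Th, posdefmx Th ->
  (\int[m]_(X in cone) (stein_op alpha Sigma (expfun Th) X)%:E = 0)%E.

Let A : M := Psi + 2 *: Sigma.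

(* This is [(s Psi + 2 (s - 1) Sigma)^-1]; along this path the Stein equation
   becomes a linear differential equation for the Laplace transform. *)
Definition laplace_path (s : R) : M := invmx (Psi + (s - 1) *: A).

Let pA : posdefmx A.
Proof. by apply: posdefD => //; exact: posdefZ. Qed.

Lemma posdef_laplace_path s : 1 < s -> posdefmx (laplace_path s).
Proof.
move=> s1; apply: posdef_inv; apply: posdefD => //; apply: posdefZ => //.
by rewrite subr_gt0.
Qed.

Let laplace_pathK s : 1 < s ->
  laplace_path s *m (Psi + (s - 1) *: A) = 1%:M.
Proof.
move=> s1; apply: mulVmx; rewrite -unitmx_inv; apply: posdef_unit.
exact: posdef_laplace_path.
Qed.

(** The inverse U of the path satisfies U' = A and s A = U + 2 Sigma; conjugation by U^-1 gives the
    matrix Th + 2 Th Sigma Th that [stein_op_expfun] pairs with S. *)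
Lemma laplace_path_mul s : 1 < s ->
  s *: (laplace_path s *m A *m laplace_path s) =
  laplace_path s + 2 *: (laplace_path s *m Sigma *m laplace_path s).
Proof.
move=> s1; have TK := laplace_pathK s1; set T := laplace_path s in TK *.
have -> : s *: (T *m A *m T) = T *m (s *: A) *m T by rewrite -scalemxAr -scalemxAl.
have -> : s *: A = (Psi + (s - 1) *: A) + 2 *: Sigma.
  rewrite addrAC -/A -[X in X + _]scale1r -scalerDl; congr (_ *: _); ring.
by rewrite mulmxDr TK mulmxDl mul1mx -scalemxAr -scalemxAl.
Qed.

(** Conjugating U - 2 (s - 1) Sigma = s Psi by U^-1 leaves a semidefinite matrix. The term quadratic
    in the path is thereby controlled by the linear one, at the cost of staying away from s = 1. *)
Lemma laplace_path_le s X : 1 < s -> cone X ->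
  2 * (s - 1) * \tr (laplace_path s *m Sigma *m laplace_path s *m X) <=
  \tr (laplace_path s *m X).
Proof.
move=> s1 cX; have TK := laplace_pathK s1.
have pT := posdef_laplace_path s1; set T := laplace_path s in TK pT *.
have p1 : psdmx (T *m Psi *m T^T) by apply: psd_congr; exact: posdef_psd.
have s0 : 0 <= s by rewrite ltW// (lt_trans ltr01).
have := psd_trace_mul_ge0 (psdZ s0 p1) cX; rewrite pT.1.
have -> : s *: (T *m Psi *m T) = T - (2 * (s - 1)) *: (T *m Sigma *m T).
  apply/eqP; rewrite eq_sym subr_eq; apply/eqP.
  rewrite -[in LHS](mul1mx T) -TK.
  have -> : s *: (T *m Psi *m T) = T *m (s *: Psi) *m T by rewrite -scalemxAr -scalemxAl.
  have -> : (2 * (s - 1)) *: (T *m Sigma *m T) = T *m ((2 * (s - 1)) *: Sigma) *m T.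
    by rewrite -scalemxAr -scalemxAl.
  rewrite -mulmxDl -mulmxDr; congr (_ *m _ *m _).
  apply/matrixP => i j; rewrite !mxE; ring.
by rewrite mulmxBl linearB/= trace_scale_mul subr_ge0.
Qed.

Let trace_laplace_path s X : 1 < s ->
  s * \tr (laplace_path s *m A *m laplace_path s *m X) =
  \tr (laplace_path s *m X) + 2 * \tr (laplace_path s *m Sigma *m laplace_path s *m X).
Proof.
move=> s1; rewrite -(trace_scale_mul s (laplace_path s *m A *m laplace_path s)).
rewrite laplace_path_mul//; by rewrite mulmxDl linearD/= trace_scale_mul.
Qed.

(** With y = tr (Th_s X), the first trace is at most (1 + 1 / (u - 1)) y, and y exp(- y) <= 1. A
    constant therefore dominates the derivative, uniformly in s >= u. *)
Lemma laplace_path_bound u s X : 1 < u -> u <= s -> cone X ->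
  `|\tr (laplace_path s *m A *m laplace_path s *m X) * expfun (laplace_path s) X|
    <= 1 + (u - 1)^-1.
Proof.
move=> u1 us cX; have s1 := lt_le_trans u1 us.
have pT := posdef_laplace_path s1.
have hz := laplace_path_le s1 cX; have hq := trace_laplace_path X s1.
have y0 := psd_trace_mul_ge0 (posdef_psd pT) cX.
have z0 : 0 <= \tr (laplace_path s *m Sigma *m laplace_path s *m X).
  apply: psd_trace_mul_ge0 => //; rewrite -[X in _ *m X]pT.1.
  exact/psd_congr/posdef_psd.
move: hz hq y0 z0 (mul_expN_le1 (\tr (laplace_path s *m X))).
rewrite /expfun; set y := \tr (laplace_path s *m X);
set q := \tr (laplace_path s *m A *m laplace_path s *m X).
set z := \tr (laplace_path s *m Sigma *m laplace_path s *m X).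
move=> hz hq y0 z0 ye; set e := expR (- y) in ye *.
have e0 : 0 <= e by exact: expR_ge0.
have q0 : 0 <= q by rewrite -(pmulr_rge0 _ (lt_trans ltr01 s1)) hq addr_ge0// mulr_ge0.
rewrite ger0_norm ?mulr_ge0//; set k := (u - 1)^-1.
have k0 : 0 <= k by rewrite invr_ge0 subr_ge0 ltW.
have ku : k * (u - 1) = 1 by rewrite mulVf// subr_eq0 gt_eqF.
have zy : 2 * z <= k * y.
  have -> : 2 * z = k * ((u - 1) * (2 * z)) by rewrite mulrA ku mul1r.
  rewrite ler_wpM2l//; apply: le_trans hz.
  by rewrite mulrA [_ * 2]mulrC ler_wpM2r// ler_wpM2l// lerD2r.
have qy : q <= (1 + k) * y by nra.
by rewrite (le_trans (ler_wpM2r e0 qy))// -mulrA ler_piMr// addr_ge0.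
Qed.

Definition laplace (Th : M) : R := \int[m]_(X in cone) expfun Th X.

Lemma weight0 (Th X : M) : weight 0 Th X = expfun Th X.
Proof. by rewrite /weight mul0r sub0r. Qed.

Lemma is_derive_laplace_path (s : R) : 1 < s ->
  is_derive s (1 : R) (laplace \o laplace_path)
    (alpha * \tr (Sigma *m laplace_path s) / s * laplace (laplace_path s)).
Proof.
(* The left end must stay away from 1, where the dominating constant blows up; the right end is
   arbitrary. *)
move=> s1; pose u := (1 + s) / 2; pose v := s + 1.
have u1 : 1 < u by rewrite /u; lra.
have us : u < s by rewrite /u; lra.
have mc := @measurable_posdefmx R d.
have t1 t : t \in `]u, v[ -> u < t by rewrite in_itv/= => /andP[].
pose dT t : M := - (laplace_path t *m A *m laplace_path t).
have dTE t X : - \tr (dT t *m X) = \tr (laplace_path t *m A *m laplace_path t *m X).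
  by rewrite /dT mulNmx linearN/= opprK.
have icst c : m.-integrable cone (EFin \o (cst c : M -> R)).
  apply: (eq_integrable mc (fun X => (c%:E * (expfun 0 X)%:E)%E)).
    by move=> X _; rewrite /= expfun0 mule1.
  by apply: integrableZl => //; apply: integrable_expfun => //; right.
set T := laplace_path s; have pT : posdefmx T := posdef_laplace_path s1.
pose F X := \tr (T *m A *m T *m X) * expfun T X.
have iF : m.-integrable cone (EFin \o F).
  apply: (@le_integrable _ _ _ _ _ mc _ (EFin \o cst (1 + (u - 1)^-1))) => //.
    apply/measurable_EFinP; apply: cont_cone_measurable; apply: cont_coneM.
      exact: cont_coneT (@trace_mul_continuous _ _ _).
    exact: cont_cone_expfun.
  move=> X cX; rewrite /= lee_fin (le_trans (laplace_path_bound u1 (ltW us) cX))//.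
  exact: ler_norm.
have := @is_derive_weight_integral R d m 0 laplace_path dT u v _ _
  (cst (1 + (u - 1)^-1)) _ _ _ s.
have -> : (fun t => \int[m]_(X in cone) weight 0 (laplace_path t) X) = laplace \o laplace_path.
  by apply/funext => t; apply: eq_Rintegral => X _; rewrite weight0.
have -> : \int[m]_(X in cone) (- \tr (dT s *m X) * weight 0 (laplace_path s) X) =
    alpha * \tr (Sigma *m T) / s * laplace T.
  have ie : m.-integrable cone (EFin \o expfun T) by apply: integrable_expfun => //; left.
  have -> : \int[m]_(X in cone) (- \tr (dT s *m X) * weight 0 (laplace_path s) X) =
      \int[m]_(X in cone) F X.
    by apply: eq_Rintegral => X _; rewrite dTE weight0.
  (* The Stein identity for [expfun T], with its two trace terms merged into 2 s F by
     [trace_laplace_path]; [F] is the integrand of the derivative. *)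
  have E : \int[m]_(X in cone) (2 * s * F X - 2 * alpha * \tr (Sigma *m T) * expfun T X) = 0.
    rewrite -[RHS]/(fine 0%E) -(stein0 pT); congr fine; apply: eq_integral => X _.
    congr EFin; rewrite stein_op_expfun ?pT.1// /F.
    rewrite -[2 * s * _]mulrA [s * _]mulrA (trace_laplace_path X s1) -/T; ring.
  rewrite RintegralB// in E; last 2 first.
    by apply: (eq_integrable mc (fun X => ((2 * s)%:E * (F X)%:E)%E)) => //; exact: integrableZl.
    by apply: (eq_integrable mc (fun X => ((2 * alpha * \tr (Sigma *m T))%:E * (expfun T X)%:E)%E)) => //; exact: integrableZl.
  rewrite !RintegralZl// in E.
  move/eqP: E; rewrite subr_eq0 => /eqP E.
  have s0 : s != 0 by rewrite gt_eqF// (lt_trans ltr01).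
  apply: (mulfI s0); rewrite /laplace; apply: (@mulfI _ 2) => //.
  by rewrite mulrA E; field.
apply.
- move=> t /t1 ut i j; rewrite [X in is_derive _ _ _ X]mxE.
  apply: is_derive_invmx_line; [exact: pP.1|exact: pA.1|].
  apply: posdefD => //; apply: posdefZ => //; by rewrite subr_gt0 (lt_trans u1).
- move=> t /t1 ut; apply: (eq_integrable mc (EFin \o expfun (laplace_path t))).
    by move=> X _; rewrite /= weight0.
  by apply: integrable_expfun => //; left; apply: posdef_laplace_path; exact: lt_trans ut.
- by move=> X; rewrite addr_ge0// invr_ge0 subr_ge0 ltW.
- exact: icst.
- move=> t X /t1 /ltW ut cX; rewrite weight0.
  by rewrite -normrN -mulNr dTE; exact: laplace_path_bound.
- by rewrite in_itv/= us /v ltrDl ltr01.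
Qed.

End laplace_ode.

Section laplace_stein.
Context {R : realType} {d : nat}.
Local Notation M := 'M[R]_d.
Local Notation cone := (@posdefmx R d).

(** The path tends to the zero matrix, where the Laplace transform is the total mass 1; the
    functions [expfun] are at most 1 on the cone, so dominated convergence applies. *)
Lemma cvg_laplace_path (m : {measure set M -> \bar R}) (Sigma Psi : M) (s : R) :
  m cone = 1%E -> posdefmx Sigma -> posdefmx Psi -> 1 < s ->
  laplace m (laplace_path Sigma Psi (s + n.+1%:R)) @[n --> \oo] --> (1 : R).
Proof.
move=> mT pS pP s1; have mc := @measurable_posdefmx R d.
have sn1 n : 1 < s + n.+1%:R by rewrite ltr_wpDr.
have pT n := posdef_laplace_path pS pP (sn1 n).
have ie Th (h : posdefmx Th \/ Th = 0) : m.-integrable cone (EFin \o expfun Th).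
  exact: integrable_expfun.
have pA : posdefmx (Psi + 2 *: Sigma) by apply: posdefD => //; exact: posdefZ.
have E1 : laplace m 0 = 1.
  transitivity (\int[m]_(X in cone) (cst (1 : R) X)).
    by apply: eq_Rintegral => X _; rewrite expfun0.
  by rewrite Rintegral_cst//= [X in fine X]mT mul1r.
have iE n : (laplace m (laplace_path Sigma Psi (s + n.+1%:R)))%:E =
    (\int[m]_(X in cone) (expfun (laplace_path Sigma Psi (s + n.+1%:R)) X)%:E)%E.
  by rewrite fineK//; apply: integrable_fin_num => //; apply: ie; left.
suff h : (laplace m (laplace_path Sigma Psi (s + n.+1%:R)))%:E @[n --> \oo] --> (1%:E : \bar R).
  exact: (fine_cvg h).
have i0 : (1%:E = \int[m]_(X in cone) (expfun 0 X)%:E)%E.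
  rewrite -E1; apply: fineK; apply: integrable_fin_num => //; apply: ie; by right.
under eq_fun do rewrite iE; rewrite i0.
apply: (@dominated_cvg _ _ _ m cone mc _ _ (EFin \o expfun 0)) => //.
- by move=> n; apply: measurable_int (ie _ (or_introl (pT n))).
- move=> X cX; apply: cvg_EFin; first exact: nearW.
  rewrite expfun0 -[X in _ --> X]expR0 /comp/= /expfun.
  suff c : - \tr (laplace_path Sigma Psi (s + n.+1%:R) *m X) @[n --> \oo] --> (0 : R).
    exact: (cvg_comp _ _ c (@continuous_expR R 0)).
  rewrite -[X in _ --> X]oppr0; apply: cvgN.
  (* In terms of r the path is r (A + r Psi)^-1 with A = Psi + 2 Sigma: a factor tending to 0 times
     a matrix tending to A^-1. *)
  pose r n : R := (s + n.+1%:R - 1)^-1.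
  have rc : r n @[n --> \oo] --> 0.
    apply: (@squeeze_cvgr _ _ _ _ (cst 0) harmonic) => //; last 2 first.
    - exact: cvg_cst.
    - exact: cvg_harmonic.
    apply: nearW => n; rewrite invr_ge0 subr_ge0 ltW//=.
    by rewrite lef_pV2 ?posrE ?subr_gt0//; lra.
  have r0 n : 0 < r n by rewrite invr_gt0 subr_gt0.
  have E n : \tr (laplace_path Sigma Psi (s + n.+1%:R) *m X) =
      r n * \tr (invmx (Psi + 2 *: Sigma + (r n - 0) *: Psi) *m X).
    have rE : s + n.+1%:R - 1 = (r n)^-1 by rewrite invrK.
    rewrite -trace_scale_mul /laplace_path rE; congr (\tr (_ *m _)).
    have rn := lt0r_neq0 (r0 n).
    have -> : Psi + (r n)^-1 *: (Psi + 2 *: Sigma) =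
       (r n)^-1 *: (Psi + 2 *: Sigma + (r n - 0) *: Psi).
      by move: (r n) rn => x x0; apply/matrixP => i j; rewrite !mxE; field.
    have un : (r n)^-1 \is a GRing.unit by rewrite unitfE invr_neq0.
    rewrite invmxZ; first by rewrite [_^-1^-1]invrK.
    rewrite unitmxZ//; apply: posdef_unit; apply: posdefD => //; apply: posdefZ => //.
    by rewrite subr0.
  suff c : r n * \tr (invmx (Psi + 2 *: Sigma + (r n - 0) *: Psi) *m X) @[n --> \oo] --> (0 : R).
    by move: c; rewrite -(funext E).
  rewrite -[X in _ --> X](mul0r (\tr (invmx (Psi + 2 *: Sigma) *m X))).
  apply: cvgM => //; apply: cvg_sumr => i _.
  under eq_fun do rewrite mxE; rewrite mxE; apply: cvg_sumr => j _.
  apply: cvgM; last exact: cvg_cst.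
  apply: cvg_invmx; last 2 first.
  + exact: posdef_unit.
  + move=> k l; pose q := (Psi + 2 *: Sigma) k l.
    have : q + r t * Psi k l @[t --> \oo] --> q + 0 * Psi k l.
      by apply: cvgD; [exact: cvg_cst|apply: cvgM => //; exact: cvg_cst].
    rewrite mul0r addr0; apply: cvg_trans; apply: near_eq_cvg; apply: nearW => t.
    by rewrite [in RHS]mxE [in RHS]mxE subr0 /q !mxE.
  apply: nearW => n; apply: posdef_unit; apply: posdefD => //; apply: posdefZ => //.
  by rewrite subr0.
- by apply: ie; right.
- move=> n X cX; rewrite /= expfun0 lee_fin ger0_norm ?expR_ge0//.
  by apply: expfun_le1; apply: psd_trace_mul_ge0 => //; exact: posdef_psd.
Qed.

Lemma laplace_gt0 (m : {measure set M -> \bar R}) (Th : M) : m cone = 1%E ->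
  posdefmx Th -> 0 < laplace m Th.
Proof.
move=> mT pT; have mc := @measurable_posdefmx R d.
have ie : m.-integrable cone (EFin \o expfun Th) by apply: integrable_expfun => //; left.
rewrite lt_def Rintegral_ge0 ?andbT; last by move=> X _; exact: expR_ge0.
apply/eqP => l0; have := @integral_gt0_neq0 _ _ _ m cone (expfun Th) mc.
apply => //.
- by apply: cont_cone_measurable; exact: cont_cone_expfun.
- by move=> X _; exact: expR_gt0.
- by rewrite mT => /eqP; rewrite onee_eq0.
- by rewrite -[LHS]fineK; [congr EFin; exact: l0|exact: (integrable_fin_num mc ie)].
Qed.

(** Both transforms solve the same linear equation along the path, so their quotient is constant,
    and both tend to 1 at infinity. *)
Lemma laplace_stein_unique (m1 m2 : {measure set M -> \bar R}) alpha (Sigma : M) :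
  m1 cone = 1%E -> m2 cone = 1%E -> posdefmx Sigma ->
  (forall Th, posdefmx Th ->
    (\int[m1]_(X in cone) (stein_op alpha Sigma (expfun Th) X)%:E = 0)%E) ->
  (forall Th, posdefmx Th ->
    (\int[m2]_(X in cone) (stein_op alpha Sigma (expfun Th) X)%:E = 0)%E) ->
  forall Th, posdefmx Th -> laplace m1 Th = laplace m2 Th.
Proof.
move=> m1T m2T pS st1 st2 Th pT.
have piT := posdef_inv pT.
(* To pass through [Th] at time s, a path needs s Psi = Th^-1 - 2 (s - 1) Sigma. This is positive
   definite for s slightly above 1, because the cone is open along symmetric lines. *)
have [s s1 pP0] : exists2 s, 1 < s & posdefmx (invmx Th + (s - 1) *: (- 2 *: Sigma)).
  have sH : (- 2 *: Sigma)^T = - 2 *: Sigma by rewrite linearZ/= pS.1.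
  have p1 : posdefmx (invmx Th + ((1 : R) - 1) *: (- 2 *: Sigma)).
    by rewrite subrr scale0r addr0.
  have /nbhs_ballP[e /= e0 he] := near_line_posdef piT.1 sH p1.
  exists (1 + e / 2); first by rewrite ltrDl divr_gt0.
  apply: he; rewrite /ball/= opprD addrA subrr add0r normrN gtr0_norm ?divr_gt0//.
  by lra.
have s0 : 0 < s by exact: lt_trans s1.
pose Psi := s^-1 *: (invmx Th + (s - 1) *: (- 2 *: Sigma)).
have pP : posdefmx Psi by apply: posdefZ => //; rewrite invr_gt0.
have ThE : laplace_path Sigma Psi s = Th.
  rewrite /laplace_path -[RHS]invmxK; congr invmx.
  by apply/matrixP => i j; rewrite !mxE; field; rewrite gt_eqF.
pose K := (laplace m1 \o laplace_path Sigma Psi) * (fun t => (laplace m2 (laplace_path Sigma Psi t))^-1).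
have dK (t : R) : 1 < t -> is_derive t (1 : R) K 0.
  move=> t1; have d1 := is_derive_laplace_path m1T pS pP st1 t1.
  have d2 := is_derive_laplace_path m2T pS pP st2 t1.
  have p0 := laplace_gt0 m2T (posdef_laplace_path pS pP t1).
  have d3 := is_deriveV (lt0r_neq0 p0) d2.
  rewrite /K; apply: is_derive_eq; rewrite /GRing.scale/=; field.
  by rewrite !gt_eqF//; exact: lt_trans t1.
have Kcst n : K (s + n.+1%:R) = K s.
  have [|||c _] := @MVT _ K (cst 0) s (s + n.+1%:R).
  - by rewrite ltrDl.
  - by move=> x; rewrite in_itv/= => /andP[sx _]; apply: dK; exact: lt_trans sx.
  - apply: derivable_within_continuous => x; rewrite in_itv/= => /andP[sx _].
    by have [] := dK _ (lt_le_trans s1 sx).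
  by rewrite mul0r => /eqP; rewrite subr_eq0 => /eqP.
have : K (s + n.+1%:R) @[n --> \oo] --> (1 * 1^-1 : R).
  apply: cvgM; first exact: cvg_laplace_path.
  by apply: cvgV => //; exact: cvg_laplace_path.
under eq_fun do rewrite Kcst.
move=> h; have := cvg_lim (@norm_hausdorff R R^o) h.
rewrite lim_cst; last exact: (@norm_hausdorff R R^o).
move=> /(_ _) E.
have {}E : K s = 1 by rewrite E invr1 mulr1.
have p0 := laplace_gt0 m2T (posdef_laplace_path pS pP s1).
rewrite -ThE; apply: (mulIf (lt0r_neq0 (_ : 0 < (laplace m2 (laplace_path Sigma Psi s))^-1))).
  by rewrite invr_gt0.
by rewrite mulfV ?gt_eqF.
Qed.

End laplace_stein.

(** * The law of the random matrix as a measure on the cone *)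

Section random_matrix.
Context {R : realType} {d : nat} {disp} {T : measurableType disp}.
Local Notation M := 'M[R]_d.
Local Notation cone := (@posdefmx R d).
Variables (P : probability T R) (W : {RV P >-> M}).
Hypothesis Wc : forall w, posdefmx (W w).

Let preim_cone : W @^-1` cone = setT.
Proof. by apply/seteqP; split=> w // _; exact: Wc. Qed.

Lemma distribution_setI_cone V : distribution P W V = distribution P W (V `&` cone).
Proof. by rewrite /distribution /pushforward preimage_setI preim_cone setIT. Qed.

Lemma distribution_cone : distribution P W cone = 1%E.
Proof. by rewrite /distribution /pushforward preim_cone probability_setT. Qed.

Let mcomp (g : M -> R) : measurable_fun cone g -> measurable_fun setT (g \o W).
Proof.
move=> mg; rewrite (_ : g \o W = (g \_ cone) \o W); last first.
  by apply/funext => w; rewrite /= patchE mem_set//; exact: Wc.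
apply: measurableT_comp => //.
by apply/(measurable_restrictT _ _).1 => //; exact: measurable_posdefmx.
Qed.

Lemma integrable_distribution_cone (g : M -> R) : measurable_fun cone g ->
  (distribution P W).-integrable cone (EFin \o g) <->
  P.-integrable setT (EFin \o (g \o W)).
Proof.
move=> mg; have mc := @measurable_posdefmx R d.
have E : (\int[distribution P W]_(X in cone) `|(g X)%:E| =
    \int[P]_w `|(g (W w))%:E|)%E.
  rewrite ge0_integral_pushforward//; first by rewrite preim_cone.
  by apply: measurableT_comp => //; exact/measurable_EFinP.
split=> /integrableP[_ i]; apply/integrableP; split.
- exact/measurable_EFinP/mcomp.
- by rewrite -E.
- exact/measurable_EFinP.
- by rewrite E.
Qed.

Lemma integral_distribution_cone (g : M -> R) : measurable_fun cone g ->
  P.-integrable setT (EFin \o (g \o W)) ->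
  (\int[distribution P W]_(X in cone) (g X)%:E = 'E_P[g \o W])%E.
Proof.
move=> mg ig; have mc := @measurable_posdefmx R d.
have gW w : (g \_ cone) (W w) = g (W w) by rewrite patchE mem_set//; exact: Wc.
rewrite (eq_integral (EFin \o (g \_ cone))); last first.
  by move=> X cX; rewrite /= patchE cX.
rewrite unlock integral_pushforward//.
- by rewrite preim_cone; apply: eq_integral => w _; rewrite /= gW.
- apply/measurable_EFinP.
  by apply/(measurable_restrictT _ _).1 => //; exact: measurable_posdefmx.
- rewrite preim_cone; apply: eq_integrable ig => // w _.
  by rewrite /= gW.
Qed.

End random_matrix.

Theorem corollary3p3 (R : realType) (d : nat) (d_gt0 : (0 < d)%N)
    (alpha : R) (alpha_gt : d%:R - 1 < alpha)
    (Sigma : 'M[R]_d) (Sigma_posdef : posdefmx Sigma)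
    (disp : measure_display) (T : measurableType disp) (P : probability T R)
    (W : {RV P >-> 'M[R]_d}) (W_posdef : forall w, posdefmx (W w)) :
  (forall V : set 'M[R]_d, measurable V ->
     distribution P W V = wishart alpha Sigma V)
  <->
  (forall f : 'M[R]_d -> R, C2_stein alpha Sigma f ->
     P.-integrable setT (EFin \o (stein_op alpha Sigma f \o W)) /\
     ('E_P[stein_op alpha Sigma f \o W] = 0)%E).
Proof.
have mc := @measurable_posdefmx R d; set cone := [set S : 'M[R]_d | posdefmx S] in mc.
have mA f : C2_posdef f -> measurable_fun cone (stein_op alpha Sigma f).
  by move=> hf; apply: cont_cone_measurable; exact: cont_cone_stein_op.
split=> [H f hf|H].
  (* The distribution has mass one on the cone, so an equal Wishart measure cannot be the zero
     measure. *)
  have g0 : multigamma (d := d) (alpha / 2) <> 0.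
    move=> /(wishart_degenerate Sigma) => g0.
    have := H _ mc; rewrite distribution_cone// g0 => /eqP.
    by rewrite onee_eq0.
  have [i0 e0] := wishart_stein Sigma_posdef g0 hf.
  have hf2 : C2_posdef f by case: hf.
  have i1 : P.-integrable setT (EFin \o (stein_op alpha Sigma f \o W)).
    apply/integrable_distribution_cone => //; first exact: mA.
    have /integrableP[m i] := i0; apply/integrableP; split=> //.
    rewrite (eq_measure_integral (wishart alpha Sigma))// => A mA' _.
    exact: H.
  split=> //; rewrite -integral_distribution_cone//; last exact: mA.
  rewrite -[RHS]e0; apply: eq_measure_integral => A mA' _.
  exact: H.
have mD := distribution_cone W_posdef.
have iE f : C2_stein alpha Sigma f ->
    (\int[distribution P W]_(X in cone) (stein_op alpha Sigma f X)%:E = 0)%E.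
  move=> hf; have [i0 e0] := H f hf.
  by rewrite integral_distribution_cone//; apply: mA; case: hf.
have g0 : multigamma (d := d) (alpha / 2) <> 0.
  move=> /(wishart_degenerate Sigma) w0.
  have fm g : finite_mean (wishart alpha Sigma) g.
    rewrite /finite_mean (eq_measure_integral mzero); last by move=> A _ _; exact: w0.
    by rewrite integral_measure_zero ltry.
  pose Th := - invmx Sigma.
  have piS := posdef_inv Sigma_posdef.
  have sT : Th^T = Th by rewrite /Th linearN/= piS.1.
  have hTh : C2_stein alpha Sigma (expfun Th) by split=> //; exact: C2_posdef_expfun.
  apply: (integral_gt0_neq0 mc (mA _ (C2_posdef_expfun Th)) _ _ (iE _ hTh)); last first.
    by move=> /eqP; rewrite [X in X == _]mD onee_eq0.
  move=> S cS; rewrite stein_op_expfun// mulr_gt0 ?expR_gt0//.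
  (* At Th = - Sigma^-1 the bracket of [stein_op_expfun] is (4 - 2) tr (Sigma^-1 S) + 2 alpha d. It
     is positive because alpha > d - 1 >= 0. *)
  have -> : \tr (Th *m Sigma *m Th *m S) = \tr (invmx Sigma *m S).
    by rewrite /Th !mulNmx mulVmx ?posdef_unit// !mulmxN !mulNmx opprK mul1mx.
  rewrite /Th mulNmx linearN/= mulmxN linearN/= mulmxV ?posdef_unit// mxtrace1.
  have t0 := posdef_trace_mul_gt0 d_gt0 piS cS.
  have d1 : 1 <= d%:R :> R by rewrite ler1n.
  by nra.
have W1 := wishart_mass Sigma_posdef g0.
have hTh Th : posdefmx Th -> C2_stein alpha Sigma (expfun Th).
  by move=> pT; apply: C2_stein_expfun => //; rewrite W1 ltry.
have L := laplace_stein_unique mD W1 Sigma_posdef (fun Th p => iE _ (hTh Th p))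
  (fun Th p => (wishart_stein Sigma_posdef g0 (hTh Th p)).2).
move=> V mV; apply: (laplace_unique d_gt0 _ _ mD W1) => //.
- exact: distribution_setI_cone.
- exact: wishart_setI_cone.
move=> Th pT; have := L Th pT; rewrite /laplace /Rintegral => E.
rewrite -[LHS]fineK ?E ?fineK//; apply: integrable_fin_num => //; by apply: integrable_expfun => //; left.
Qed.
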